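(* Let $\mathcal G$ be a finite groupoid, and let $D$ be a fundamental domain of $\mathcal G$. There is a ${}^*$-representation of $\mathbb C\mathcal G$ on $\int_D^\oplus l^2(s^*x)\,d\mu(x)$ which sends an operator $T\in\mathbb C\mathcal G$ to $\int_D^\oplus T_x\,d\mu(x)$. Under this representation $$\tau_{\mathcal G}(T)=\int_D\frac{\operatorname{tr}(T_x)}{|\operatorname{St}(x,\mathcal G)|}\,d\mu(x).$$ In particular $$\dim_{vN}\ker T=\int_D\frac{\dim\ker T_x}{|\operatorname{St}(x,\mathcal G)|}\,d\mu(x).$$
   Context: Measurable spaces are standard Borel spaces; all sets and functions are measurable. A groupoid $\mathcal G$ is a small category all of whose morphisms are invertible; $\mathcal G_0$ is its set of objects, $\mathcal G$ also denotes its set of morphisms, and $\mathcal G_0\subset\mathcal G$ via identity morphisms. $s,r\colon\mathcal G\to\mathcal G_0$ are source and range; the composition of $\gamma\colon x\to y$ and $\gamma'\colon y\to z$ is written $\gamma\gamma'\colon x\to z$; $i(\gamma)=\gamma^{-1}$. $s^*x:=s^{-1}(x)$; the orbit $\mathcal Gx$ is the set of $y$ admitting a morphism from $x$; $\operatorname{St}(x,\mathcal G)=\{\alpha\in\mathcal G: s(\alpha)=r(\alpha)=x\}$. All groupoids are discrete measured: $\mathcal G$ is a measurable space, $\mathcal G_0$ a measurable subset, $s,r$ have countable fibers, the structure maps are measurable, and $\mathcal G_0$ carries a (finite) measure $\mu$ such that $U\mapsto\int_{\mathcal G_0}|r^{-1}(x)\cap U|\,d\mu(x)$ and $U\mapsto\int_{\mathcal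 G_0}|s^{-1}(x)\cap U|\,d\mu(x)$ coincide; this measure on $\mathcal G$ is also denoted $\mu$, and $L^2(\mathcal G)$ is taken with respect to it. A measurable edge is a map $\phi\colon \operatorname{Dom}(\phi)\to\mathcal G$, $\operatorname{Dom}(\phi)\subset\mathcal G_0$, such that $s\circ\phi$ is the inclusion and $r\circ\phi$ is injective. Its inverse $\phi^{-1}$ has domain $r(\operatorname{Im}\phi)$ and $\phi^{-1}(r(\phi(x)))=i(\phi(x))$. A measurable edge acts on $L^2(\mathcal G)$ by $\phi(F)(\gamma)=F(\gamma\,\phi^{-1}(r(\gamma)))$ if $r(\gamma)\in\operatorname{Dom}(\phi^{-1})$ and $0$ otherwise; $f\in L^\infty(\mathcal G_0)$ acts by $f(F)(\gamma)=f(r(\gamma))F(\gamma)$. The groupoid ring $\mathbb C\mathcal G$ is the ring (in fact ${}^*$-ring) of bounded operators on $L^2(\mathcal G)$ generated by measurable edges and $L^\infty(\mathcal G_0)$; each of its elements is a finite sum $T=\sum_i\phi_if_i$ with $\phi_i$ measurable edges and $f_i\in L^\infty(\mathcal G_0)$. The trace is $\tau_{\mathcal G}(T)=\langle T\chi_0,\chi_0\rangle_{L^2(\mathcal G)}$, $\chi_0$ the characteristic function of $\mathcal G_0\subset\mathcal G$; it is positive, faithful and normal. $\dim_{vN}\ker T$ is $\tau_{\mathcal G}$ (extended to the weak closure) of the projection onto $\ker T$ for self-adjoint $T$, and $\dim_{vN}\ker T:=\dim_{vN}\ker T^*T$ in general. For $T=\sum_i\phi_if_i$ and $x\in\mathcal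 G_0$, $T_x\colon l^2(s^*x)\to l^2(s^*x)$ is the operator (the convolution operator on the Cayley diagram of $x$) given on the standard basis vectors by $T_x\zeta_\alpha=\sum_{i:\ r(\alpha)\in\operatorname{Dom}(\phi_i)}f_i(r(\alpha))\,\zeta_{\alpha\,\phi_i(r(\alpha))}$. The field $x\mapsto l^2(s^*x)$ is measurable via the sections $S_\phi(x)=\zeta_{\phi(x)}$ if $x\in \operatorname{Dom}(\phi)$, $0$ otherwise, where $\phi$ ranges over a countable family of measurable edges with disjoint images covering $\mathcal G$. $\mathcal G$ is finite if $s^*x$ is finite for almost all $x$. A fundamental domain is a measurable $D\subset\mathcal G_0$ such that every finite orbit intersects $D$ exactly once. $\operatorname{tr}$ is the usual (non-normalized) trace. *)

(* Defs.v *)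
From HB Require Import structures.
From mathcomp Require Import all_boot all_order all_algebra.
From mathcomp Require Import finmap generic_quotient ring_quotient.
From mathcomp Require Import all_classical all_reals all_analysis.
From mathcomp Require Import measurable_realfun complex.
From mathcomp Require Import ring lra.

Set Implicit Arguments.
Unset Strict Implicit.
Unset Printing Implicit Defensive.

Import Order.TTheory GRing.Theory Num.Theory.
Local Open Scope classical_set_scope.
Local Open Scope ring_scope.

Section ComplexValued.
Context {R : realType}.
Local Notation C := R[i].

Definition normsq (z : C) : R := complex.Re z ^+ 2 + complex.Im z ^+ 2.

Definition cmeasurable d (T : measurableType d) (D : set T) (f : T -> C) :=
  measurable_fun D (fun x => complex.Re (f x)) /\
  measurable_fun D (fun x => complex.Im (f x)).

Definition cintegrable d (T : measurableType d) (mu : {measure set T -> \bar R})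
    (D : set T) (f : T -> C) :=
  mu.-integrable D (fun x => (complex.Re (f x))%:E) /\
  mu.-integrable D (fun x => (complex.Im (f x))%:E).

Definition cintegral d (T : measurableType d) (mu : {measure set T -> \bar R})
    (D : set T) (f : T -> C) : C :=
  Complex (Rintegral mu D (fun x => complex.Re (f x)))
          (Rintegral mu D (fun x => complex.Im (f x))).

(** Meaningful for absolutely summable families. *)
Definition rsum (T : choiceType) (A : set T) (f : T -> R) : R :=
  fine (\esum_(a in A) (Num.max (f a) 0)%:E) -
  fine (\esum_(a in A) (Num.max (- f a) 0)%:E).

Definition csum (T : choiceType) (A : set T) (f : T -> C) : C :=
  Complex (rsum A (fun a => complex.Re (f a)))
          (rsum A (fun a => complex.Im (f a))).

(** For [A : set T], a vector of l^2(A) is represented by a function on [T]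
    that vanishes outside [A]. *)

Definition l2norm2 (T : choiceType) (A : set T) (xi : T -> C) : \bar R :=
  (\esum_(a in A) (normsq (xi a))%:E)%E.

Definition l2 (T : choiceType) (A : set T) : set (T -> C) :=
  [set xi | (forall a, ~ A a -> xi a = 0) /\ (l2norm2 A xi < +oo)%E].

Definition l2ip (T : choiceType) (A : set T) (xi eta : T -> C) : C :=
  csum A (fun a => xi a * conjc (eta a)).

Definition zeta (T : choiceType) (a : T) : T -> C := fun b => (b == a)%:R.

Lemma ReD (x y : C) : complex.Re (x + y) = complex.Re x + complex.Re y.
Proof. by case: x; case: y. Qed.

Lemma ImD (x y : C) : complex.Im (x + y) = complex.Im x + complex.Im y.
Proof. by case: x; case: y. Qed.

Lemma ReM (x y : C) : complex.Re (x * y) =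
  complex.Re x * complex.Re y - complex.Im x * complex.Im y.
Proof. by case: x; case: y. Qed.

Lemma ImM (x y : C) : complex.Im (x * y) =
  complex.Re x * complex.Im y + complex.Im x * complex.Re y.
Proof. by case: x; case: y. Qed.

Lemma normsq_ge0 z : 0 <= normsq z.
Proof. by rewrite addr_ge0 ?sqr_ge0. Qed.

Lemma normsq0 : normsq 0 = 0.
Proof. by rewrite /normsq /= expr0n addr0. Qed.

Lemma normsq_lin (a x y : C) :
  normsq (a * x + y) <= 2 * normsq a * normsq x + 2 * normsq y.
Proof.
rewrite /normsq ReD ImD ReM ImM.
move: (complex.Re a) (complex.Im a) (complex.Re x) (complex.Im x)
  (complex.Re y) (complex.Im y) => p q r s u v.
have h1 := sqr_ge0 (p * r - q * s - u).
have h2 := sqr_ge0 (p * s + q * r - v).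
nra.
Qed.

Section Closure.
Context d (T : measurableType d) (D : set T).

Lemma cmeasurable0 : cmeasurable D (fun=> 0).
Proof. by split; apply: measurable_cst. Qed.

Lemma cmeasurable_lin (a : C) (f g : T -> C) : cmeasurable D f ->
  cmeasurable D g -> cmeasurable D (fun x => a * f x + g x).
Proof.
move=> [f1 f2] [g1 g2]; split.
  under eq_fun do rewrite ReD ReM.
  apply: measurable_funD => //; apply: measurable_funB.
    exact: measurable_funM.
  exact: measurable_funM.
under eq_fun do rewrite ImD ImM.
apply: measurable_funD => //; apply: measurable_funD.
  exact: measurable_funM.
exact: measurable_funM.
Qed.

Lemma measurable_normsq (f : T -> C) : cmeasurable D f ->
  measurable_fun D (fun x => normsq (f x)).
Proof. by case=> *; apply: measurable_funD; apply: measurable_funX. Qed.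

Lemma integral_lin_lty (mu : {measure set T -> \bar R}) (mD : measurable D)
    (k l : R) (f g h : T -> \bar R) :
  0 <= k -> 0 <= l ->
  (forall x, D x -> 0 <= f x)%E -> (forall x, D x -> 0 <= g x)%E ->
  (forall x, D x -> 0 <= h x)%E ->
  measurable_fun D f -> measurable_fun D g -> measurable_fun D h ->
  (forall x, D x -> h x <= k%:E * f x + l%:E * g x)%E ->
  (\int[mu]_(x in D) f x < +oo -> \int[mu]_(x in D) g x < +oo ->
   \int[mu]_(x in D) h x < +oo)%E.
Proof.
move=> k0 l0 f0 g0 h0 mf mg mh le foo goo.
have mkf : measurable_fun D (fun x => k%:E * f x)%E.
  exact: measurable_funeM.
have mlg : measurable_fun D (fun x => l%:E * g x)%E.
  exact: measurable_funeM.
apply: (@le_lt_trans _ _ (\int[mu]_(x in D) (k%:E * f x + l%:E * g x))%E).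
  apply: ge0_le_integral => //.
  exact: emeasurable_funD.
rewrite ge0_integralD//; last 2 first.
  by move=> x Dx; rewrite mule_ge0 ?lee_fin ?f0.
  by move=> x Dx; rewrite mule_ge0 ?lee_fin ?g0.
rewrite ge0_integralZl// ge0_integralZl//.
by rewrite lte_add_pinfty// lte_mul_pinfty// ?lee_fin// ge0_fin_numE//;
  apply: integral_ge0.
Qed.

End Closure.

Lemma rsum_supp1 (T : choiceType) (A : set T) (b : T) (f : T -> R) : A b ->
  (forall a, a <> b -> f a = 0) -> rsum A f = f b.
Proof.
move=> Ab f0.
have key (g : T -> R) : (forall a, 0 <= g a) ->
    (forall a, a <> b -> g a = 0) -> fine (\esum_(a in A) (g a)%:E) = g b.
  move=> g0 gb; rewrite (esumID [set b])//; last by move=> *; rewrite lee_fin.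
  rewrite [X in (_ + X)%E]esum1 ?adde0; last first.
    by move=> a [_ /= ab]; rewrite gb.
  rewrite setIC (setIidl _)//; last by move=> _ ->.
  by rewrite esum_set1// lee_fin.
rewrite /rsum !key.
- by case: (leP (f b) 0) => h; [rewrite max_l|rewrite max_r]; lra.
- by move=> a; rewrite le_max lexx orbT.
- by move=> a ab; rewrite f0// oppr0 maxxx.
- by move=> a; rewrite le_max lexx orbT.
- by move=> a ab; rewrite f0// maxxx.
Qed.

Lemma l2ip_zeta (T : choiceType) (A : set T) (b : T) (xi : T -> C) : A b ->
  l2ip A xi (zeta b) = xi b.
Proof.
move=> Ab; rewrite /l2ip /csum !(@rsum_supp1 _ _ b)//.
- by rewrite /zeta eqxx conjc1 mulr1; case: (xi b).
- by move=> a /eqP ab; rewrite /zeta (negPf ab) conjc0 mulr0.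
- by move=> a /eqP ab; rewrite /zeta (negPf ab) conjc0 mulr0.
Qed.

Lemma l2ip0 (T : choiceType) (A : set T) (xi : T -> C) : l2ip A xi 0 = 0.
Proof.
rewrite /l2ip /csum /rsum.
have z a : xi a * conjc ((0 : T -> C) a) = 0 by rewrite conjc0 mulr0.
by rewrite !esum1 ?subrr// => a _; rewrite z/= ?oppr0 maxxx.
Qed.

End ComplexValued.

Section AeQuotient.
Context d (X : measurableType d) (R : realType) (mu : {measure set X -> \bar R})
  (D : set X) (W : lmodType R[i]) (S : submodClosed (X -> W)).

Record field := Field { field_fun :> X -> W ; _ : field_fun \in S }.

HB.instance Definition _ := [isSub for field_fun].
HB.instance Definition _ := [Choice of field by <:].
HB.instance Definition _ := [SubChoice_isSubLmodule of field by <:].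

Definition ae_null : {pred field} :=
  fun f => `[< {ae mu, forall x, D x -> f x = 0} >].

Lemma ae_null_submod : submod_closed ae_null.
Proof.
split; first by apply/asboolP; apply: aeW => x _.
move=> a f g /asboolP f0 /asboolP g0; apply/asboolP.
apply: filterS2 f0 g0 => x fx gx Dx.
by rewrite -[LHS]/(a *: f x + g x) fx// gx// scaler0 addr0.
Qed.

HB.instance Definition _ :=
  GRing.isSubmodClosed.Build _ _ ae_null ae_null_submod.

Definition aeq : Type := Quotient.quot ae_null.
HB.instance Definition _ := GRing.Zmodule.on aeq.

Local Open Scope quotient_scope.

Definition aeq_repr (F : aeq) : X -> W := repr (F : Quotient.quot ae_null).
Coercion aeq_repr : aeq >-> Funclass.

(** The class of [f] if [f] belongs to [S], and 0 otherwise. *)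
Definition aeq_class (f : X -> W) : aeq :=
  \pi_(Quotient.quot ae_null) (insubd 0 f : field).

Definition aeq_scale (a : R[i]) (F : aeq) : aeq :=
  \pi_(Quotient.quot ae_null) (a *: (repr (F : Quotient.quot ae_null) : field)).

Let pi_scale a (f : field) : \pi_(Quotient.quot ae_null) (a *: f) =
  aeq_scale a (\pi_(Quotient.quot ae_null) f).
Proof.
apply/eqP; rewrite -Quotient.idealrBE -scalerBr rpredZ//.
by rewrite Quotient.idealrBE reprK.
Qed.

Let pi_add (f g : field) : \pi_(Quotient.quot ae_null) (f + g) =
  \pi_(Quotient.quot ae_null) f + \pi_(Quotient.quot ae_null) g.
Proof. by rewrite !piE. Qed.

Let aeq_ind (P : aeq -> Prop) :
  (forall f : field, P (\pi_(Quotient.quot ae_null) f)) -> forall F, P F.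
Proof. by move=> h F; rewrite -[F](@reprK _ (Quotient.quot ae_null)). Qed.

Lemma aeq_scaleA a b F : aeq_scale a (aeq_scale b F) = aeq_scale (a * b) F.
Proof. by elim/aeq_ind: F => f; rewrite -!pi_scale scalerA. Qed.

Lemma aeq_scale1 : left_id 1 aeq_scale.
Proof. by elim/aeq_ind => f; rewrite -!pi_scale scale1r. Qed.

Lemma aeq_scaleDr : right_distributive aeq_scale +%R.
Proof.
move=> a; elim/aeq_ind => f; elim/aeq_ind => g.
by rewrite -pi_add -!pi_scale scalerDr pi_add.
Qed.

Lemma aeq_scaleDl F : {morph aeq_scale^~ F : a b / a + b}.
Proof.
move=> a b; elim/aeq_ind: F => f.
by rewrite -!pi_scale scalerDl pi_add.
Qed.

HB.instance Definition _ := GRing.Zmodule_isLmodule.Build R[i] aeq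
  aeq_scaleA aeq_scale1 aeq_scaleDr aeq_scaleDl.

Lemma aeq_eq (F G : aeq) :
  F = G <-> {ae mu, forall x, D x -> F x = G x}.
Proof.
split=> [->|FG]; first exact: aeW.
rewrite -[F](@reprK _ (Quotient.quot ae_null)).
rewrite -[G](@reprK _ (Quotient.quot ae_null)).
apply/eqP; rewrite -Quotient.idealrBE; apply/asboolP.
apply: filterS FG => x FG Dx.
by apply/eqP; rewrite subr_eq0; apply/eqP; exact: FG.
Qed.

Lemma aeq_classE (f : X -> W) : f \in S ->
  {ae mu, forall x, D x -> aeq_class f x = f x}.
Proof.
move=> fS.
have /asboolP : repr (\pi_(Quotient.quot ae_null) (insubd 0 f : field)) -
    (insubd 0 f : field) \in ae_null by rewrite Quotient.idealrBE reprK.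
apply: filterS => x h Dx; apply/eqP; rewrite -subr_eq0; apply/eqP.
have := h Dx; rewrite -[LHS]/(aeq_class f x - (insubd 0 f : field) x).
by rewrite -[X in _ - X x]/(val (insubd 0 f : field)) insubdK.
Qed.

End AeQuotient.

Section Operators.
Context {R : realType} {V : lmodType R[i]} (ip : V -> V -> R[i]).

Definition ipnorm (v : V) : R := Num.sqrt (complex.Re (ip v v)).

Definition bounded_op (A : V -> V) :=
  linear A /\ exists M : R, forall v, ipnorm (A v) <= M * ipnorm v.

(** The value is 0 if there is no adjoint (no orthogonal projection onto [K]);
    both are unique when [ip] is definite. *)
Definition adjoint (A : V -> V) : V -> V :=
  xget 0 [set B | forall u v, ip (A u) v = ip u (B v)].

Definition orthoproj (K : set V) : V -> V :=
  xget 0 [set P | forall v, K (P v) /\ forall w, K w -> ip (v - P v) w = 0].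

Definition ker (A : V -> V) : set V := [set v | A v = 0].

End Operators.

Definition has_dim (K : pzRingType) (V : lmodType K) (A : set V) (n : nat) :=
  exists v : 'I_n -> V,
    (forall c : 'I_n -> K, \sum_i c i *: v i = 0 -> forall i, c i = 0) /\
    A = [set w | exists c : 'I_n -> K, w = \sum_i c i *: v i].

(** The value is 0 for infinite-dimensional subspaces. *)
Definition dimension (K : pzRingType) (V : lmodType K) (A : set V) : nat :=
  xget 0%N [set n | has_dim A n].

(** The sigma-algebra is the Borel sigma-algebra of a Polish space. *)
Definition standard_borel (R : realType) d (T : measurableType d) :=
  exists (P : completePseudoMetricType R) (f : T -> P),
    [/\ hausdorff_space P,
        exists2 A : set P, countable A & dense A,
        bijective f &
        forall U : set T, measurable U <-> (<<s @open P >>) (f @` U)].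

(** Objects and morphisms have distinct types [G0] and [G], and [gid] plays the
    role of the inclusion of [G0] in [G].  The composition [gcomp a b] means
    "first a, then b" and is unspecified when [gr a <> gs b]. *)
Record groupoid (R : realType) d0 d (G0 : measurableType d0)
    (G : measurableType d) := Groupoid {
  gs : G -> G0 ;
  gr : G -> G0 ;
  gid : G0 -> G ;
  gcomp : G -> G -> G ;
  ginv : G -> G ;
  gs_id : forall x, gs (gid x) = x ;
  gr_id : forall x, gr (gid x) = x ;
  gs_comp : forall a b, gr a = gs b -> gs (gcomp a b) = gs a ;
  gr_comp : forall a b, gr a = gs b -> gr (gcomp a b) = gr b ;
  gcompA : forall a b c, gr a = gs b -> gr b = gs c ->
    gcomp a (gcomp b c) = gcomp (gcomp a b) c ;
  gcomp1g : forall a, gcomp (gid (gs a)) a = a ;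
  gcompg1 : forall a, gcomp a (gid (gr a)) = a ;
  gs_inv : forall a, gs (ginv a) = gr a ;
  gr_inv : forall a, gr (ginv a) = gs a ;
  gcompgV : forall a, gcomp a (ginv a) = gid (gs a) ;
  gcompVg : forall a, gcomp (ginv a) a = gid (gr a) ;
  standard_borelG : standard_borel R G ;
  standard_borelG0 : standard_borel R G0 ;
  measurable_range_gid : measurable (range gid) ;
  measurable_gid : measurable_fun setT gid ;
  measurable_gs : measurable_fun setT gs ;
  measurable_gr : measurable_fun setT gr ;
  measurable_ginv : measurable_fun setT ginv ;
  measurable_gcomp : measurable_fun [set p : G * G | gr p.1 = gs p.2]
    (fun p => gcomp p.1 p.2) ;
  countable_gs : forall x, countable (gs @^-1` [set x]) ;
  countable_gr : forall x, countable (gr @^-1` [set x]) ;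
  (* [mu1] is the measure on G, determined by [mu0] through either formula *)
  mu0 : {finite_measure set G0 -> \bar R} ;
  mu1 : {measure set G -> \bar R} ;
  mu1_gs : forall U, measurable U ->
    mu1 U = (\int[mu0]_x counting (gs @^-1` [set x] `&` U))%E ;
  mu1_gr : forall U, measurable U ->
    mu1 U = (\int[mu0]_x counting (gr @^-1` [set x] `&` U))%E }.

Section Groupoid.
Context (R : realType) d0 d (G0 : measurableType d0) (G : measurableType d)
  (H : groupoid R G0 G).
Local Notation C := R[i].
Local Notation s := (gs H).
Local Notation r := (gr H).
Local Notation mu := (mu0 H).

(** The fibre written s^*x. *)
Definition sfib (x : G0) : set G := s @^-1` [set x].

Definition orbit (x : G0) : set G0 := r @` sfib x.

Definition stab (x : G0) : set G := [set a | s a = x /\ r a = x].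

Definition finite_groupoid := {ae mu, forall x, finite_set (sfib x)}.

Record fundamental_domain := FundamentalDomain {
  fd_set :> set G0 ;
  measurable_fd : measurable fd_set ;
  fdP : forall x, finite_set (orbit x) -> exists! y, (orbit x `&` fd_set) y }.

(** The function [edge_fun] is unspecified outside [edge_dom]. *)
Record edge := Edge {
  edge_dom : set G0 ;
  edge_fun :> G0 -> G ;
  measurable_edge_dom : measurable edge_dom ;
  measurable_edge_fun : measurable_fun edge_dom edge_fun ;
  gs_edge : forall x, edge_dom x -> s (edge_fun x) = x ;
  gr_edge_inj : {in edge_dom &, injective (fun x => r (edge_fun x))} }.

Definition edge_im (phi : edge) : set G := phi @` edge_dom phi.

Definition edge_inv_dom (phi : edge) : set G0 := r @` edge_im phi.

Definition edge_inv (phi : edge) (y : G0) : G :=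
  ginv H (phi (xget point [set x | edge_dom phi x /\ r (phi x) = y])).

(** Finite families are padded with edges of empty domain. *)
Record edge_cover := EdgeCover {
  ecover :> nat -> edge ;
  ecover_disjoint : trivIset setT (fun n => edge_im (ecover n)) ;
  ecover_cover : \bigcup_n edge_im (ecover n) = setT }.

(** An element of L^oo(G0) is given by a representative; [linf_op] depends on
    its class only. *)
Record Linf := MkLinf {
  linf_fun :> G0 -> C ;
  cmeasurable_linf : cmeasurable setT linf_fun ;
  linf_bound : exists M : R, {ae mu, forall x, `|linf_fun x| <= M%:C%C} }.

Definition L2_pred : {pred G -> C} := fun F =>
  `[< cmeasurable setT F /\ (\int[mu1 H]_a (normsq (F a))%:E < +oo)%E >].

Lemma L2_submod : submod_closed L2_pred.
Proof.
split.
  apply/asboolP; split; first exact: cmeasurable0.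
  rewrite integral0_eq// => a _.
  by rewrite -[X in normsq X]/(0 : C) normsq0.
move=> a f g /asboolP[mf If] /asboolP[mg Ig]; apply/asboolP.
have m := cmeasurable_lin a mf mg; split => //.
apply: (@integral_lin_lty _ _ _ _ _ _ (2 * normsq a) 2
  (fun x => (normsq (f x))%:E) (fun x => (normsq (g x))%:E)) => //.
- by rewrite mulr_ge0 ?normsq_ge0.
- by move=> *; rewrite lee_fin normsq_ge0.
- by move=> *; rewrite lee_fin normsq_ge0.
- by move=> *; rewrite lee_fin normsq_ge0.
- exact/measurable_EFinP/measurable_normsq.
- exact/measurable_EFinP/measurable_normsq.
- exact/measurable_EFinP/measurable_normsq.
- by move=> x _; rewrite -!EFinM -EFinD lee_fin normsq_lin.
Qed.

HB.instance Definition _ := GRing.isSubmodClosed.Build _ _ L2_pred L2_submod.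

Definition L2 := aeq (mu1 H) setT L2_pred.
HB.instance Definition _ := GRing.Lmodule.on L2.

Definition L2_repr (F : L2) : G -> C := aeq_repr F.
Coercion L2_repr : L2 >-> Funclass.

Definition L2_class (F : G -> C) : L2 := aeq_class (mu1 H) setT L2_pred F.

Definition L2_ip (F K : L2) : C :=
  cintegral (mu1 H) setT (fun a => F a * conjc (K a)).

Definition edge_act (phi : edge) (F : G -> C) : G -> C := fun a =>
  if r a \in edge_inv_dom phi then F (gcomp H a (edge_inv phi (r a))) else 0.

Definition edge_op (phi : edge) (F : L2) : L2 := L2_class (edge_act phi F).

Definition linf_op (f : Linf) (F : L2) : L2 :=
  L2_class (fun a => f (r a) * F a).

Inductive groupoid_ring : set (L2 -> L2) :=
| groupoid_ring_edge phi : groupoid_ring (edge_op phi)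
| groupoid_ring_linf f : groupoid_ring (linf_op f)
| groupoid_ring_add S T :
    groupoid_ring S -> groupoid_ring T -> groupoid_ring (S + T)
| groupoid_ring_opp T : groupoid_ring T -> groupoid_ring (- T)
| groupoid_ring_mul S T :
    groupoid_ring S -> groupoid_ring T -> groupoid_ring (S \o T).

(** A formal sum, standing for the operator [sum_i phi_i f_i]. *)
Definition formal_sum := seq (edge * Linf).

Definition op_of (p : formal_sum) : L2 -> L2 :=
  \sum_(q <- p) (edge_op q.1 \o linf_op q.2).

Definition chi0 : L2 := L2_class (fun a => (a \in range (gid H))%:R).

(** This vector state is weakly continuous, so the same formula is the extension
    of the trace to the weak closure of the groupoid ring. *)
Definition trace (T : L2 -> L2) : C := L2_ip (T chi0) chi0.

Definition dim_vN_ker_sa (T : L2 -> L2) : C :=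
  trace (orthoproj L2_ip (ker T)).

Definition dim_vN_ker (T : L2 -> L2) : C :=
  dim_vN_ker_sa (adjoint L2_ip T \o T).

Definition conv_zeta (p : formal_sum) (a : G) : G -> C :=
  \sum_(q <- p | r a \in edge_dom q.1)
     q.2 (r a) *: zeta (gcomp H a (q.1 (r a))).

(** The linear extension of [conv_zeta]; for each [b], only finitely many terms
    of the sum are nonzero. *)
Definition conv (p : formal_sum) (x : G0) (xi : G -> C) : G -> C := fun b =>
  \sum_(a \in sfib x) xi a * conv_zeta p a b.

Definition conv_tr (p : formal_sum) (x : G0) : C :=
  \sum_(a \in sfib x) conv p x (zeta a) a.

Definition conv_ker (p : formal_sum) (x : G0) : set (G -> C) :=
  l2 (sfib x) `&` [set xi | conv p x xi = 0].

Definition stab_card (x : G0) : nat := #|` fset_set (stab x)|%fset.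

Definition esection (phi : edge) (x : G0) : G -> C :=
  if x \in edge_dom phi then zeta (phi x) else 0.

Section DirectIntegral.
Context (E : edge_cover) (D : fundamental_domain).

(** Square-integrability forces [xi x] to be in l^2(s^*x) for almost all x. *)
Definition dint_pred : {pred G0 -> G -> C} := fun xi =>
  `[< [/\ forall x a, ~ sfib x a -> xi x a = 0,
          forall n,
            cmeasurable D (fun x => l2ip (sfib x) (xi x) (esection (E n) x)) &
          (\int[mu]_(x in D) l2norm2 (sfib x) (xi x) < +oo)%E] >].

Let coef (xi : G0 -> G -> C) n x : C :=
  if x \in edge_dom (E n) then xi x (E n x) else 0.

Let l2ip_coef xi n x :
  l2ip (sfib x) (xi x) (esection (E n) x) = coef xi n x.
Proof.
rewrite /esection /coef; case: ifPn => [|_]; last exact: l2ip0.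
by rewrite inE => Ex; rewrite l2ip_zeta//; exact: gs_edge.
Qed.

Let l2norm2_coef xi x :
  l2norm2 (sfib x) (xi x) = (\sum_(0 <= n <oo) (normsq (coef xi n x))%:E)%E.
Proof.
rewrite nneseries_esum; last by move=> *; rewrite lee_fin normsq_ge0.
rewrite (esumID [set n | edge_dom (E n) x])//; last first.
  by move=> *; rewrite lee_fin normsq_ge0.
rewrite [X in (_ + X)%E]esum1 ?adde0; last first.
  move=> n [_ /= nx]; rewrite /coef ifF ?normsq0//.
  by apply/negbTE/negP; rewrite inE.
rewrite (_ : _ `&` _ = [set n | edge_dom (E n) x]); last first.
  by apply/seteqP; split=> n /=; [case|].
rewrite /l2norm2.
rewrite (@reindex_esum _ _ _ [set n | edge_dom (E n) x] _ (fun n => E n x)).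
  by apply: eq_esum => n /= nx; rewrite /coef ifT// inE.
split.
- by move=> n /= nx; exact: gs_edge.
- move=> m n; rewrite !inE /= => mx nx mn.
  apply: (@ecover_disjoint E m n) => //; exists (E m x).
  by split; [exists x|exists x; rewrite // mn].
- move=> a /= ax; have : setT a by [].
  rewrite -(ecover_cover E) => -[n _ [y yn ya]].
  have yx : y = x by rewrite -ax -ya gs_edge.
  by exists n; rewrite /= -yx.
Qed.

Let measurable_l2norm2 xi : (forall n, cmeasurable D (coef xi n)) ->
  measurable_fun D (fun x => l2norm2 (sfib x) (xi x)).
Proof.
move=> h; under eq_fun do rewrite l2norm2_coef.
apply: ge0_emeasurable_sum => [k x _ _|k _]; first by rewrite lee_fin normsq_ge0.
exact/measurable_EFinP/measurable_normsq.
Qed.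

Lemma dint_submod : submod_closed dint_pred.
Proof.
have l2_ge0 xi x : (0 <= l2norm2 (sfib x) (xi x))%E.
  by apply: esum_ge0 => a _; rewrite lee_fin normsq_ge0.
split.
  apply/asboolP; split=> //.
    move=> n; under eq_fun do rewrite l2ip_coef.
    rewrite (_ : (fun _ => _) = (fun=> 0)); first exact: cmeasurable0.
    by apply/funext => x; rewrite /coef; case: ifP.
  rewrite integral0_eq// => x _; apply: esum1 => a _.
  by rewrite -[X in normsq X]/(0 : C) normsq0.
move=> a f g /asboolP[f0 mf If] /asboolP[g0 mg Ig]; apply/asboolP.
have coefE n x : coef (a *: f + g) n x = a * coef f n x + coef g n x.
  by rewrite /coef; case: ifP => // _; rewrite mulr0 addr0.
have mf' n : cmeasurable D (coef f n).
  rewrite (_ : coef f n = fun x => l2ip (sfib x) (f x) (esection (E n) x))//.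
  by apply/funext => x; rewrite l2ip_coef.
have mg' n : cmeasurable D (coef g n).
  rewrite (_ : coef g n = fun x => l2ip (sfib x) (g x) (esection (E n) x))//.
  by apply/funext => x; rewrite l2ip_coef.
have m n : cmeasurable D (coef (a *: f + g) n).
  rewrite (_ : coef _ n = fun x => a * coef f n x + coef g n x).
    exact: cmeasurable_lin.
  by apply/funext => x; rewrite coefE.
split.
- move=> x b xb; rewrite -[LHS]/(a * f x b + g x b).
  by rewrite f0// g0// mulr0 addr0.
- move=> n.
  rewrite (_ : (fun x => l2ip _ _ _) = coef (a *: f + g) n)//.
  by apply/funext => x; rewrite l2ip_coef.
apply: (@integral_lin_lty _ _ _ _ _ (measurable_fd D) (2 * normsq a) 2
  (fun x => l2norm2 (sfib x) (f x)) (fun x => l2norm2 (sfib x) (g x))) => //.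
- by rewrite mulr_ge0 ?normsq_ge0.
- exact: measurable_l2norm2.
- exact: measurable_l2norm2.
- exact: measurable_l2norm2.
move=> x _; rewrite !l2norm2_coef.
have c0 xi n : (0 <= (normsq (coef xi n x))%:E)%E by rewrite lee_fin normsq_ge0.
rewrite -!nneseriesZl// -nneseriesD//; last 2 first.
  by move=> *; rewrite mule_ge0// lee_fin mulr_ge0 ?normsq_ge0.
  by move=> *; rewrite mule_ge0.
apply: lee_nneseries => // n _.
by rewrite coefE -!EFinM -EFinD lee_fin normsq_lin.
Qed.

HB.instance Definition _ :=
  GRing.isSubmodClosed.Build _ _ dint_pred dint_submod.

Definition dint := aeq mu D dint_pred.
HB.instance Definition _ := GRing.Lmodule.on dint.

Definition dint_repr (xi : dint) : G0 -> G -> C := aeq_repr xi.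
Coercion dint_repr : dint >-> Funclass.

Definition dint_class (xi : G0 -> G -> C) : dint :=
  aeq_class mu D dint_pred xi.

Definition dint_ip (xi eta : dint) : C :=
  cintegral mu D (fun x => l2ip (sfib x) (xi x) (eta x)).

Definition dint_conv (p : formal_sum) (xi : dint) : dint :=
  dint_class (fun x => conv p x (xi x)).

Record star_representation (pi : (L2 -> L2) -> (dint -> dint)) : Prop := {
  star_rep_bounded : forall T, groupoid_ring T -> bounded_op dint_ip (pi T) ;
  star_rep1 : pi idfun = idfun ;
  star_repD : forall S T, groupoid_ring S -> groupoid_ring T ->
    pi (S + T) = pi S + pi T ;
  star_repZ : forall (c : C) T, groupoid_ring T -> pi (c *: T) = c *: pi T ;
  star_repM : forall S T, groupoid_ring S -> groupoid_ring T ->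
    pi (S \o T) = pi S \o pi T ;
  star_rep_adjoint : forall T, groupoid_ring T ->
    pi (adjoint L2_ip T) = adjoint dint_ip (pi T) }.

End DirectIntegral.

End Groupoid.

(* Main.v *)
(** The countable cover of the groupoid by edges enumerates every fibre of the
    source map measurably, so that L^2 of the groupoid is the direct integral of
    the l^2(s^* x) over all objects and the direct integral over D is its
    subspace of functions supported on s^-1(D). A ring element T acts fibrewise,
    by right translations, hence preserves this subspace, and the representation
    is the compression of T to it.

    The trace of T is the integral over all objects of a function t, the
    diagonal coefficient of T at identities, and t(r a) is the diagonal
    coefficient of T_x at an arrow a with source x. Integrating
    1_D(s a) t(r a) / |St(s a)| over the arrows a along the fibres of s gives
    the integral over D in the formula; along the fibres of r it gives back the
    integral of t, the arrows from D into y being a torsor under a stabilizer.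

    For the kernel, Gram-Schmidt applied to the rows of T_x gives the
    projection P_x onto ker T_x measurably in x. These projections assemble
    into the projection onto ker T, their diagonal coefficients are invariant
    under left translation, and their traces are the dimensions of ker T_x, so
    the same transport applies. *)
Require Import Defs.
From mathcomp Require Import all_boot all_order all_algebra.
From mathcomp Require Import finmap generic_quotient ring_quotient.
From mathcomp Require Import all_classical all_reals all_analysis.
From mathcomp Require Import measurable_realfun complex.
From mathcomp Require Import ring lra.

Set Implicit Arguments.
Unset Strict Implicit.
Unset Printing Implicit Defensive.

Import Order.TTheory GRing.Theory Num.Theory.
Import numFieldNormedType.Exports.
Local Open Scope classical_set_scope.
Local Open Scope ring_scope.

(** * Absolutely summable families *)

(** Elements of [L2 H] and [dint E D] are almost-everywhere classes, and an operator has many formal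
    sums. Both difficulties are met by [ae_sfib]: an identity almost everywhere on arrows is one on
    all of almost every fibre, so operators are handled through their action [fam_act] on functions,
    fibre by fibre. Compression is defined for every map on [L2 H], hence cannot depend on the
    formal sum.

    Adjoints and orthogonal projections are choices with a default value. Existence is carried along
    the ring by [ring_like], or exhibited by [ker_proj_op], and definiteness of the inner product
    then identifies the choice.

    Fibres are finite only almost everywhere, so the kernel projection is built on arbitrary fibres:
    its Fourier series is summed pointwise, with Fatou in the place of norm convergence. Its
    diagonal coefficient at an arrow is the best constant for point evaluation on the kernel, a
    description free of the edge cover; this yields both the invariance under left translation and
    the dimension as a sum of diagonal coefficients. Infinite stabilizers and infinite dimensions
    read 0, as does [fine +oo]. *)

Section ComplexParts.
Context {R : realType}.
Local Notation C := R[i].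
Implicit Types x y z : C.

Lemma complex_eq x y : complex.Re x = complex.Re y ->
  complex.Im x = complex.Im y -> x = y.
Proof. by case: x y => a b [c d] /= -> ->. Qed.

Lemma ReN z : complex.Re (- z) = - complex.Re z.
Proof. by case: z. Qed.

Lemma Re_conjc z : complex.Re (conjc z) = complex.Re z.
Proof. by case: z. Qed.

Lemma Im_conjc z : complex.Im (conjc z) = - complex.Im z.
Proof. by case: z. Qed.

Lemma Re_sum I (r : seq I) (P : pred I) (F : I -> C) :
  complex.Re (\sum_(i <- r | P i) F i) = \sum_(i <- r | P i) complex.Re (F i).
Proof. by apply: (big_morph _ (@Defs.ReD R)). Qed.

Lemma Im_sum I (r : seq I) (P : pred I) (F : I -> C) :
  complex.Im (\sum_(i <- r | P i) F i) = \sum_(i <- r | P i) complex.Im (F i).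
Proof. by apply: (big_morph _ (@Defs.ImD R)). Qed.

Lemma conjcM x y : conjc (x * y) = conjc x * conjc y.
Proof. by rewrite rmorphM. Qed.

Lemma conjcD x y : conjc (x + y) = conjc x + conjc y.
Proof. by rewrite rmorphD. Qed.

Lemma conjcN x : conjc (- x) = - conjc x.
Proof. by rewrite rmorphN. Qed.

Lemma conjc_sum I (r : seq I) (P : pred I) (F : I -> C) :
  conjc (\sum_(i <- r | P i) F i) = \sum_(i <- r | P i) conjc (F i).
Proof. by rewrite rmorph_sum. Qed.

Lemma normsq_conjc z : normsq (conjc z) = normsq z.
Proof. by rewrite /normsq Re_conjc Im_conjc sqrrN. Qed.

Lemma normsqM x y : normsq (x * y) = normsq x * normsq y.
Proof. by rewrite /normsq Defs.ReM Defs.ImM; ring. Qed.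

Lemma normsq_eq0 z : normsq z = 0 -> z = 0.
Proof.
move=> /eqP; rewrite paddr_eq0 ?sqr_ge0// !sqrf_eq0 => /andP[/eqP a /eqP b].
exact: complex_eq.
Qed.

Lemma mulc_conj z : z * conjc z = (normsq z)%:C%C.
Proof. by case: z => a b; apply: complex_eq; rewrite /normsq /=; ring. Qed.

Lemma Re_mulc_conj z : complex.Re (z * conjc z) = normsq z.
Proof. by rewrite mulc_conj. Qed.

Lemma Re_mulJ_le x y :
  `|complex.Re (x * conjc y)| <= normsq x + normsq y.
Proof.
case: x y => a b [c d]; rewrite /normsq /= ler_norml.
have := sqr_ge0 (a - c); have := sqr_ge0 (a + c).
have := sqr_ge0 (b - d); have := sqr_ge0 (b + d).
have := sqr_ge0 a; have := sqr_ge0 b; have := sqr_ge0 c; have := sqr_ge0 d.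
by move=> *; apply/andP; split; nra.
Qed.

Lemma Im_mulJ_le x y :
  `|complex.Im (x * conjc y)| <= normsq x + normsq y.
Proof.
case: x y => a b [c d]; rewrite /normsq /= ler_norml.
have := sqr_ge0 (a - d); have := sqr_ge0 (a + d).
have := sqr_ge0 (b - c); have := sqr_ge0 (b + c).
have := sqr_ge0 a; have := sqr_ge0 b; have := sqr_ge0 c; have := sqr_ge0 d.
by move=> *; apply/andP; split; nra.
Qed.

End ComplexParts.

Section RealSums.
Context {R : realType} {T : choiceType}.
Implicit Types (A : set T) (f g p q : T -> R).

(** One inequality holds for every nonnegative scalar and every nonnegative family; applied to
    [k^-1] and [k * f] it gives the converse. *)
Lemma ge0_esumZl A f (k : R) : 0 <= k -> (forall a, A a -> 0 <= f a) ->
  (\esum_(a in A) (k * f a)%:E = k%:E * \esum_(a in A) (f a)%:E)%E.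
Proof.
have le_esumZ (l : R) (h : T -> R) : 0 <= l -> (forall a, A a -> 0 <= h a) ->
    (\esum_(a in A) (l * h a)%:E <= l%:E * \esum_(a in A) (h a)%:E)%E.
  move=> l0 h0; apply: ge_ereal_sup => _ [X [fX XA] <-].
  rewrite fsumEFin// (_ : \sum_(a \in X) l * h a = l * \sum_(a \in X) h a);
    last by rewrite mulr_fsumr.
  rewrite EFinM lee_wpmul2l ?lee_fin//.
  apply: esum_ge.
  by exists X => //; rewrite fsumEFin.
move=> k0 f0; apply/eqP; rewrite eq_le le_esumZ//=.
have [->|kn0] := eqVneq k 0.
  by rewrite mul0e; apply: esum_ge0 => a Aa; rewrite lee_fin mul0r.
have kp : 0 < k by rewrite lt_neqAle eq_sym kn0.
rewrite -lee_pdivlMl//; apply: le_trans (le_esumZ k^-1 _ _ _).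
- by apply: le_esum => a _; rewrite mulrA mulVf// mul1r.
- by rewrite invr_ge0.
- by move=> a Aa; rewrite mulr_ge0 ?f0.
Qed.

Definition rsummable A f := (\esum_(a in A) (`|f a|)%:E < +oo)%E.

Lemma rsummable_le A f g : (forall a, A a -> `|f a| <= `|g a|) ->
  rsummable A g -> rsummable A f.
Proof.
by move=> fg; apply: le_lt_trans; apply: le_esum => a Aa; rewrite lee_fin fg.
Qed.

Lemma rsummable_lin A (k : R) f g : rsummable A f -> rsummable A g ->
  rsummable A (fun a => k * f a + g a).
Proof.
move=> sf sg; apply: (@le_lt_trans _ _
  (\esum_(a in A) ((`|k| * `|f a|)%:E + `|g a|%:E)%E)).
  by apply: le_esum => a _; rewrite -EFinD lee_fin -normrM ler_normD.
rewrite esumD => [|a _|a _]; rewrite ?lee_fin//.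
by rewrite ge0_esumZl// lte_add_pinfty// lte_mul_pinfty// lee_fin.
Qed.

Lemma esum_fin_num A f : (forall a, A a -> 0 <= f a) -> rsummable A f ->
  (\esum_(a in A) (f a)%:E \is a fin_num)%E.
Proof.
move=> f0 sf; rewrite ge0_fin_numE; last first.
  by apply: esum_ge0 => a Aa; rewrite lee_fin f0.
by apply: le_lt_trans sf; apply: le_esum => a Aa; rewrite lee_fin ler_norm.
Qed.

Lemma eq_rsum A f g : (forall a, A a -> f a = g a) -> rsum A f = rsum A g.
Proof.
by move=> fg; rewrite /rsum; congr (fine _ - fine _);
  apply: eq_esum => a Aa; rewrite fg.
Qed.

Lemma rsummable_pos A f : rsummable A f -> rsummable A (fun a => Num.max (f a) 0).
Proof.
by apply: rsummable_le => a _; case: (lerP (f a) 0); rewrite ?normr0.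
Qed.

(** Any splitting into nonnegative summable parts computes [rsum], not only the one into positive
    and negative parts: adding crosswise reduces the claim to additivity of nonnegative sums. *)
Lemma rsum_diff A p q : (forall a, A a -> 0 <= p a) ->
  (forall a, A a -> 0 <= q a) -> rsummable A p -> rsummable A q ->
  rsum A (fun a => p a - q a) =
  fine (\esum_(a in A) (p a)%:E) - fine (\esum_(a in A) (q a)%:E).
Proof.
move=> p0 q0 sp sq.
have spq : rsummable A (fun a => p a - q a).
  by have := rsummable_lin (-1) sq sp; congr (_ < _)%E; apply: eq_esum => a _;
    congr (`| _ |%:E); ring.
have sqp : rsummable A (fun a => - (p a - q a)).
  by move: spq; congr (_ < _)%E; apply: eq_esum => a _; rewrite normrN.
rewrite /rsum.
have e : (\esum_(a in A) (Num.max (p a - q a) 0)%:E + \esum_(a in A) (q a)%:E =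
   \esum_(a in A) (Num.max (- (p a - q a)) 0)%:E + \esum_(a in A) (p a)%:E)%E.
  rewrite -!esumD; first last.
  - by move=> a Aa; rewrite lee_fin q0.
  - by move=> a Aa; rewrite lee_fin le_max lexx orbT.
  - by move=> a Aa; rewrite lee_fin p0.
  - by move=> a Aa; rewrite lee_fin le_max lexx orbT.
  apply: eq_esum => a Aa; rewrite -!EFinD; congr (_%:E).
  by case: (lerP (p a - q a) 0); case: (lerP (- (p a - q a)) 0); lra.
have max_ge0 (x : R) : 0 <= Num.max x 0 by rewrite le_max lexx orbT.
have := congr1 fine e.
rewrite !fineD ?esum_fin_num//; do ?exact: rsummable_pos.
lra.
Qed.

Lemma rsum_ge0E A f : (forall a, A a -> 0 <= f a) ->
  rsum A f = fine (\esum_(a in A) (f a)%:E).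
Proof.
move=> f0; rewrite /rsum [X in _ - fine X]esum1 ?subr0.
  by congr fine; apply: eq_esum => a Aa; rewrite max_l ?f0.
by move=> a Aa; rewrite max_r// oppr_le0 f0.
Qed.

Lemma rsum_lin A (k : R) f g : rsummable A f -> rsummable A g ->
  rsum A (fun a => k * f a + g a) = k * rsum A f + rsum A g.
Proof.
have posneg (x : R) : x = Num.max x 0 - Num.max (- x) 0.
  by case: (lerP x 0); case: (lerP (- x) 0); lra.
have max_ge0 (x : R) : 0 <= Num.max x 0 by rewrite le_max lexx orbT.
have sN h : rsummable A h -> rsummable A (fun a => - h a).
  by apply: rsummable_le => a _; rewrite normrN.
move=> sf sg.
(* The sign of [k] decides which part of [f] goes to the positive side. The resulting parts may
   overlap, which [rsum_diff] allows. *)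
have [k0|k0] := lerP 0 k.
- rewrite (@eq_rsum _ _ (fun a =>
    (k * Num.max (f a) 0 + Num.max (g a) 0) -
    (k * Num.max (- f a) 0 + Num.max (- g a) 0))); last first.
    by move=> a _; rewrite {1}(posneg (f a)) {1}(posneg (g a)); ring.
  rewrite rsum_diff; first last.
  + by apply: rsummable_lin; apply/rsummable_pos/sN.
  + by apply: rsummable_lin; apply/rsummable_pos.
  + by move=> a _; rewrite addr_ge0 ?mulr_ge0.
  + by move=> a _; rewrite addr_ge0 ?mulr_ge0.
  under eq_esum do rewrite EFinD.
  under [X in _ - fine X]eq_esum do rewrite EFinD.
  rewrite !esumD; do ?[by move=> a _; rewrite lee_fin ?mulr_ge0].
  rewrite !ge0_esumZl// !fineD ?fin_numM ?esum_fin_num//;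
    do ?[exact: rsummable_pos | exact/rsummable_pos/sN].
  rewrite !fineM ?esum_fin_num//;
    do ?[exact: rsummable_pos | exact/rsummable_pos/sN].
  by rewrite /rsum /=; ring.
- have k0' : 0 <= - k by lra.
  rewrite (@eq_rsum _ _ (fun a =>
    (- k * Num.max (- f a) 0 + Num.max (g a) 0) -
    (- k * Num.max (f a) 0 + Num.max (- g a) 0))); last first.
    by move=> a _; rewrite {1}(posneg (f a)) {1}(posneg (g a)); ring.
  rewrite rsum_diff; first last.
  + by apply: rsummable_lin; apply/rsummable_pos => //; apply: sN.
  + by apply: rsummable_lin; apply/rsummable_pos => //; apply: sN.
  + by move=> a _; rewrite addr_ge0 ?mulr_ge0.
  + by move=> a _; rewrite addr_ge0 ?mulr_ge0.
  under eq_esum do rewrite EFinD.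
  under [X in _ - fine X]eq_esum do rewrite EFinD.
  rewrite !esumD; do ?[by move=> a _; rewrite lee_fin ?mulr_ge0].
  rewrite !ge0_esumZl// !fineD ?fin_numM ?esum_fin_num//;
    do ?[exact: rsummable_pos | exact/rsummable_pos/sN].
  rewrite !fineM ?esum_fin_num//;
    do ?[exact: rsummable_pos | exact/rsummable_pos/sN].
  by rewrite /rsum /=; ring.
Qed.

Lemma rsum0 A : rsum A (fun=> 0 : R) = 0.
Proof. by rewrite /rsum !esum1 ?subrr// => a _; rewrite ?oppr0 maxxx. Qed.

Lemma rsumN A f : rsum A (fun a => - f a) = - rsum A f.
Proof.
rewrite /rsum opprB; congr (_ - fine _).
by apply: eq_esum => a _; rewrite opprK.
Qed.

Lemma rsum_fset A f : finite_set A -> rsum A f = \sum_(a \in A) f a.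
Proof.
move=> fA; rewrite /rsum !esum_fset//; last 2 first.
- by move=> a _; rewrite lee_fin le_max lexx orbT.
- by move=> a _; rewrite lee_fin le_max lexx orbT.
rewrite !fsumEFin//= !fsbig_finite// -sumrB; apply: eq_bigr => a _.
by case: (lerP (f a) 0); case: (lerP (- f a) 0); lra.
Qed.

Lemma rsum_supp A B f : B `<=` A -> (forall a, A a -> ~ B a -> f a = 0) ->
  rsum A f = rsum B f.
Proof.
move=> BA f0; rewrite /rsum; congr (fine _ - fine _).
  rewrite (esumID B)/=; last by move=> a _; rewrite lee_fin le_max lexx orbT.
  rewrite [X in (_ + X)%E]esum1 ?adde0; first by rewrite setIC setIidl.
  by move=> a [Aa Ba]; rewrite f0// maxxx.
rewrite (esumID B)/=; last by move=> a _; rewrite lee_fin le_max lexx orbT.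
rewrite [X in (_ + X)%E]esum1 ?adde0; first by rewrite setIC setIidl.
by move=> a [Aa Ba]; rewrite f0// oppr0 maxxx.
Qed.

End RealSums.

Lemma reindex_rsum {R : realType} {T T' : choiceType} (P : set T) (Q : set T')
    (e : T -> T') (f : T' -> R) : set_bij P Q e ->
  rsum Q f = rsum P (fun a => f (e a)).
Proof. by move=> eb; rewrite /rsum !(reindex_esum P Q e). Qed.

(** * Complex sums and square-summable functions *)

Section ComplexSums.
Context {R : realType} {T : choiceType}.
Local Notation C := R[i].
Implicit Types (A : set T) (f g h : T -> C).

Definition csummable A f := rsummable A (fun a => complex.Re (f a)) /\
  rsummable A (fun a => complex.Im (f a)).

Lemma eq_csum A f g : (forall a, A a -> f a = g a) -> csum A f = csum A g.
Proof.
by move=> fg; rewrite /csum; congr Complex; apply: eq_rsum => a Aa; rewrite fg.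
Qed.

Lemma csum_lin A (k : C) f g : csummable A f -> csummable A g ->
  csum A (fun a => k * f a + g a) = k * csum A f + csum A g.
Proof.
move=> [f1 f2] [g1 g2]; apply: complex_eq.
- rewrite Defs.ReD Defs.ReM /csum /=.
  rewrite (@eq_rsum _ _ _ _ (fun a => complex.Re k * complex.Re (f a) +
    (- complex.Im k * complex.Im (f a) + complex.Re (g a)))); last first.
    by move=> a _; rewrite Defs.ReD Defs.ReM; ring.
  by rewrite !rsum_lin//; [ring|exact: rsummable_lin].
- rewrite Defs.ImD Defs.ImM /csum /=.
  rewrite (@eq_rsum _ _ _ _ (fun a => complex.Re k * complex.Im (f a) +
    (complex.Im k * complex.Re (f a) + complex.Im (g a)))); last first.
    by move=> a _; rewrite Defs.ImD Defs.ImM; ring.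
  by rewrite !rsum_lin//; [ring|exact: rsummable_lin].
Qed.

Lemma csum_conj A f : csum A (fun a => conjc (f a)) = conjc (csum A f).
Proof.
apply: complex_eq; rewrite /csum /=.
  by apply: eq_rsum => a _; rewrite Re_conjc.
by rewrite -rsumN; apply: eq_rsum => a _; rewrite Im_conjc.
Qed.

Lemma csum_fset A f : finite_set A -> csum A f = \sum_(a \in A) f a.
Proof.
move=> fA; rewrite /csum !rsum_fset// !fsbig_finite//; apply: complex_eq => /=.
  by rewrite Re_sum.
by rewrite Im_sum.
Qed.

Lemma csum_supp A B f : B `<=` A -> (forall a, A a -> ~ B a -> f a = 0) ->
  csum A f = csum B f.
Proof.
move=> BA f0; rewrite /csum; congr Complex; apply: rsum_supp => // a Aa Ba.
  by rewrite f0.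
by rewrite f0.
Qed.

(** Unlike [l2], no vanishing outside [A] is imposed, so that one function on all arrows can be read
    on every fibre. *)
Definition fin2 A : set (T -> C) := [set f | (l2norm2 A f < +oo)%E].

Lemma l2norm2_ge0 A f : (0 <= l2norm2 A f)%E.
Proof. by apply: esum_ge0 => a _; rewrite lee_fin normsq_ge0. Qed.

Lemma fin2_fin_num A f : fin2 A f -> l2norm2 A f \is a fin_num.
Proof. by move=> ff; rewrite ge0_fin_numE ?l2norm2_ge0. Qed.

Lemma fin2_0 A : fin2 A 0.
Proof.
rewrite /fin2 /= /l2norm2 esum1// => a _.
by rewrite -[X in normsq X]/(0 : C) normsq0.
Qed.

Lemma fin2_lin A (k : C) f g : fin2 A f -> fin2 A g -> fin2 A (k *: f + g).
Proof.
rewrite /fin2 /= => ff fg; apply: (@le_lt_trans _ _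
  (\esum_(a in A) ((2 * normsq k * normsq (f a))%:E + (2 * normsq (g a))%:E)%E)).
  by apply: le_esum => a _; rewrite -EFinD lee_fin; exact: normsq_lin.
rewrite esumD => [|a _|a _]; rewrite ?lee_fin ?mulr_ge0 ?normsq_ge0//.
rewrite !ge0_esumZl// ?mulr_ge0 ?normsq_ge0// => [|a _|a _];
  rewrite ?normsq_ge0//.
by rewrite lte_add_pinfty// lte_mul_pinfty// lee_fin// mulr_ge0 ?normsq_ge0.
Qed.

Lemma fin2_fset A f : finite_set (A `&` [set a | f a <> 0]) -> fin2 A f.
Proof.
move=> fA; rewrite /fin2 /= /l2norm2 (esumID [set a | f a <> 0])//; last first.
  by move=> a _; rewrite lee_fin normsq_ge0.
rewrite [X in (_ + X)%E]esum1; last first.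
  by move=> a [_ /= /contrapT ->]; rewrite normsq0.
rewrite adde0 esum_fset//; last by move=> a _; rewrite lee_fin normsq_ge0.
by rewrite fsumEFin// ltry.
Qed.

Lemma eq_l2norm2 A f g : (forall a, A a -> f a = g a) ->
  l2norm2 A f = l2norm2 A g.
Proof. by move=> fg; apply: eq_esum => a Aa; rewrite fg. Qed.

Lemma eq_l2ip A f f' g g' : (forall a, A a -> f a = f' a) ->
  (forall a, A a -> g a = g' a) -> l2ip A f g = l2ip A f' g'.
Proof. by move=> e e'; apply: eq_csum => a Aa; rewrite e ?e'. Qed.

Lemma fin2_csummable A f g : fin2 A f -> fin2 A g ->
  csummable A (fun a => f a * conjc (g a)).
Proof.
move=> ff fg.
have s : (\esum_(a in A) (normsq (f a) + normsq (g a))%:E < +oo)%E.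
  under eq_esum do rewrite EFinD.
  rewrite esumD => [|a _|a _]; rewrite ?lee_fin ?normsq_ge0//.
  exact: lte_add_pinfty.
split; apply: le_lt_trans s; apply: le_esum => a _; rewrite lee_fin.
  exact: Re_mulJ_le.
exact: Im_mulJ_le.
Qed.

Lemma l2ip_linl A (k : C) f g h : fin2 A f -> fin2 A g -> fin2 A h ->
  l2ip A (k *: f + g) h = k * l2ip A f h + l2ip A g h.
Proof.
move=> ff fg fh; rewrite -csum_lin; try exact: fin2_csummable.
by apply: eq_csum => a _; rewrite mulrA -mulrDl.
Qed.

Lemma l2ip_herm A f g : l2ip A g f = conjc (l2ip A f g).
Proof.
rewrite /l2ip -csum_conj; apply: eq_csum => a _.
by rewrite conjcM conjcK mulrC.
Qed.

Lemma l2ip_norm A f : l2ip A f f = (fine (l2norm2 A f))%:C%C.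
Proof.
apply: complex_eq; rewrite /l2ip /csum /=.
  rewrite (@eq_rsum _ _ _ _ (fun a => normsq (f a))).
    by rewrite rsum_ge0E// => a _; exact: normsq_ge0.
  by move=> a _; rewrite Re_mulc_conj.
by rewrite (@eq_rsum _ _ _ _ (fun=> 0)) ?rsum0// => a _; rewrite mulc_conj.
Qed.

Lemma le_l2norm2_normsq A f a : A a -> ((normsq (f a))%:E <= l2norm2 A f)%E.
Proof.
move=> Aa; apply: esum_ge; exists [set a]; last by rewrite fsbig_set1.
by split; [exact: finite_set1|move=> _ ->].
Qed.

Lemma l2norm2_eq0 A f : l2norm2 A f = 0%E -> forall a, A a -> f a = 0.
Proof.
move=> f0 a Aa; apply: normsq_eq0; apply/eqP; rewrite eq_le normsq_ge0 andbT.
by have := le_l2norm2_normsq f Aa; rewrite f0 lee_fin.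
Qed.

Lemma fin2_zeta A (a : T) : fin2 A (zeta a).
Proof.
apply: fin2_fset; apply: (@sub_finite_set _ _ [set a]); last exact: finite_set1.
move=> b [_] /=; rewrite /zeta; case: (eqVneq b a) => // _ /(_ erefl).
Qed.

Lemma l2norm2_zeta A (a : T) : A a -> l2norm2 A (zeta a : T -> C) = 1%E.
Proof.
move=> Aa; rewrite -(fineK (fin2_fin_num (fin2_zeta A a))); congr EFin.
by apply: complexI; rewrite -l2ip_norm l2ip_zeta// /zeta eqxx.
Qed.

End ComplexSums.

(** * Gram-Schmidt and orthogonal projections *)

Section PreHilbert.
Context {R : realType} {W : lmodType R[i]}.
Local Notation C := R[i].

(** The form is semidefinite and lives on a subset [S] of the ambient space. This covers [fin2 A],
    where functions vanishing on [A] have norm 0, as well as [L2 H]. *)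
Record prehilbert (S : set W) (ip : W -> W -> C) : Prop := {
  ph0 : S 0 ;
  phS : forall a u v, S u -> S v -> S (a *: u + v) ;
  ph_lin : forall a u v w, S u -> S v -> S w ->
    ip (a *: u + v) w = a * ip u w + ip v w ;
  ph_herm : forall u v, S u -> S v -> ip v u = conjc (ip u v) ;
  ph_pos : forall u, S u -> 0 <= complex.Re (ip u u) }.

Section Theory.
Context (S : set W) (ip : W -> W -> C) (pH : prehilbert S ip).
Implicit Types (u v w : W).

Definition nrm2 u : R := complex.Re (ip u u).

Lemma phD u v : S u -> S v -> S (u + v).
Proof. by move=> su sv; rewrite -[u]scale1r; exact: (phS pH). Qed.

Lemma phZ a u : S u -> S (a *: u).
Proof. by move=> su; rewrite -[_ *: _]addr0; apply: (phS pH) => //; exact: (ph0 pH). Qed.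

Lemma phB u v : S u -> S v -> S (u - v).
Proof. by move=> su sv; rewrite addrC -scaleN1r; exact: (phS pH). Qed.

Lemma ph_sum I (r : seq I) (P : pred I) (F : I -> W) :
  (forall i, P i -> S (F i)) -> S (\sum_(i <- r | P i) F i).
Proof. by move=> SF; apply: big_ind => //; [exact: (ph0 pH)|exact: phD]. Qed.

Lemma ph_ip0l w : S w -> ip 0 w = 0.
Proof.
move=> sw; have := @ph_lin _ _ pH 1 0 0 w (ph0 pH) (ph0 pH) sw.
by rewrite scale1r addr0 mul1r => /eqP; rewrite -subr_eq0 opprD addrA subrr
  sub0r oppr_eq0 => /eqP.
Qed.

Lemma ph_ip0r w : S w -> ip w 0 = 0.
Proof.
by move=> sw; rewrite (ph_herm pH (ph0 pH) sw) ph_ip0l// conjc0.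
Qed.

Lemma ph_ipZl a u w : S u -> S w -> ip (a *: u) w = a * ip u w.
Proof.
move=> su sw; rewrite -[_ *: _]addr0 (ph_lin pH)//; last exact: (ph0 pH).
by rewrite ph_ip0l// addr0.
Qed.

Lemma ph_ipDl u v w : S u -> S v -> S w -> ip (u + v) w = ip u w + ip v w.
Proof. by move=> su sv sw; rewrite -{1}[u]scale1r (ph_lin pH)// mul1r. Qed.

Lemma ph_ipBl u v w : S u -> S v -> S w -> ip (u - v) w = ip u w - ip v w.
Proof. by move=> su sv sw; rewrite addrC -scaleN1r (ph_lin pH)// mulN1r addrC. Qed.

Lemma ph_ipZr a u w : S u -> S w -> ip w (a *: u) = conjc a * ip w u.
Proof.
move=> su sw; rewrite (ph_herm pH (phZ a su) sw) ph_ipZl// conjcM.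
by rewrite -(ph_herm pH su sw).
Qed.

Lemma ph_ipDr u v w : S u -> S v -> S w -> ip w (u + v) = ip w u + ip w v.
Proof.
move=> su sv sw; rewrite (ph_herm pH (phD su sv) sw) ph_ipDl// conjcD.
by rewrite -(ph_herm pH su sw) -(ph_herm pH sv sw).
Qed.

Lemma ph_ipBr u v w : S u -> S v -> S w -> ip w (u - v) = ip w u - ip w v.
Proof.
move=> su sv sw; rewrite (ph_herm pH (phB su sv) sw) ph_ipBl// conjcD conjcN.
by rewrite -(ph_herm pH su sw) -(ph_herm pH sv sw).
Qed.

Lemma ph_suml I (r : seq I) (P : pred I) (F : I -> W) w : S w ->
  (forall i, P i -> S (F i)) ->
  ip (\sum_(i <- r | P i) F i) w = \sum_(i <- r | P i) ip (F i) w.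
Proof.
move=> sw SF; suff [] : S (\sum_(i <- r | P i) F i) /\
    ip (\sum_(i <- r | P i) F i) w = \sum_(i <- r | P i) ip (F i) w by [].
elim/big_ind2: _ => //.
- by split; [exact: (ph0 pH)|rewrite ph_ip0l].
- by move=> u a v b [su <-] [sv <-]; split; [exact: phD|rewrite ph_ipDl].
- by move=> i Pi; split=> //; exact: SF.
Qed.

Lemma ph_sumr I (r : seq I) (P : pred I) (F : I -> W) w : S w ->
  (forall i, P i -> S (F i)) ->
  ip w (\sum_(i <- r | P i) F i) = \sum_(i <- r | P i) ip w (F i).
Proof.
move=> sw SF; rewrite (ph_herm pH (ph_sum _ SF) sw) ph_suml// conjc_sum.
by apply: eq_bigr => i Pi; rewrite -(ph_herm pH (SF i Pi) sw).
Qed.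

Lemma ph_nrm u : S u -> ip u u = (nrm2 u)%:C%C.
Proof.
move=> su; apply: complex_eq => //=.
have /(congr1 (@complex.Im R)) := ph_herm pH su su; rewrite Im_conjc => h; lra.
Qed.

Lemma nrm2_addZ u v (a : C) : S u -> S v -> nrm2 (u + a *: v) =
  nrm2 u + 2 * complex.Re (conjc a * ip u v) + normsq a * nrm2 v.
Proof.
move=> su sv; have sav := phZ a sv.
rewrite /nrm2 ph_ipDl ?ph_ipDr ?ph_ipZl ?ph_ipZr//; try exact: phD.
rewrite (ph_herm pH su sv) (ph_nrm sv).
case: (ip u v) => x y; case: a {sav} => c d; rewrite /normsq /nrm2 !Defs.ReD /=; ring.
Qed.

Lemma ph_CS u v : S u -> S v -> normsq (ip u v) <= nrm2 u * nrm2 v.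
Proof.
move=> su sv; set w := ip u v.
have key (t : R) : 0 <= nrm2 u - 2 * t * normsq w + t ^+ 2 * normsq w * nrm2 v.
  have := ph_pos pH (phD su (phZ (- (t%:C%C * w)) sv)).
  rewrite -/(nrm2 _) nrm2_addZ// -/w.
  have -> : complex.Re (conjc (- (t%:C%C * w)) * w) = - (t * normsq w).
    by rewrite conjcN conjcM conjc_real mulNr ReN -mulrA (mulrC _ w) mulc_conj
      -rmorphM.
  have -> : normsq (- (t%:C%C * w)) = t ^+ 2 * normsq w.
    by case: w => a b; rewrite /normsq /=; ring.
  by lra.
have := ph_pos pH sv; rewrite -/(nrm2 v) le_eqVlt => /predU1P[v0|v0].
  rewrite -v0 mulr0 leNgt; apply/negP => w0.
  (* With [nrm2 v = 0] the polynomial is affine in [t], and this [t] gives it the value [-1]. *)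
  have := key ((nrm2 u + 1) / (2 * normsq w)); rewrite -v0.
  have -> : 2 * ((nrm2 u + 1) / (2 * normsq w)) * normsq w = nrm2 u + 1.
    by field; rewrite gt_eqF.
  lra.
(* The minimiser of the quadratic polynomial in [t]. *)
have := key (nrm2 v)^-1.
have -> : (nrm2 v)^-1 ^+ 2 * normsq w * nrm2 v = normsq w / nrm2 v.
  by field; rewrite gt_eqF.
have -> : 2 * (nrm2 v)^-1 * normsq w = 2 * (normsq w / nrm2 v) by ring.
move=> h; rewrite -ler_pdivrMr//; lra.
Qed.

Lemma nrm2_eq0_ip u v : S u -> S v -> nrm2 u = 0 -> ip u v = 0.
Proof.
move=> su sv u0; apply/normsq_eq0/eqP; rewrite eq_le normsq_ge0 andbT.
by have := ph_CS su sv; rewrite u0 mul0r.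
Qed.

(** Zero members are allowed, so that the index set is [nat] on every fibre, whatever the rank of
    the family. *)
Definition ortho_seq (g : nat -> W) :=
  [/\ forall k, S (g k), forall j k, j != k -> ip (g j) (g k) = 0 &
      forall k, g k = 0 \/ ip (g k) (g k) = 1].

Definition residual (g : nat -> W) F n := F - \sum_(k < n) ip F (g k) *: g k.

Section Residual.
Context (g : nat -> W) (og : ortho_seq g).

Lemma residualS F n : S F -> S (residual g F n).
Proof.
case: og => Sg _ _ SF; apply: phB => //; apply: ph_sum => i _.
exact: phZ.
Qed.

Lemma residual_ortho F n j : S F -> (j < n)%N -> ip (residual g F n) (g j) = 0.
Proof.
case: og => Sg go g1 SF jn; rewrite ph_ipBl//; last first.
  by apply: ph_sum => i _; exact: phZ.
rewrite ph_suml//; last by move=> i _; exact: phZ.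
rewrite (bigD1 (Ordinal jn))//= big1 ?addr0; last first.
  by move=> i ij; rewrite ph_ipZl// go ?mulr0.
rewrite ph_ipZl//; case: (g1 j) => ->; last by rewrite mulr1 subrr.
by rewrite !ph_ip0r ?mulr0 ?subrr//; exact: (ph0 pH).
Qed.

Lemma residual_ip F n w : S F -> S w -> (forall k, (k < n)%N -> ip (g k) w = 0) ->
  ip (residual g F n) w = ip F w.
Proof.
case: og => Sg _ _ SF Sw gw; rewrite ph_ipBl//; last first.
  by apply: ph_sum => i _; exact: phZ.
rewrite ph_suml//; last by move=> i _; exact: phZ.
by rewrite big1 ?subr0// => i _; rewrite ph_ipZl// gw ?mulr0.
Qed.

Lemma residual_nrm2 F n : S F ->
  nrm2 (residual g F n) = nrm2 F - \sum_(k < n) normsq (ip F (g k)).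
Proof.
case: og => Sg _ _ SF; have SrF := residualS n SF.
(* The residual is orthogonal to the part subtracted from [F], so one of its two occurrences can be
   replaced by [F]. *)
have -> : nrm2 (residual g F n) = complex.Re (ip (residual g F n) F).
  rewrite /nrm2 {2}/residual ph_ipBr//; last first.
    by apply: ph_sum => i _; exact: phZ.
  rewrite ph_sumr//; last by move=> i _; exact: phZ.
  rewrite [X in _ - X]big1 ?subr0// => i _.
  by rewrite ph_ipZr// residual_ortho ?mulr0.
rewrite ph_ipBl//; last by apply: ph_sum => i _; exact: phZ.
rewrite ph_suml//; last by move=> i _; exact: phZ.
rewrite Defs.ReD ReN Re_sum; congr (_ - _); apply: eq_bigr => i _.
by rewrite ph_ipZl// (ph_herm pH SF (Sg i)) Re_mulc_conj.
Qed.

Lemma bessel_le F n : S F -> \sum_(k < n) normsq (ip F (g k)) <= nrm2 F.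
Proof.
move=> SF; rewrite -subr_ge0 -residual_nrm2//.
exact/(ph_pos pH)/residualS.
Qed.

End Residual.

Definition normalise u := ((Num.sqrt (nrm2 u))^-1)%:C%C *: u.

Lemma normaliseS u : S u -> S (normalise u).
Proof. exact: phZ. Qed.

Lemma normalise_ip u : S u -> nrm2 u != 0 -> ip (normalise u) (normalise u) = 1.
Proof.
move=> su u0; have up : 0 < nrm2 u by rewrite lt_neqAle eq_sym u0 (ph_pos pH su).
rewrite ph_ipZl ?ph_ipZr ?ph_nrm//; last exact: phZ.
rewrite conjc_real -!rmorphM mulrA -invfM -expr2 sqr_sqrtr; last exact: ltW.
by rewrite mulVf// rmorph1.
Qed.

Fixpoint gs_seq (v : nat -> W) n : seq W :=
  if n is m.+1 then
    rcons (gs_seq v m)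
      (normalise (v m - \sum_(g <- gs_seq v m) ip (v m) g *: g))
  else [::].

(** Gram-Schmidt without any independence assumption: since [0^-1 = 0], a
    vector depending on the previous ones contributes [0]. *)
Definition gram_schmidt (v : nat -> W) n : W := last 0 (gs_seq v n.+1).

Lemma gs_seqE (v : nat -> W) n : gs_seq v n = mkseq (gram_schmidt v) n.
Proof. by elim: n => // n IH; rewrite mkseqS -IH /= /gram_schmidt /= last_rcons. Qed.

Lemma gsE (v : nat -> W) n : gram_schmidt v n = normalise (residual (gram_schmidt v) (v n) n).
Proof.
rewrite {1}/gram_schmidt /= last_rcons gs_seqE /residual /mkseq big_map.
by rewrite -(big_mkord xpredT (fun k => ip (v n) (gram_schmidt v k) *: gram_schmidt v k))
  /index_iota subn0.
Qed.

Context (v : nat -> W) (Sv : forall n, S (v n)).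
Let g := gram_schmidt v.

Lemma gs_ortho_seq : ortho_seq g.
Proof.
have main n : [/\ forall k, (k < n)%N -> S (g k),
    forall j k, (j < n)%N -> (k < n)%N -> j != k -> ip (g j) (g k) = 0 &
    forall k, (k < n)%N -> g k = 0 \/ ip (g k) (g k) = 1].
  elim: n => [|n [IS IO IN]]; first by split.
  (* Cutting the sequence off at [n] turns the induction hypothesis into an [ortho_seq], to which
     the residual lemmas apply. *)
  pose h k := if (k < n)%N then g k else 0.
  have oh : ortho_seq h.
    split.
    - by move=> k; rewrite /h; case: ifP => [/IS//|_]; exact: (ph0 pH).
    - move=> j k jk; rewrite /h; case: ifP => [jn|_]; case: ifP => [kn|_].
      + exact: IO.
      + by rewrite ph_ip0r//; exact: IS.
      + by rewrite ph_ip0l//; exact: IS.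
      + by rewrite ph_ip0l//; exact: (ph0 pH).
    - move=> k; rewrite /h; case: ifP => [kn|_]; last by left.
      exact: IN.
  have rh : residual g (v n) n = residual h (v n) n.
    rewrite /residual; congr (_ - _); apply: eq_bigr => k _.
    by rewrite /h ltn_ord.
  have gn : g n = normalise (residual h (v n) n) by rewrite -rh; exact: gsE.
  have Sr := residualS oh n (Sv n).
  have Sgn : S (g n) by rewrite gn; exact: normaliseS.
  have On j : (j < n)%N -> ip (g n) (g j) = 0.
    move=> jn; rewrite gn ph_ipZl//; last exact: IS.
    have := residual_ortho oh (Sv n) jn; rewrite {2}/h jn => ->.
    by rewrite mulr0.
  have SS k : (k < n.+1)%N -> S (g k).
    by rewrite ltnS leq_eqVlt => /predU1P[->//|]; exact: IS.
  split=> //.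
  - move=> j k; rewrite ltnS leq_eqVlt => /predU1P[->|jn];
      rewrite ltnS leq_eqVlt => /predU1P[->|kn].
    + by rewrite eqxx.
    + by move=> _; exact: On.
    + by move=> _; rewrite (ph_herm pH Sgn (IS _ jn)) On// conjc0.
    + exact: IO.
  - move=> k; rewrite ltnS leq_eqVlt => /predU1P[->|]; last exact: IN.
    rewrite gn; have [r0|r0] := eqVneq (nrm2 (residual h (v n) n)) 0.
      by left; rewrite /normalise r0 sqrtr0 invr0 scale0r.
    by right; exact: normalise_ip.
split.
- by move=> k; have [IS _ _] := main k.+1; exact: IS.
- move=> j k jk; have [_ IO _] := main (maxn j k).+1.
  by apply: IO => //; rewrite ltnS ?leq_maxl ?leq_maxr.
- by move=> k; have [_ _ IN] := main k.+1; exact: IN.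
Qed.

Lemma ortho_gs w : S w -> (forall n, ip (v n) w = 0) -> forall n, ip (g n) w = 0.
Proof.
move=> Sw vw n; have og := gs_ortho_seq; case: (og) => Sg _ _.
elim/ltn_ind: n => n IH; rewrite {1}/g gsE ph_ipZl//; last exact: residualS.
by rewrite residual_ip// vw mulr0.
Qed.

(** [v n] is a combination of [g 0], ..., [g n] up to a vector of norm 0, and by Cauchy-Schwarz such
    a vector is orthogonal to everything. *)
Lemma ortho_gs_inv w n : S w -> (forall k, (k <= n)%N -> ip (g k) w = 0) ->
  ip (v n) w = 0.
Proof.
move=> Sw gw; have og := gs_ortho_seq; case: (og) => Sg _ _.
have Sr := residualS og n (Sv n).
rewrite -(residual_ip og (n := n) (Sv n) Sw); last first.
  by move=> k /ltnW kn; exact: gw.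
have [r0|r0] := eqVneq (nrm2 (residual g (v n) n)) 0.
  exact: nrm2_eq0_ip.
have := gw n (leqnn n); rewrite {1}/g gsE ph_ipZl// => /eqP.
rewrite mulf_eq0 => /orP[|/eqP//].
rewrite -[0](rmorph0 (real_complex R)) (inj_eq (@complexI _)) invr_eq0.
by rewrite sqrtr_eq0 leNgt lt_neqAle eq_sym r0 (ph_pos pH Sr).
Qed.

End Theory.
End PreHilbert.

(** * Square-summable functions on one fibre and pointwise limits *)

Section L2Fibre.
Context {R : realType} {T : choiceType}.
Local Notation C := R[i].
Implicit Types (A : set T) (f g h : T -> C).

Lemma l2_prehilbert A : prehilbert (fin2 A) (l2ip A : (T -> C) -> (T -> C) -> C).
Proof.
split.
- exact: fin2_0.
- by move=> a u v; exact: fin2_lin.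
- by move=> a u v w; exact: l2ip_linl.
- by move=> u v _ _; exact: l2ip_herm.
- by move=> u _; rewrite l2ip_norm /= fine_ge0 ?l2norm2_ge0.
Qed.

Lemma l2_nrm2 A f : nrm2 (l2ip A) f = fine (l2norm2 A f).
Proof. by rewrite /nrm2 l2ip_norm. Qed.

Definition ccvg (u : nat -> C) (l : C) :=
  (fun n => complex.Re (u n)) @ \oo --> complex.Re l /\
  (fun n => complex.Im (u n)) @ \oo --> complex.Im l.

Lemma ccvg_cst (l : C) : ccvg (fun=> l) l.
Proof. by split; exact: cvg_cst. Qed.

Lemma ccvg_lin (u v : nat -> C) l m (a : C) : ccvg u l -> ccvg v m ->
  ccvg (fun n => a * u n + v n) (a * l + m).
Proof.
move=> [u1 u2] [v1 v2]; split.
  under eq_fun do rewrite Defs.ReD Defs.ReM.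
  rewrite Defs.ReD Defs.ReM; apply: cvgD => //.
  by apply: cvgB; apply: cvgM => //; exact: cvg_cst.
under eq_fun do rewrite Defs.ImD Defs.ImM.
rewrite Defs.ImD Defs.ImM; apply: cvgD => //.
by apply: cvgD; apply: cvgM => //; exact: cvg_cst.
Qed.

Lemma ccvg_normsq (u : nat -> C) l : ccvg u l ->
  (fun n => normsq (u n)) @ \oo --> normsq l.
Proof.
by move=> [u1 u2]; apply: cvgD; rewrite !expr2; under eq_fun do rewrite expr2;
  exact: cvgM.
Qed.

Lemma rcvg_sum (I : eqType) (r : seq I) (F : nat -> I -> R) (l : I -> R) :
  (forall i, i \in r -> F ^~ i @ \oo --> l i) ->
  (fun n => \sum_(i <- r) F n i) @ \oo --> \sum_(i <- r) l i.
Proof.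
elim: r => [|i r IH] h.
  by under eq_fun do rewrite big_nil; rewrite big_nil; exact: cvg_cst.
under eq_fun do rewrite big_cons.
rewrite big_cons; apply: cvgD; first by apply: h; rewrite mem_head.
by apply: IH => j jr; apply: h; rewrite inE jr orbT.
Qed.

(** Fatou for the counting measure: on a finite subset of [A] the limit passes through the sum, and
    [l2norm2] is the supremum of these finite sums. *)
Lemma l2norm2_fatou A (F : nat -> T -> C) f (c : nat -> R) l :
  (forall n, (l2norm2 A (F n) <= (c n)%:E)%E) -> c @ \oo --> l ->
  (forall a, A a -> ccvg (F ^~ a) (f a)) -> (l2norm2 A f <= l%:E)%E.
Proof.
move=> Fc cl Ff; apply: ge_ereal_sup => _ [X [fX XA] <-].
rewrite fsumEFin// lee_fin fsbig_finite//=.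
have cv : (fun n => \sum_(a <- fset_set X) normsq (F n a)) @ \oo -->
    \sum_(a <- fset_set X) normsq (f a).
  apply: rcvg_sum => a; rewrite in_fset_set// inE => /XA Aa.
  exact/ccvg_normsq/Ff.
apply: ler_cvg_to cv cl _; apply: nearW => n.
rewrite -lee_fin -sumEFin; apply: le_trans (Fc n).
by apply: esum_ge; exists X => //; rewrite fsbig_finite.
Qed.

End L2Fibre.

Section NatSums.
Context {R : realType}.
Local Notation C := R[i].

Lemma rsum_nat_cvg (f : nat -> R) : rsummable setT f ->
  (fun n => \sum_(k < n) f k) @ \oo --> rsum setT f.
Proof.
have pos (h : nat -> R) : (forall n, 0 <= h n) -> rsummable setT h ->
    (fun n => \sum_(k < n) h k) @ \oo --> fine (\esum_(n in setT) (h n)%:E).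
  move=> h0 sh.
  have hfin : (\esum_(n in setT) (h n)%:E \is a fin_num)%E by exact: esum_fin_num.
  rewrite (_ : (fun n => _) = fine \o (fun n => \sum_(0 <= k < n) (h k)%:E)%E).
    apply: fine_cvg; rewrite fineK// -nneseries_esumT//.
    by apply: is_cvg_nneseries => n _ _; rewrite lee_fin.
  by apply/funext => n /=; rewrite sumEFin/= big_mkord.
move=> sf.
have posneg (x : R) : x = Num.max x 0 - Num.max (- x) 0.
  by case: (lerP x 0); case: (lerP (- x) 0); lra.
have max_ge0 (x : R) : 0 <= Num.max x 0 by rewrite le_max lexx orbT.
under eq_fun => n do under eq_bigr do rewrite (posneg (f _)).
under eq_fun do rewrite sumrB.
apply: cvgB; apply: pos => //; apply: rsummable_pos => //.
by apply: rsummable_le sf => a _; rewrite normrN.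
Qed.

Lemma csum_nat_cvg (f : nat -> C) : csummable setT f ->
  ccvg (fun n => \sum_(k < n) f k) (csum setT f).
Proof.
move=> [f1 f2]; split.
  by under eq_fun do rewrite Re_sum; exact: rsum_nat_cvg.
by under eq_fun do rewrite Im_sum; exact: rsum_nat_cvg.
Qed.

Lemma l2norm2_nat_le (f : nat -> C) (c : R) :
  (forall n, \sum_(k < n) normsq (f k) <= c) -> (l2norm2 setT f <= c%:E)%E.
Proof.
move=> fc; rewrite /l2norm2 -nneseries_esumT; last first.
  by move=> n; rewrite lee_fin normsq_ge0.
apply: lime_le.
  by apply: is_cvg_nneseries => n _ _; rewrite lee_fin normsq_ge0.
by apply: nearW => n; rewrite sumEFin lee_fin big_mkord.
Qed.

End NatSums.

(** * Projection onto the orthogonal complement of an orthonormal sequence *)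

Section Projection.
Context {R : realType} {T : choiceType} (A : set T).
Local Notation C := R[i].
Local Notation ip := (l2ip A : (T -> C) -> (T -> C) -> C).
Local Notation PH := (l2_prehilbert A).
Context (g : nat -> T -> C) (og : ortho_seq (fin2 A) ip g).

Lemma sum_fun I (r : seq I) (P : pred I) (F : I -> T -> C) a :
  (\sum_(i <- r | P i) F i) a = \sum_(i <- r | P i) F i a.
Proof. by elim/big_rec2: _ => // i y1 y2 _ <-. Qed.

Lemma residualE F n a :
  residual ip g F n a = F a - \sum_(k < n) ip F (g k) * g k a.
Proof.
rewrite -[LHS]/(F a - (\sum_(k < n) ip F (g k) *: g k) a).
by rewrite sum_fun.
Qed.

Lemma bessel F : fin2 A F ->
  (l2norm2 setT (fun n => ip F (g n)) <= l2norm2 A F)%E.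
Proof.
move=> fF; rewrite -(fineK (fin2_fin_num fF)); apply: l2norm2_nat_le => n.
by have := bessel_le PH og n fF; rewrite l2_nrm2.
Qed.

Lemma ip_zeta_l F a : A a -> ip (zeta a) F = conjc (F a).
Proof. by move=> Aa; rewrite l2ip_herm l2ip_zeta. Qed.

(** Bessel for the unit vector at [a], whose coefficients are the conjugates of the values
    [g n a]. *)
Lemma bessel_zeta a : A a -> (l2norm2 setT (fun n => g n a) <= 1)%E.
Proof.
move=> Aa; rewrite -(l2norm2_zeta (R := R) Aa); have := bessel (fin2_zeta A a).
apply: le_trans; apply: le_esum => n _.
by rewrite ip_zeta_l// normsq_conjc.
Qed.

Lemma fin2_zeta_coef a : A a -> fin2 setT (fun n => g n a).
Proof. by move=> Aa; apply: le_lt_trans (bessel_zeta Aa) _; rewrite ltry. Qed.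

Lemma fin2_coef F : fin2 A F -> fin2 setT (fun n => ip F (g n)).
Proof. by move=> fF; apply: le_lt_trans (bessel fF) _. Qed.

(** The Fourier series is summed point by point; for [b] in [A] and [F] square-summable it converges
    absolutely, both factors being square-summable in [n]. *)
Definition proj_orth (F : T -> C) : T -> C := fun b =>
  F b - csum setT (fun n => ip F (g n) * g n b).

(** The diagonal matrix coefficient of the projection at [a], as [proj_orth_zeta_diag] shows. *)
Definition proj_diag (a : T) : R :=
  1 - fine (l2norm2 setT (fun n => g n a)).

Lemma residual_cvg F b : fin2 A F -> A b ->
  ccvg (fun n => residual ip g F n b) (proj_orth F b).
Proof.
move=> fF Ab; rewrite /proj_orth.
have s : csummable setT (fun n => ip F (g n) * g n b).
  have fc : fin2 setT (fun n => conjc (g n b)).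
    apply: le_lt_trans (fin2_zeta_coef Ab); apply: le_esum => n _.
    by rewrite normsq_conjc.
  have := fin2_csummable (fin2_coef fF) fc.
  by under eq_fun do rewrite conjcK.
have := ccvg_lin (-1) (csum_nat_cvg s) (ccvg_cst (F b)).
rewrite mulN1r addrC; congr ccvg.
by apply/funext => n; rewrite residualE mulN1r addrC.
Qed.

Let defect F := fine (l2norm2 A F) - fine (l2norm2 setT (fun n => ip F (g n))).

Lemma residual_nrm2_cvg F : fin2 A F ->
  (fun n => nrm2 ip (residual ip g F n)) @ \oo --> defect F.
Proof.
move=> fF; under eq_fun do rewrite (residual_nrm2 PH og)// l2_nrm2.
apply: cvgB; first exact: cvg_cst.
have sF : rsummable setT (fun n => normsq (ip F (g n))).
  apply: le_lt_trans (fin2_coef fF); apply: le_esum => n _.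
  by rewrite ger0_norm ?normsq_ge0.
rewrite /l2norm2 -(rsum_ge0E (f := fun n => normsq (ip F (g n)))).
  exact: rsum_nat_cvg.
by move=> n _; exact: normsq_ge0.
Qed.

Lemma proj_orth_norm F : fin2 A F ->
  (l2norm2 A (proj_orth F) <= (defect F)%:E)%E.
Proof.
move=> fF; apply: l2norm2_fatou (residual_nrm2_cvg fF) _ => [n|a Aa].
  rewrite l2_nrm2 fineK//; apply: fin2_fin_num.
  exact: (residualS PH og n fF).
exact: residual_cvg.
Qed.

Lemma fin2_proj_orth F : fin2 A F -> fin2 A (proj_orth F).
Proof.
by move=> fF; apply: le_lt_trans (proj_orth_norm fF) _; rewrite ltry.
Qed.

Lemma proj_orth_le F : fin2 A F -> (l2norm2 A (proj_orth F) <= l2norm2 A F)%E.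
Proof.
move=> fF; apply: le_trans (proj_orth_norm fF) _.
rewrite -[leRHS](fineK (fin2_fin_num fF)) lee_fin /defect.
by rewrite gerBl fine_ge0 ?l2norm2_ge0.
Qed.

(** The residuals converge to [proj_orth F] only pointwise, but by Fatou the
    limit still minimizes the distance to the orthogonal complement. *)
Lemma proj_orth_ip F w : fin2 A F -> fin2 A w -> (forall n, ip (g n) w = 0) ->
  ip (F - proj_orth F) w = 0.
Proof.
move=> fF fw gw; have fP := fin2_proj_orth fF.
set z := ip (F - proj_orth F) w.
have Sr n := residualS PH og n fF.
have key (a : C) : nrm2 ip (proj_orth F) + 2 * complex.Re (conjc a * ip (proj_orth F) w)
    + normsq a * nrm2 ip w <=
    defect F + 2 * complex.Re (conjc a * ip F w) + normsq a * nrm2 ip w.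
  rewrite -(nrm2_addZ PH)// l2_nrm2 -lee_fin fineK; last first.
    apply: fin2_fin_num; apply: (phD PH) => //; exact: (phZ PH).
  apply: (@l2norm2_fatou _ _ _ (fun n => residual ip g F n + a *: w) _
    (fun n => nrm2 ip (residual ip g F n) + 2 * complex.Re (conjc a * ip F w) +
      normsq a * nrm2 ip w)).
  - move=> n; rewrite -(residual_ip PH og (n := n) fF fw)//.
    rewrite -(nrm2_addZ PH)// l2_nrm2 fineK//; apply: fin2_fin_num.
    by apply: (phD PH) => //; exact: (phZ PH).
  - apply: cvgD; last exact: cvg_cst.
    apply: cvgD; last exact: cvg_cst.
    exact: residual_nrm2_cvg.
  - move=> b Ab; have := ccvg_lin 1 (residual_cvg fF Ab) (ccvg_cst (a * w b)).
    by rewrite mul1r; congr ccvg; apply/funext => n; rewrite mul1r.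
have zE : z = ip F w - ip (proj_orth F) w by exact: (ph_ipBl PH).
(* For [a = - t z] the terms quadratic in [a] cancel between the two sides of [key]. What remains is
   linear in [t], which forces [z = 0]. *)
have key2 (t : R) : 2 * t * normsq z <= defect F - nrm2 ip (proj_orth F).
  have := key (- (t%:C%C * z)).
  have -> : ip F w = z + ip (proj_orth F) w by rewrite zE subrK.
  have ReMD (x y1 y2 : C) : complex.Re (x * (y1 + y2)) =
      complex.Re (x * y1) + complex.Re (x * y2) by rewrite mulrDr Defs.ReD.
  rewrite ReMD.
  have -> : complex.Re (conjc (- (t%:C%C * z)) * z) = - (t * normsq z).
    by rewrite conjcN conjcM conjc_real mulNr ReN -mulrA (mulrC _ z) mulc_conj
      -rmorphM.
  lra.
apply/normsq_eq0/eqP; rewrite eq_le normsq_ge0 andbT leNgt; apply/negP => z0.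
have := key2 ((defect F - nrm2 ip (proj_orth F) + 1) / (2 * normsq z)).
rewrite (_ : 2 * _ * _ = defect F - nrm2 ip (proj_orth F) + 1); first lra.
by field; rewrite gt_eqF.
Qed.

(** Against a finitely supported [v] the inner product is a finite sum, so pointwise convergence of
    the residuals carries over to it. *)
Lemma proj_orth_ortho F v : fin2 A F -> finite_set (A `&` [set a | v a <> 0]) ->
  (exists N, forall n, (N <= n)%N -> ip (residual ip g F n) v = 0) ->
  ip (proj_orth F) v = 0.
Proof.
move=> fF fv [N rv].
have ipE h : ip h v = \sum_(a <- fset_set (A `&` [set a | v a <> 0]))
    h a * conjc (v a).
  rewrite /l2ip (@csum_supp _ _ A (A `&` [set a | v a <> 0])); first last.
  - move=> a Aa; rewrite /= not_andP => -[//|/contrapT ->].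
    by rewrite conjc0 mulr0.
  - by move=> a [].
  by rewrite csum_fset// fsbig_finite.
have cv : ccvg (fun n => ip (residual ip g F n) v) (ip (proj_orth F) v).
  rewrite ipE; under eq_fun do rewrite ipE.
  have : forall a, a \in fset_set (A `&` [set a | v a <> 0]) ->
      ccvg (fun n => residual ip g F n a * conjc (v a))
        (proj_orth F a * conjc (v a)).
    move=> a; rewrite in_fset_set// inE => -[Aa _].
    have := ccvg_lin (conjc (v a)) (residual_cvg fF Aa) (ccvg_cst 0).
    rewrite addr0 mulrC; congr ccvg; apply/funext => n.
    by rewrite addr0 mulrC.
  move=> h; split.
    rewrite Re_sum; under eq_fun do rewrite Re_sum.
    by apply: rcvg_sum => a /h[].
  rewrite Im_sum; under eq_fun do rewrite Im_sum.
  by apply: rcvg_sum => a /h[].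
have lim0 (u : nat -> R) l : u @ \oo --> l -> (forall n, (N <= n)%N -> u n = 0) ->
    l = 0.
  move=> ul u0; have : u @ \oo --> (0 : R).
    by apply: cvg_near_cst; exists N => // n /= Nn; exact: u0.
  by apply: cvg_unique.
case: cv => c1 c2; apply: complex_eq.
  by apply: lim0 c1 _ => n Nn; rewrite rv.
by apply: lim0 c2 _ => n Nn; rewrite rv.
Qed.

Lemma proj_orth_zeta_diag a : A a -> proj_orth (zeta a) a = (proj_diag a)%:C%C.
Proof.
move=> Aa; rewrite /proj_orth /zeta eqxx /proj_diag rmorphB rmorph1.
congr (_ - _); apply: etrans _ (l2ip_norm setT (fun n => g n a)).
by apply: eq_csum => n _; rewrite ip_zeta_l// mulrC.
Qed.

Lemma proj_orth_zeta_norm a : A a ->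
  fine (l2norm2 A (proj_orth (zeta a))) <= proj_diag a.
Proof.
move=> Aa; rewrite -lee_fin fineK; last exact/fin2_fin_num/fin2_proj_orth/fin2_zeta.
apply: le_trans (proj_orth_norm (fin2_zeta A a)) _.
rewrite lee_fin /defect l2norm2_zeta//= /proj_diag lerB//.
rewrite le_eqVlt; apply/orP; left; apply/eqP; congr fine.
by apply: eq_esum => n _; rewrite ip_zeta_l// normsq_conjc.
Qed.

Lemma proj_diag_ge0 a : A a -> 0 <= proj_diag a.
Proof.
move=> Aa; apply: le_trans (proj_orth_zeta_norm Aa).
by rewrite fine_ge0 ?l2norm2_ge0.
Qed.

(** The projection of [zeta a] is the reproducing kernel at [a] of the orthogonal complement of the
    [g n]; Cauchy-Schwarz bounds the evaluation [k a]. *)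
Lemma proj_diag_reproducing k a : A a -> fin2 A k -> (forall n, ip (g n) k = 0) ->
  normsq (k a) <= proj_diag a * fine (l2norm2 A k).
Proof.
move=> Aa fk gk; have fz := fin2_zeta (R := R) A a; have fP := fin2_proj_orth fz.
have -> : normsq (k a) = normsq (ip (proj_orth (zeta a)) k).
  have := proj_orth_ip fz fk gk; rewrite (ph_ipBl PH)// ip_zeta_l// => /eqP.
  by rewrite subr_eq0 => /eqP <-; rewrite normsq_conjc.
apply: le_trans (ph_CS PH fP fk) _; rewrite !l2_nrm2 ler_wpM2r//.
  by rewrite fine_ge0 ?l2norm2_ge0.
exact: proj_orth_zeta_norm.
Qed.

End Projection.

(** * Dimension as a trace *)

Section LinearAlgebra.
Context {F : fieldType} {V : lmodType F}.

(** If [m < n], the [n] by [m] matrix of coefficients has a nonzero vector in its left kernel, which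
    is a linear relation between the [v i]. *)
Lemma free_family_le (n m : nat) (v : 'I_n -> V) (w : 'I_m -> V) :
  (forall c : 'I_n -> F, \sum_i c i *: v i = 0 -> forall i, c i = 0) ->
  (forall i, exists c : 'I_m -> F, v i = \sum_j c j *: w j) -> (n <= m)%N.
Proof.
move=> free_v /choice[c vE]; rewrite leqNgt; apply/negP => mn.
pose M : 'M[F]_(n, m) := \matrix_(i, j) c i j.
have : kermx M != 0.
  rewrite kermx_eq0 /row_free neq_ltn; apply/orP; left.
  exact: leq_ltn_trans (rank_leq_col M) mn.
move=> /rowV0Pn[x /sub_kermxP xM /eqP x0]; apply: x0.
apply/rowP => i; rewrite mxE; apply: (free_v (fun i => x 0 i)).
under eq_bigr do rewrite vE scaler_sumr.
rewrite exchange_big/= big1// => j _.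
under eq_bigr do rewrite scalerA.
rewrite -scaler_suml (_ : \sum_i _ = (x *m M) 0 j); last first.
  by rewrite mxE; apply: eq_bigr => k _; rewrite mxE.
by rewrite xM mxE scale0r.
Qed.

Lemma has_dim_uniq (K : set V) n m : has_dim K n -> has_dim K m -> n = m.
Proof.
have le n' m' : has_dim K n' -> has_dim K m' -> (n' <= m')%N.
  move=> [v [fv Kv]] [w [_ Kw]]; apply: free_family_le fv _ => i.
  have : K (v i).
    rewrite Kv; exists (fun j => (j == i)%:R).
    rewrite (bigD1 i)//= eqxx scale1r big1 ?addr0// => j /negbTE ->.
    by rewrite scale0r.
  by rewrite Kw => -[c ->]; exists c.
by move=> hn hm; apply/eqP; rewrite eqn_leq !le.
Qed.

Lemma dimension_has_dim (K : set V) n : has_dim K n -> dimension K = n.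
Proof.
move=> Kn; apply: (@has_dim_uniq K _ n) => //; exact: (@xgetI _ 0%N [set n | has_dim K n] n).
Qed.

Lemma dimension_infinite (K : set V) :
  (forall n, ~ has_dim K n) -> dimension K = 0%N.
Proof. exact: (@xgetPN _ 0%N [set n | has_dim K n]). Qed.

End LinearAlgebra.

Section Dimension.
Context {R : realType} {T : choiceType} (A : set T).
Local Notation C := R[i].
Local Notation ip := (l2ip A : (T -> C) -> (T -> C) -> C).
Local Notation PH := (l2_prehilbert A).
Context (K : set (T -> C)) (q : T -> R).
Hypothesis K0 : K 0.
Hypothesis Klin : forall a u v, K u -> K v -> K (a *: u + v).
Hypothesis Kl2 : K `<=` l2 A.
(** Together with [q_ge] this says that [q a] is the least nonnegative constant bounding evaluation
    at [a] on [K], that is the diagonal of the reproducing kernel of [K]. *)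
Hypothesis q_le : forall k a, K k -> A a ->
  normsq (k a) <= q a * fine (l2norm2 A k).
Hypothesis q_ge : forall a, A a -> exists2 p, K p &
  p a = (q a)%:C%C /\ fine (l2norm2 A p) <= q a.

Let Kfin u : K u -> fin2 A u. Proof. by move=> /Kl2[]. Qed.

Let KZ a u : K u -> K (a *: u).
Proof. by move=> Ku; rewrite -[_ *: _]addr0; exact: Klin. Qed.

Let KB u v : K u -> K v -> K (u - v).
Proof. by move=> Ku Kv; rewrite addrC -scaleN1r; exact: Klin. Qed.

Let K_sum n (f : 'I_n -> T -> C) : (forall i, K (f i)) -> K (\sum_i f i).
Proof.
move=> Kf; apply: big_ind => // u v Ku Kv; rewrite -[u]scale1r.
exact: Klin.
Qed.

Let q_ge0 a : A a -> 0 <= q a.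
Proof.
move=> /q_ge[p _ [_]]; apply: le_trans.
by rewrite fine_ge0 ?l2norm2_ge0.
Qed.

(** Padding by zeros makes a finite orthonormal family an [ortho_seq], so that residuals are
    available. *)
Definition frame m (g : nat -> T -> C) := [/\ ortho_seq (fin2 A) ip g,
  forall k, K (g k), forall k, (k < m)%N -> ip (g k) (g k) = 1 &
  forall k, (m <= k)%N -> g k = 0].

Definition frame_spans m (g : nat -> T -> C) :=
  forall u, K u -> u = \sum_(k < m) ip u (g k) *: g k.

Let frame_free m g : frame m g ->
  forall c : 'I_m -> C, \sum_i c i *: g i = 0 -> forall i, c i = 0.
Proof.
move=> [[Sg go _] _ g1 _] c c0 i.
have := congr1 (ip ^~ (g i)) c0; rewrite (ph_ip0l PH)//.
rewrite (ph_suml PH)//; last by move=> j _; apply: (phZ PH).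
rewrite (bigD1 i)//= (ph_ipZl PH)// g1// mulr1 big1 ?addr0// => j ji.
by rewrite (ph_ipZl PH)// go ?mulr0.
Qed.

(** The new member is the normalised residual of a vector outside the span. Its norm is nonzero
    because functions in [K] vanish outside [A], so that the form is definite on [K]. *)
Let frame_extend m g : frame m g -> ~ frame_spans m g ->
  exists g', frame m.+1 g'.
Proof.
move=> fg /existsNP[u /not_implyP[Ku nu]]; case: (fg) => og Kg g1 g0.
case: (og) => Sg go gn.
pose r := residual ip g u m.
have Kr : K r by apply: KB => //; apply: K_sum => i; exact: KZ.
have Sr := Kfin Kr.
have r0 : nrm2 ip r != 0.
  apply/eqP; rewrite l2_nrm2 => nr0.
  have r0 : forall a, A a -> r a = 0.
    by apply: l2norm2_eq0; rewrite -(fineK (fin2_fin_num Sr)) nr0.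
  apply: nu; apply/eqP; rewrite -subr_eq0; apply/eqP.
  apply/funext => a; have [Aa|Aa] := pselect (A a); first exact: r0.
  by have [rA _] := Kl2 Kr; exact: rA.
have Kn : K (normalise ip r) by exact: KZ.
have northo k : (k < m)%N -> ip (normalise ip r) (g k) = 0.
  by move=> km; rewrite (ph_ipZl PH)// (residual_ortho PH og) ?mulr0//; exact: Kfin.
pose h k := if k == m then normalise ip r else g k.
have no k : k != m -> ip (normalise ip r) (g k) = 0.
  rewrite neq_ltn => /orP[/northo//|mk].
  by rewrite g0 ?(ltnW mk)// (ph_ip0r PH)//; exact: Kfin.
exists h; split.
- split.
  + by move=> k; rewrite /h; case: ifP => // _; exact: Kfin.
  + move=> j k; rewrite /h; have [->|jm] := eqVneq j m.
      have [//|km _] := eqVneq k m.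
      exact: no.
    have [_ _|km jk] := eqVneq k m; last exact: go.
    by rewrite (ph_herm PH (Kfin Kn) (Sg j)) no// conjc0.
  + move=> k; rewrite /h; case: ifP => // _; right.
    exact: (normalise_ip PH).
- by move=> k; rewrite /h; case: ifP.
- move=> k; rewrite ltnS leq_eqVlt /h; have [_ _|_ /= km] := eqVneq k m.
    exact: (normalise_ip PH).
  exact: g1.
- by move=> k mk; rewrite /h gtn_eqF// g0// ltnW.
Qed.

Let frame_has_dim m g : frame m g -> frame_spans m g -> has_dim K m.
Proof.
move=> fg sg; exists (fun i : 'I_m => g i); split; first exact: frame_free.
apply/seteqP; split=> [u Ku|u [c ->]].
  by exists (fun i : 'I_m => ip u (g i)); exact: sg.
by apply: K_sum => i; apply: KZ; case: fg.
Qed.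

(** For a frame [g], the reproducing kernel at [a] of the span of the first [m] members. *)
Let kernel_vec (g : nat -> T -> C) m (a : T) : T -> C := \sum_(k < m) conjc (g k a) *: g k.

Let kernel_vecE (g : nat -> T -> C) m a :
  kernel_vec g m a a = (\sum_(k < m) normsq (g k a))%:C%C.
Proof.
rewrite /kernel_vec sum_fun rmorph_sum; apply: eq_bigr => k _.
by rewrite -[LHS]/(conjc (g k a) * g k a) mulrC; exact: mulc_conj.
Qed.

Let kernel_vec_norm g m a : frame m g ->
  nrm2 ip (kernel_vec g m a) = \sum_(k < m) normsq (g k a).
Proof.
move=> [[Sg go _] _ g1 _].
have SK : fin2 A (kernel_vec g m a).
  by apply: (ph_sum PH) => i _; exact: (phZ PH).
rewrite /nrm2 {1}/kernel_vec (ph_suml PH)//; last first.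
  by move=> i _; exact: (phZ PH).
rewrite Re_sum; apply: eq_bigr => k _.
rewrite (ph_ipZl PH)// (ph_sumr PH)//; last by move=> i _; exact: (phZ PH).
rewrite (bigD1 k)//= (ph_ipZr PH)// g1// conjcK mulr1 big1 ?addr0; last first.
  by move=> i ik; rewrite (ph_ipZr PH)// go ?mulr0// eq_sym.
by rewrite mulrC Re_mulc_conj.
Qed.

Let esum_frame m g : frame m g ->
  (\esum_(a in A) (\sum_(k < m) normsq (g k a))%:E = m%:R%:E)%E.
Proof.
move=> [[Sg _ _] _ g1 _]; under eq_esum do rewrite -sumEFin.
rewrite esum_sum; last by move=> *; rewrite lee_fin normsq_ge0.
rewrite (eq_bigr (fun=> 1%:E)); last first.
  move=> k _; rewrite -/(l2norm2 A (g k)) -(fineK (fin2_fin_num (Sg k))).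
  by congr EFin; apply: complexI; rewrite -l2ip_norm g1.
by rewrite sumEFin sumr_const card_ord.
Qed.

(** The value of [kernel_vec] at [a] and its squared norm are the same number [t], so [q_le] reads
    [t ^ 2 <= q a * t]. *)
Let frame_le m g a : frame m g -> A a -> \sum_(k < m) normsq (g k a) <= q a.
Proof.
move=> fg Aa; set t := \sum_(k < m) _.
have Kk : K (kernel_vec g m a).
  by apply: K_sum => i; apply: KZ; case: fg.
have := q_le Kk Aa; rewrite kernel_vecE -l2_nrm2 kernel_vec_norm// -/t.
have t0 : 0 <= t by apply: sumr_ge0 => k _; exact: normsq_ge0.
rewrite /normsq /= expr0n addr0 expr2.
have [->|tn0] := eqVneq t 0; first by rewrite q_ge0.
by rewrite ler_pM2r// lt_neqAle eq_sym tn0.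
Qed.

(** Cauchy-Schwarz for the vector [p] of [q_ge] and [kernel_vec], whose inner product is
    [p a = q a]: with [t] the sum on the right, [q a ^ 2 <= q a * t]. *)
Let frame_ge m g a : frame m g -> frame_spans m g -> A a ->
  q a <= \sum_(k < m) normsq (g k a).
Proof.
move=> fg sg Aa; have [p Kp [pa np]] := q_ge Aa.
case: (fg) => [[Sg _ _] _ _ _].
have t0 : 0 <= \sum_(k < m) normsq (g k a).
  by apply: sumr_ge0 => k _; exact: normsq_ge0.
have SK : fin2 A (kernel_vec g m a).
  by apply: (ph_sum PH) => i _; exact: (phZ PH).
have := ph_CS PH (Kfin Kp) SK; rewrite kernel_vec_norm// l2_nrm2.
have -> : ip p (kernel_vec g m a) = p a.
  have Sp := Kfin Kp; rewrite {2}(sg _ Kp) sum_fun (ph_sumr PH)//; last first.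
    by move=> i _; exact: (phZ PH).
  apply: eq_bigr => k _; rewrite (ph_ipZr PH)//.
  by rewrite conjcK mulrC.
rewrite pa /normsq /= expr0n addr0 expr2 => h.
have {}h : q a * q a <= q a * \sum_(k < m) normsq (g k a).
  by apply: le_trans h _; rewrite ler_wpM2r.
have [->//|qn0] := eqVneq (q a) 0.
by move: h; rewrite ler_pM2l// lt_neqAle eq_sym qn0 q_ge0.
Qed.

(** If some frame spans [K], its length is the dimension and [q a] is the sum of its
    [normsq (g k a)]. Otherwise there are frames of every length, the sum of [q] is infinite, and
    both sides are 0 by convention. *)
Lemma dimension_esum : (dimension K)%:R = fine (\esum_(a in A) (q a)%:E).
Proof.
have [[m [g [fg sg]]]|nospan] := pselect (exists m g, frame m g /\ frame_spans m g).
  rewrite (dimension_has_dim (frame_has_dim fg sg)).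
  have -> : (\esum_(a in A) (q a)%:E = m%:R%:E)%E; last by [].
  rewrite -(esum_frame fg); apply: eq_esum => a Aa; congr EFin.
  by apply/eqP; rewrite eq_le frame_le// frame_ge.
have frames m : exists g, frame m g.
  elim: m => [|m [g fg]].
    exists (fun=> 0); split=> //; split=> //.
    - by move=> k; exact: (ph0 PH).
    - by move=> *; rewrite (ph_ip0l PH)//; exact: (ph0 PH).
    - by left.
  by apply: (frame_extend fg) => sg; apply: nospan; exists m, g.
rewrite dimension_infinite; last first.
  move=> n [v [_ Kv]]; have [g fg] := frames n.+1.
  suff : (n.+1 <= n)%N by rewrite ltnn.
  apply: free_family_le (frame_free fg) _ => i.
  have : K (g i) by case: fg.
  by rewrite Kv => -[c ->]; exists c.
have -> : (\esum_(a in A) (q a)%:E = +oo)%E; last by [].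
apply/eqyP => r r0; have [g fg] := frames (Num.truncn r).+1.
apply: (@le_trans _ _ ((Num.truncn r).+1%:R%:E)).
  by rewrite lee_fin ltW// real_truncnS_gt// num_real.
rewrite -(esum_frame fg); apply: le_esum => a Aa.
by rewrite lee_fin frame_le.
Qed.

End Dimension.

(** * Extending measurable functions from a measurable domain *)

Section MeasurableExtension.
Context d d' (X : measurableType d) (Y : measurableType d').

Lemma measurable_fun_mem (D : set X) : measurable D ->
  measurable_fun setT (fun x => x \in D).
Proof.
move=> mD; apply: (measurable_fun_bool true); rewrite setTI.
by rewrite (_ : _ @^-1` _ = D)//; apply/seteqP; split=> x /=; [move/set_mem|move/mem_set].
Qed.

Lemma measurable_fun_patch (D : set X) (f : X -> Y) (c : Y) : measurable D ->
  measurable_fun D f -> measurable_fun setT (fun x => if x \in D then f x else c).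
Proof.
move=> mD mf; apply: measurable_fun_if => //; first exact: measurable_fun_mem.
rewrite setTI (_ : _ @^-1` _ = D)//.
by apply/seteqP; split=> x /=; [move/set_mem|move/mem_set].
Qed.

End MeasurableExtension.

Lemma measurable_fun_pair_in d d1 d2 (X : measurableType d)
    (Y : measurableType d1) (Z : measurableType d2) (D : set X) (f : X -> Y)
    (g : X -> Z) : measurable D -> measurable_fun D f -> measurable_fun D g ->
  measurable_fun D (fun x => (f x, g x)).
Proof.
move=> mD mf mg.
apply: (eq_measurable_fun (fun x => (if x \in D then f x else point,
  if x \in D then g x else point))); first by move=> x ->.
apply: measurable_funS (measurableT) (@subsetT _ D) _.
by apply: measurable_fun_pair; exact: measurable_fun_patch.
Qed.

(** * Measurability of the groupoid operations *)

Section StandardBorel.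
Context {R : realType} {d} {T : measurableType d} (sb : standard_borel R T).

(** The sets are preimages of small balls around the points of a countable dense set, one for each
    pair of a point and a radius [1 / (n + 1)]. *)
Lemma standard_borel_separating : exists U : nat -> set T,
  (forall n, measurable (U n)) /\
  forall x y, x <> y -> exists n, U n x /\ ~ U n y.
Proof.
case: sb => P [f [hP [A cA dA] [g fK gK] mU]].
have mf (V : set P) : open V -> measurable (f @^-1` V).
  move=> oV; apply/mU; apply: sub_sigma_algebra => /=.
  suff -> : f @` (f @^-1` V) = V by [].
  apply/seteqP; split=> [_ [x Vx <-]//|p Vp].
  by exists (g p); rewrite /= ?gK.
have /countable_injP[e einj] := cA.
pose U (k n : nat) := \bigcup_(a in A `&` [set a | e a = k])
  f @^-1` (interior (ball a (n.+1%:R^-1 : R))).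
have mUkn k n : measurable (U k n).
  have [[a [Aa ak]]|na] := pselect (exists a, A a /\ e a = k).
    rewrite (_ : U k n = f @^-1` (interior (ball a (n.+1%:R^-1 : R)))).
      by apply: mf; exact: open_interior.
    apply/seteqP; split=> [x [b [Ab bk] h]|x h]; last by exists a.
    by rewrite (_ : a = b)//; apply: einj; rewrite ?inE// ak bk.
  rewrite (_ : U k n = set0)//; apply/seteqP; split=> // x [a [Aa ak] _].
  by apply: na; exists a.
have [h [h' hK]] : exists h : nat -> nat * nat, exists h', cancel h' h.
  exists (fun n => odflt (0, 0)%N (@choice.unpickle (nat * nat)%type n)).
  by exists (@choice.pickle (nat * nat)%type) => n; rewrite choice.pickleK.
exists (fun n => U (h n).1 (h n).2); split=> // x y xy.
have fxy : f x <> f y by move=> /(can_inj fK).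
move: hP; rewrite open_hausdorff => /(_ (f x) (f y)).
have : f x != f y by apply/eqP.
move=> /[swap] /[apply] -[[V W]] /= [Vx Wy] [oV oW VW].
move: Vx; rewrite inE => Vx; move: Wy; rewrite inE => Wy.
have /nbhs_ballP[r /= r0 rV] : nbhs (f x) V by exact: open_nbhs_nbhs.
(* A dense point [a] within [t / 2] of [f x] will be used with the ball of radius [t] around it; if
   [f y] were in that ball, its distance to [f x] would be below [t / 2 + t < r]. *)
have [n nr] : exists n : nat, (n.+1%:R^-1 : R) < r / 2.
  have r2 : 0 < r / 2 by rewrite divr_gt0.
  exists (Num.truncn (r / 2)^-1); rewrite -[ltRHS]invrK ltf_pV2 ?posrE ?invr_gt0//.
  by rewrite real_truncnS_gt// num_real.
set t := (n.+1%:R^-1 : R) in nr.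
have t0 : 0 < t by rewrite invr_gt0.
have [a [/interior_subset xa Aa]] : (interior (ball (f x) (t / 2)) `&` A) !=set0.
  apply: dA; last exact: open_interior.
  exists (f x); rewrite /interior; apply: nbhsx_ballx.
  by rewrite divr_gt0.
exists (h' (e a, n)); rewrite hK /=; split.
  exists a => //=; rewrite /interior /=.
  apply/nbhs_ballP; exists (t / 2); first by rewrite /= divr_gt0.
  move=> z xz; rewrite -/t [t]splitr; apply: ball_triangle xz.
  exact: ball_sym.
move=> [b [Ab /= be] /interior_subset yb].
have ab : b = a by apply: einj; rewrite ?inE.
have : (V `&` W) (f y).
  split=> //; apply: rV; rewrite -ab in xa.
  apply: (@le_ball _ _ _ (t / 2 + t)); first lra.
  exact: ball_triangle xa yb.
by move/eqP: VW => ->.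
Qed.

(** By separation the complement is a countable union of rectangles. Measurability of every set
    defined by an equation between arrows or objects rests on this. *)
Lemma measurable_diagonal : measurable [set p : T * T | p.1 = p.2].
Proof.
have [U [mU sU]] := standard_borel_separating.
rewrite (_ : [set p | _] = ~` \bigcup_n (U n `*` ~` U n)).
  apply: measurableC; apply: bigcupT_measurable => n.
  by apply: measurableX => //; exact: measurableC.
apply/seteqP; split=> [[x y] /= -> [n _ [/=]]//|[x y] /= h].
by apply: contrapT => /sU[n [Ux Uy]]; apply: h; exists n.
Qed.

Lemma measurable_fun_eq_set d' (X : measurableType d') (D : set X)
    (f g : X -> T) : measurable D -> measurable_fun D f -> measurable_fun D g ->
  measurable (D `&` [set x | f x = g x]).
Proof.
move=> mD mf mg.
have m : measurable_fun D (fun x => (f x, g x)) by exact: measurable_fun_pair_in.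
exact: (m mD _ measurable_diagonal).
Qed.

End StandardBorel.

Section Counting.
Context {R : realType} {T : choiceType}.

Lemma counting_esum (X : set T) :
  counting X = (\esum_(a in X) 1 : \bar R)%E.
Proof.
rewrite /counting; case: asboolP => [fX|iX].
  rewrite esum_fset// fsbig_finite//= (eq_bigr (fun=> 1%:E))//.
  by rewrite sumEFin big_const_seq count_predT iter_addr_0.
apply/esym/eqyP => r r0; have [B BX Br] := infinite_set_fset (Num.truncn r).+1 iX.
apply: esum_ge; exists [set` B]; first by split; [exact: finite_fset|].
rewrite fsbig_finite; last exact: finite_fset.
rewrite set_fsetK (eq_bigr (fun=> 1%:E))// sumEFin lee_fin.
rewrite big_const_seq count_predT iter_addr_0.
apply: (@le_trans _ _ ((Num.truncn r).+1%:R)).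
  by rewrite ltW// real_truncnS_gt// num_real.
by rewrite ler_nat.
Qed.

End Counting.

(** * Algebra of arrows, right translation by edges, integration over arrows *)

Section GroupoidTheory.
Context (R : realType) d0 d (G0 : measurableType d0) (G : measurableType d)
  (H : groupoid R G0 G).
Local Notation C := R[i].
Local Notation s := (gs H).
Local Notation r := (gr H).
Local Notation mu := (mu0 H).
Local Notation comp := (gcomp H).
Local Notation inv := (ginv H).

Lemma gcompK a b : r a = s b -> comp (comp a b) (inv b) = a.
Proof.
by move=> ab; rewrite -gcompA ?gs_inv// gcompgV -ab gcompg1.
Qed.

Lemma gcompKV a b : r a = r b -> comp (comp a (inv b)) b = a.
Proof.
move=> ab; rewrite -gcompA ?gs_inv ?gr_inv ?ab//.
by rewrite gcompVg -ab gcompg1.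
Qed.

Lemma ginvK : involutive inv.
Proof.
move=> a; rewrite -[LHS](@gcompg1 _ _ _ _ _ H) gr_inv gs_inv -(gcompVg H a).
rewrite gcompA ?gr_inv ?gs_inv//.
by rewrite -[X in comp X a]/(comp (inv (inv a)) (inv a)) gcompVg gr_inv gcomp1g.
Qed.

Lemma gcompVK a b : s a = s b -> comp a (comp (inv a) b) = b.
Proof.
by move=> ab; rewrite gcompA ?gs_inv ?gr_inv// gcompgV ab gcomp1g.
Qed.

Lemma gcompKl a b : r a = s b -> comp (inv a) (comp a b) = b.
Proof.
by move=> ab; rewrite gcompA ?gr_inv ?gs_inv// gcompVg ab gcomp1g.
Qed.

Lemma gcompIl a b c : r a = s b -> r a = s c -> comp a b = comp a c -> b = c.
Proof. by move=> ab ac e; rewrite -(gcompKl ab) e gcompKl. Qed.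

Implicit Types phi : edge H.

(** Right translations by an edge and by its inverse. They preserve sources, and [edge_act] is
    composition with [rtransV], which is why ring elements act within each fibre. *)
Definition rtrans phi a := comp a (phi (r a)).
Definition rtransV phi a := comp a (edge_inv phi (r a)).

Lemma edge_invE phi x : edge_dom phi x -> edge_inv phi (r (phi x)) = inv (phi x).
Proof.
move=> px; congr (inv (phi _)); apply: xget_unique => // y [py ryx].
by apply: (@gr_edge_inj _ _ _ _ _ _ phi) => //; rewrite inE.
Qed.

Lemma edge_inv_domP phi y : edge_inv_dom phi y <->
  exists2 x, edge_dom phi x & y = r (phi x).
Proof.
split=> [[_ [x px <-] <-]|[x px ->]]; first by exists x.
by exists (phi x) => //; exists x.
Qed.

Lemma rtrans_dom phi a : edge_dom phi (r a) -> edge_inv_dom phi (r (rtrans phi a)).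
Proof.
move=> pa; apply/edge_inv_domP; exists (r a) => //.
by rewrite gr_comp ?gs_edge.
Qed.

Lemma rtransV_dom phi a : edge_inv_dom phi (r a) -> edge_dom phi (r (rtransV phi a)).
Proof.
move=> /edge_inv_domP[x px xa]; rewrite /rtransV xa edge_invE//.
by rewrite gr_comp ?gs_inv ?gr_inv ?gs_edge.
Qed.

Lemma rtransK phi a : edge_dom phi (r a) -> rtransV phi (rtrans phi a) = a.
Proof.
move=> pa; rewrite /rtransV {2}/rtrans gr_comp ?gs_edge// edge_invE//.
by rewrite gcompK ?gs_edge.
Qed.

Lemma rtransVK phi a : edge_inv_dom phi (r a) -> rtrans phi (rtransV phi a) = a.
Proof.
move=> /edge_inv_domP[x px xa]; rewrite /rtrans /rtransV xa edge_invE//.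
rewrite gr_comp ?gs_inv// gr_inv gs_edge//.
by rewrite gcompKV.
Qed.

Lemma gs_rtrans phi a : edge_dom phi (r a) -> s (rtrans phi a) = s a.
Proof. by move=> pa; rewrite gs_comp ?gs_edge. Qed.

Lemma gs_rtransV phi a : edge_inv_dom phi (r a) -> s (rtransV phi a) = s a.
Proof.
by move=> /edge_inv_domP[x px xa]; rewrite gs_comp// xa edge_invE ?gs_inv.
Qed.

Lemma rtrans_bij phi x : set_bij (sfib H x `&` [set a | edge_dom phi (r a)])
  (sfib H x `&` [set a | edge_inv_dom phi (r a)]) (rtrans phi).
Proof.
split.
- move=> a [/= ax pa]; split; last exact: rtrans_dom.
  by rewrite /sfib /= gs_rtrans.
- move=> a b; rewrite !inE => -[_ pa] [_ pb] /(congr1 (rtransV phi)).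
  by rewrite !rtransK.
- move=> b [/= bx pb]; exists (rtransV phi b); last exact: rtransVK.
  by split; [rewrite /sfib /= gs_rtransV|exact: rtransV_dom].
Qed.

Lemma edge_imE phi : edge_im phi = s @^-1` edge_dom phi `&` [set a | phi (s a) = a].
Proof.
apply/seteqP; split=> [_ [x px <-]|a [/= pa <-]]; last by exists (s a).
by rewrite /= gs_edge.
Qed.

Lemma measurable_edge_dom_s phi : measurable (s @^-1` edge_dom phi).
Proof.
rewrite -[X in measurable X]setTI.
exact: (measurable_gs H measurableT (measurable_edge_dom phi)).
Qed.

Lemma measurable_preimage d1 d2 (X : measurableType d1) (Y : measurableType d2)
  (D : set X) (V : set Y) (f : X -> Y) : measurable D -> measurable V ->
  measurable_fun D f -> measurable (D `&` [set x | V (f x)]).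
Proof. by move=> mD mV /(_ mD _ mV). Qed.

Lemma measurable_fun_edge d1 (X : measurableType d1) phi (D : set X) (f : X -> G0) :
  measurable D -> measurable_fun D f -> (forall x, D x -> edge_dom phi (f x)) ->
  measurable_fun D (fun x => phi (f x)).
Proof.
move=> mD mf Df.
apply: (measurable_comp (F := edge_dom phi) (f := phi)) mf.
- exact: measurable_edge_dom.
- by move=> _ [x Dx <-]; exact: Df.
- exact: measurable_edge_fun.
Qed.

Lemma measurable_edge_im phi : measurable (edge_im phi).
Proof.
rewrite edge_imE; apply: (measurable_fun_eq_set (standard_borelG H)) => //.
- exact: measurable_edge_dom_s.
- apply: measurable_fun_edge => //; first exact: measurable_edge_dom_s.
  exact: measurable_funS (measurable_gs H).
Qed.

Lemma measurable_fun_comp d1 (X : measurableType d1) (D : set X) (f g : X -> G) :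
  measurable D -> measurable_fun D f -> measurable_fun D g ->
  (forall x, D x -> r (f x) = s (g x)) ->
  measurable_fun D (fun x => comp (f x) (g x)).
Proof.
move=> mD mf mg fg.
(* The set of composable pairs is the preimage of the diagonal of [G0]. *)
have mK : measurable [set p : G * G | r p.1 = s p.2].
  rewrite -[X in measurable X]setTI.
  apply: (measurable_fun_eq_set (standard_borelG0 H)) => //.
    exact: measurableT_comp (measurable_gr H) measurable_fst.
  exact: measurableT_comp (measurable_gs H) measurable_snd.
apply: (measurable_comp mK (f := fun p => comp p.1 p.2))
  (measurable_fun_pair_in mD mf mg).
- by move=> _ [x Dx <-] /=; exact: fg.
- exact: measurable_gcomp.
Qed.

Context (E : edge_cover H).

Lemma sfib_bij x :
  set_bij [set n | edge_dom (E n) x] (sfib H x) (fun n => E n x).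
Proof.
split.
- by move=> n /= nx; exact: gs_edge.
- move=> m n; rewrite !inE /= => mx nx mn.
  apply: (@ecover_disjoint _ _ _ _ _ _ E m n) => //; exists (E m x).
  by split; [exists x|exists x; rewrite // mn].
- move=> a /= ax; have : [set: G] a by [].
  rewrite -(ecover_cover E) => -[n _ [y yn ya]].
  have yx : y = x by rewrite -ax -ya gs_edge.
  by exists n; rewrite /= -yx.
Qed.

Lemma measurable_fun_cover d1 (Y : measurableType d1) (f : G -> Y) :
  (forall n, measurable_fun (edge_im (E n)) f) -> measurable_fun setT f.
Proof.
move=> h; rewrite -(ecover_cover E); apply/measurable_fun_bigcup => //.
by move=> n; exact: measurable_edge_im.
Qed.

Let inv_piece phi n := [set y | edge_dom (E n) y /\ edge_im phi (inv (E n y))].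

Let inv_pieceE phi n y : inv_piece phi n y ->
  edge_inv_dom phi y /\ edge_inv phi y = E n y.
Proof.
move=> [ny [x px xE]].
have yE : y = r (phi x) by rewrite xE gr_inv gs_edge.
split; first by apply/edge_inv_domP; exists x.
have -> : edge_inv phi y = inv (phi x) by rewrite {1}yE edge_invE.
by rewrite xE ginvK.
Qed.

Let measurable_inv_piece phi n : measurable (inv_piece phi n).
Proof.
apply: (measurable_preimage (f := fun y => inv (E n y))
  (measurable_edge_dom (E n)) (measurable_edge_im phi) _).
exact: measurableT_comp (measurable_ginv H) (@measurable_edge_fun _ _ _ _ _ _ (E n)).
Qed.

Let edge_inv_dom_bigcup phi : edge_inv_dom phi = \bigcup_n inv_piece phi n.
Proof.
apply/seteqP; split=> [y /edge_inv_domP[x px ->]|y [n _ /inv_pieceE[]//]].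
have : [set: G] (inv (phi x)) by [].
rewrite -(ecover_cover E) => -[n _ [z nz zE]]; exists n => //.
have -> : r (phi x) = z by rewrite -(gs_edge nz) zE gs_inv.
by split=> //; exists x => //; rewrite zE ginvK.
Qed.

(** The cover replaces the Lusin-Souslin theorem: [y] is in the range of [phi]
    iff one of the countably many [E n y] is inverse to an element of [phi]. *)
Lemma measurable_edge_inv_dom phi : measurable (edge_inv_dom phi).
Proof. by rewrite edge_inv_dom_bigcup; apply: bigcupT_measurable. Qed.

Lemma measurable_edge_inv phi : measurable_fun (edge_inv_dom phi) (edge_inv phi).
Proof.
rewrite edge_inv_dom_bigcup; apply/measurable_fun_bigcup => // n.
apply: (eq_measurable_fun (E n)).
  by move=> y; rewrite inE => /inv_pieceE[].
by apply: measurable_funS (@measurable_edge_fun _ _ _ _ _ _ (E n)) => [|y []//];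
  exact: measurable_edge_dom.
Qed.

Lemma measurable_inv_dom_r phi : measurable (r @^-1` edge_inv_dom phi).
Proof.
rewrite -[X in measurable X]setTI.
exact: (measurable_gr H measurableT (measurable_edge_inv_dom phi)).
Qed.

Lemma measurable_edge_dom_r phi : measurable (r @^-1` edge_dom phi).
Proof.
rewrite -[X in measurable X]setTI.
exact: (measurable_gr H measurableT (measurable_edge_dom phi)).
Qed.

Lemma measurable_rtransV phi : measurable_fun (r @^-1` edge_inv_dom phi) (rtransV phi).
Proof.
have mD := measurable_inv_dom_r phi.
apply: measurable_fun_comp => //.
- apply: (measurable_comp (F := edge_inv_dom phi) (f := edge_inv phi)).
  + exact: measurable_edge_inv_dom.
  + by move=> _ [x Dx <-].
  + exact: measurable_edge_inv.
  + exact: measurable_funS (measurable_gr H).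
- move=> a /edge_inv_domP[x px ->]; by rewrite edge_invE// gs_inv.
Qed.

Lemma measurable_rtrans phi : measurable_fun (r @^-1` edge_dom phi) (rtrans phi).
Proof.
have mD := measurable_edge_dom_r phi.
apply: measurable_fun_comp => //.
- apply: measurable_fun_edge => //.
  exact: measurable_funS (measurable_gr H).
- by move=> a pa; rewrite gs_edge.
Qed.

Local Open Scope ereal_scope.

Lemma esum_sfib (f : G -> \bar R) x : (forall a, 0 <= f a) ->
  \esum_(a in sfib H x) f a =
  \sum_(0 <= n <oo) (if x \in edge_dom (E n) then f (E n x) else 0).
Proof.
move=> f0; rewrite nneseries_esumT; last by move=> n; case: ifP.
rewrite (reindex_esum _ _ _ _ (sfib_bij x)) esum_mkcond.
apply: eq_esum => n _.
by rewrite (_ : (n \in _) = (x \in edge_dom (E n)))//; apply/idP/idP;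
  rewrite !inE.
Qed.

Lemma measurable_section (f : G -> \bar R) n : measurable_fun setT f ->
  measurable_fun setT (fun x => if x \in edge_dom (E n) then f (E n x) else 0).
Proof.
move=> mf; apply: (measurable_fun_patch (f := fun x => f (E n x))).
  exact: measurable_edge_dom.
exact: measurableT_comp mf (@measurable_edge_fun _ _ _ _ _ _ (E n)).
Qed.

Lemma measurable_esum_sfib (f : G -> \bar R) : (forall a, 0 <= f a) ->
  measurable_fun setT f ->
  measurable_fun setT (fun x => \esum_(a in sfib H x) f a).
Proof.
move=> f0 mf; under eq_fun do rewrite esum_sfib//.
apply: ge0_emeasurable_sum => [n x _ _|n _]; first by case: ifP.
exact: measurable_section.
Qed.

(** A fibre of the source map meets the image of an edge in at most one arrow, so the counting
    function is an indicator. *)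
Lemma mu1_edge_im n (U : set G) : measurable U -> U `<=` edge_im (E n) ->
  mu1 H U = mu (edge_dom (E n) `&` [set x | U (E n x)]).
Proof.
move=> mU Un; rewrite mu1_gs//.
have mD : measurable (edge_dom (E n) `&` [set x | U (E n x)]).
  exact: measurable_preimage (measurable_edge_dom _) mU (@measurable_edge_fun _ _ _ _ _ _ (E n)).
transitivity (\int[mu]_x (\1_(edge_dom (E n) `&` [set x | U (E n x)]) x)%:E).
  apply: eq_integral => x _; rewrite indicE counting_esum.
  have [h|h] := pselect ((edge_dom (E n) `&` [set x | U (E n x)]) x).
    rewrite (mem_set h) (_ : _ `&` _ = [set E n x]) ?esum_set1//.
    apply/seteqP; split=> [a [/= ax Ua]|_ ->]; last first.
      by case: h => nx Ux; split=> //=; exact: gs_edge.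
    by have [y ny yE] := Un a Ua; rewrite -yE -ax -yE gs_edge.
  rewrite (memNset h) (_ : _ `&` _ = set0) ?esum_set0//.
  apply/seteqP; split=> // a [/= ax Ua]; apply: h.
  have [y ny yE] := Un a Ua; rewrite -ax -yE gs_edge//.
  by split=> //=; rewrite yE.
by rewrite integral_indic// setIT.
Qed.

(** A total measurable map is needed for the pushforward of [mu]. Outside the domain the value is
    chosen outside the image, so that preimages of subsets of the image stay in the domain. If the
    image is everything, it contains the identity arrows and the domain is everything too. *)
Let ext n x := if x \in edge_dom (E n) then E n x else xget point (~` edge_im (E n)).

Let measurable_ext n : measurable_fun setT (ext n).
Proof.
exact: measurable_fun_patch (measurable_edge_dom (E n)) (@measurable_edge_fun _ _ _ _ _ _ (E n)).
Qed.

Let ext_dom n x : edge_im (E n) (ext n x) -> edge_dom (E n) x.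
Proof.
rewrite /ext; case: ifPn => [|nx]; first by rewrite inE.
have [[a na]|h] := pselect (exists a, ~ edge_im (E n) a).
  by move=> /(@xgetI _ point (~` edge_im (E n)) a na).
move=> _; suff : edge_im (E n) (gid H x).
  by move=> [y ny /(congr1 s)]; rewrite gs_edge// gs_id => yx; rewrite -yx.
by apply: contrapT => h'; apply: h; exists (gid H x).
Qed.

Lemma ge0_integral_edge_im n (f : G -> \bar R) : (forall a, 0 <= f a) ->
  measurable_fun setT f ->
  \int[mu1 H]_(a in edge_im (E n)) f a = \int[mu]_(x in edge_dom (E n)) f (E n x).
Proof.
move=> f0 mf.
have extV (U : set G) : U `<=` edge_im (E n) ->
    ext n @^-1` U = edge_dom (E n) `&` [set x | U (E n x)].
  move=> Un; apply/seteqP; split=> [x /= Ux|x [nx Ux]]; last first.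
    by rewrite /= /ext mem_set.
  have nx := ext_dom (Un _ Ux); split=> //=.
  by move: Ux; rewrite /ext mem_set.
rewrite (eq_measure_integral (pushforward mu (ext n))); last first.
  move=> U mU Un; rewrite -[RHS]/(mu (ext n @^-1` U)) extV//.
  exact: mu1_edge_im.
rewrite ge0_integral_pushforward//; last 2 first.
- exact: measurable_edge_im.
- exact: measurable_funTS.
rewrite extV// (_ : _ `&` _ = edge_dom (E n)); last first.
  by apply/seteqP; split=> [x []//|x nx]; split=> //=; exists x.
by apply: eq_integral => x nx; rewrite /= /ext nx.
Qed.

(** The images of the edges partition the arrows; on each of them the integral is one over the
    domain of the edge, and sum and integral are exchanged. *)
Lemma ge0_integral_gs (f : G -> \bar R) : (forall a, 0 <= f a) ->
  measurable_fun setT f ->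
  \int[mu1 H]_a f a = \int[mu]_x \esum_(a in sfib H x) f a.
Proof.
move=> f0 mf.
have mE n : measurable (edge_im (E n)) by exact: measurable_edge_im.
have mEf : measurable_fun (\bigcup_n edge_im (E n)) f by rewrite ecover_cover.
rewrite -(ecover_cover E).
rewrite (ge0_integral_bigcup (mu1 H) mE mEf _ (@ecover_disjoint _ _ _ _ _ _ E))//.
under [RHS]eq_integral do rewrite esum_sfib//.
rewrite integral_nneseries//; last 2 first.
- by move=> n; exact: measurable_section.
- by move=> n x _; case: ifP.
apply: eq_eseriesr => n _; rewrite ge0_integral_edge_im// [LHS]integral_mkcond.
by apply: eq_integral => x _; rewrite /patch.
Qed.

Lemma ginv_bij x : set_bij (sfib H x) (r @^-1` [set x]) inv.
Proof.
split.
- by move=> a /= ax; rewrite gr_inv.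
- by move=> a b _ _ /(congr1 inv); rewrite !ginvK.
- by move=> a /= ax; exists (inv a); rewrite ?ginvK//= /sfib /= gs_inv.
Qed.

(** Inversion exchanges the fibres of source and range, and it preserves [mu1] because both counting
    formulas define the same measure. *)
Lemma ge0_integral_gr (f : G -> \bar R) : (forall a, 0 <= f a) ->
  measurable_fun setT f ->
  \int[mu1 H]_a f a = \int[mu]_x \esum_(a in r @^-1` [set x]) f a.
Proof.
move=> f0 mf.
rewrite (eq_measure_integral (pushforward (mu1 H) inv));
  [exact: (measurable_ginv H)|move=> mi|move=> mi]; last first.
  move=> U mU _; rewrite -[RHS]/(mu1 H (inv @^-1` U)) mu1_gr// mu1_gs; last first.
    by rewrite -[X in measurable X]setTI; exact: (measurable_ginv H).
  apply: eq_integral => x _; rewrite !counting_esum.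
  rewrite (@reindex_esum _ _ _ (s @^-1` [set x] `&` inv @^-1` U) _ inv)//.
  have [h1 h2 h3] := ginv_bij x; split.
  + by move=> a [ax Ua]; split => //; exact: h1.
  + by move=> a b _ _ /(congr1 inv); rewrite !ginvK.
  + move=> a [ax Ua]; have [b bx ba] := h3 a ax; exists b => //.
    by split=> //=; rewrite ba.
rewrite ge0_integral_pushforward//.
rewrite preimage_setT ge0_integral_gs//; last 2 first.
- by move=> a; exact: f0.
- exact: measurableT_comp mf (measurable_ginv H).
by apply: eq_integral => x _; rewrite (reindex_esum _ _ _ _ (ginv_bij x)).
Qed.

End GroupoidTheory.

(** * Integration along the fibres *)

Section RIntegrable.
Context {R : realType} {d} {T : measurableType d} (mu : {measure set T -> \bar R}).

Lemma rintegrableP (D : set T) (f : T -> R) : measurable D ->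
  mu.-integrable D (EFin \o f) <->
  measurable_fun D f /\ (\int[mu]_(x in D) (`|f x|)%:E < +oo)%E.
Proof.
move=> mD; split=> [/integrableP[/measurable_EFinP//]|[/measurable_EFinP mf fi]].
by apply/integrableP.
Qed.

Lemma ge0_rintegrable_fine (h : T -> \bar R) : measurable_fun setT h ->
  (forall x, 0 <= h x)%E -> (\int[mu]_x h x < +oo)%E ->
  mu.-integrable setT (EFin \o (fine \o h)) /\
  Rintegral mu setT (fine \o h) = fine (\int[mu]_x h x).
Proof.
move=> mh h0 hoo.
have ih : mu.-integrable setT h.
  apply/integrableP; split=> //.
  by under eq_integral do rewrite gee0_abs//.
have mfh : measurable_fun setT (EFin \o (fine \o h)).
  by apply/measurable_EFinP; exact: measurableT_comp.
have ae_h : {ae mu, forall x, setT x -> (EFin \o (fine \o h)) x = h x}.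
  have := integrable_ae measurableT ih; apply: filterS => x hx xT /=.
  by rewrite fineK// hx.
split.
  apply: le_integrable ih => // x _ /=.
  by case: (h x) => //=; rewrite leey.
by rewrite /Rintegral; congr fine; exact: ae_eq_integral.
Qed.

End RIntegrable.

(** * Disintegration over a family of fibres, for both source and range *)

Section FibreIntegration.
Context {R : realType} {d d0} {G : measurableType d} {G0 : measurableType d0}
  (mu : {measure set G0 -> \bar R}) (nu : {measure set G -> \bar R})
  (fib : G0 -> set G).
Hypothesis fib_meas : forall f : G -> \bar R, (forall a, 0 <= f a)%E ->
  measurable_fun setT f ->
  measurable_fun setT (fun x => \esum_(a in fib x) f a)%E.
Hypothesis fib_int : forall f : G -> \bar R, (forall a, 0 <= f a)%E ->
  measurable_fun setT f ->
  (\int[nu]_a f a = \int[mu]_x \esum_(a in fib x) f a)%E.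

(** The number of points of a null set in the fibre over [x] has integral 0, so almost every fibre
    misses the set. *)
Lemma ae_fib (P : G -> Prop) : {ae nu, forall a, P a} ->
  {ae mu, forall x, forall a, fib x a -> P a}.
Proof.
move=> [N [mN N0 PN]].
pose f a : \bar R := (\1_N a)%:E.
have f0 a : (0 <= f a)%E by rewrite lee_fin.
have mf : measurable_fun setT f by exact/measurable_EFinP/measurable_indic.
have : (\int[mu]_x `| \esum_(a in fib x) f a | = 0)%E.
  rewrite -[RHS]N0 -[N in RHS]setIT -integral_indic// [RHS]fib_int//.
  by apply: eq_integral => x _; rewrite gee0_abs//; exact: esum_ge0.
move=> /(ae_eq_integral_abs mu measurableT (fib_meas f0 mf)).
apply: filterS => x /(_ Logic.I) /= fx a xa; apply: contrapT => Pa.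
have Na : N a by apply: PN.
have : (1 <= \esum_(a in fib x) f a)%E.
  apply: esum_ge; exists [set a]; last by rewrite fsbig_set1 /f indicE mem_set.
  by split; [exact: finite_set1|move=> _ ->].
by rewrite fx lee_fin; rewrite ler10.
Qed.

(** The union of the fibres over a null set is null, by the integration formula for its
    indicator. *)
Lemma ae_fib_inv (P : G -> Prop) : (forall N, measurable N -> mu N = 0%E ->
    measurable (\bigcup_(x in N) fib x)) -> (forall a, exists x, fib x a) ->
  (forall x y a, fib x a -> fib y a -> x = y) ->
  {ae mu, forall x, forall a, fib x a -> P a} -> {ae nu, forall a, P a}.
Proof.
move=> mfib cov dis [N [mN N0 PN]]; exists (\bigcup_(x in N) fib x).
have mM := mfib N mN N0; split=> //; last first.
  move=> a /= Pa; have [x xa] := cov a; exists x => //; apply: PN => /= h.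
  exact/Pa/h.
rewrite -[X in nu X]setIT -integral_indic// fib_int//; last first.
  by apply/measurable_EFinP/measurable_indic.
rewrite -(integral0 mu setT); apply: ge0_ae_eq_integral => //.
- by apply: fib_meas => //; exact/measurable_EFinP/measurable_indic.
- by move=> x _; apply: esum_ge0 => a _; rewrite lee_fin.
exists N; split=> // x /= nx; apply: contrapT => Nx; apply: nx => _.
apply: esum1 => a xa; rewrite indicE memNset// => -[y Ny ya]; apply: Nx.
by rewrite (dis _ _ _ xa ya).
Qed.

Lemma rsum_integral (f : G -> R) : nu.-integrable setT (EFin \o f) ->
  mu.-integrable setT (EFin \o (fun x => rsum (fib x) f)) /\
  Rintegral nu setT f = Rintegral mu setT (fun x => rsum (fib x) f).
Proof.
move=> /(rintegrableP _ _ measurableT)[mf fi].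
(* For [e] equal to [1] and [-1] these are the positive and negative parts. Their fibre sums are
   finite almost everywhere, so taking [fine] does not change the integrals. *)
pose part (e : R) a := Num.max (e * f a) 0.
have part0 e a : 0 <= part e a by rewrite le_max lexx orbT.
have mpart e : measurable_fun setT (part e).
  by apply: measurable_maxr => //; exact: measurable_funM.
pose h e x := (\esum_(a in fib x) (part e a)%:E)%E.
have h0 e x : (0 <= h e x)%E by apply: esum_ge0 => a _; rewrite lee_fin.
have mh e : measurable_fun setT (h e).
  apply: fib_meas => [a|]; first by rewrite lee_fin.
  exact/measurable_EFinP.
have ie e : `|e| = 1 -> (\int[nu]_a (part e a)%:E < +oo)%E.
  move=> e1; apply: le_lt_trans fi; apply: ge0_le_integral => //.
  - by move=> a _; rewrite lee_fin.
  - exact/measurable_EFinP.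
  - by apply/measurable_EFinP; exact: measurableT_comp.
  - move=> a _; rewrite lee_fin -[leRHS]mul1r -e1 -normrM /part.
    by case: (lerP (e * f a) 0) => // _; exact: ler_norm.
have hint e : (\int[mu]_x h e x = \int[nu]_a (part e a)%:E)%E.
  rewrite [RHS]fib_int// => [a|]; first by rewrite lee_fin.
  exact/measurable_EFinP.
have hoo e : `|e| = 1 -> (\int[mu]_x h e x < +oo)%E.
  by move=> e1; rewrite hint ie.
have n1 : `|1 : R| = 1 by rewrite normr1.
have nN1 : `|-1 : R| = 1 by rewrite normrN1.
have [i1 r1] := ge0_rintegrable_fine (mh 1) (h0 1) (hoo _ n1).
have [i2 r2] := ge0_rintegrable_fine (mh (-1)) (h0 (-1)) (hoo _ nN1).
have e : (fun x => rsum (fib x) f) = (fun x => fine (h 1 x) - fine (h (-1) x)).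
  apply/funext => x; rewrite /rsum /h /part; congr (fine _ - fine _).
    by under [RHS]eq_esum do rewrite mul1r.
  by under [RHS]eq_esum do rewrite mulN1r.
rewrite e; split.
  by have := integrableB measurableT i1 i2; apply: eq_integrable => // x _ /=;
    rewrite EFinB.
rewrite RintegralB// r1 r2 !hint.
have ip e' : `|e'| = 1 -> nu.-integrable setT (EFin \o part e').
  move=> e1; apply/(rintegrableP _ _ measurableT); split=> //.
  by under eq_integral do rewrite ger0_norm//; exact: ie.
rewrite -!/(Rintegral _ _ _) -RintegralB//; try exact: ip.
congr fine; apply: eq_integral => a _; congr EFin; rewrite /part mul1r mulN1r.
by case: (lerP (f a) 0); case: (lerP (- f a) 0); lra.
Qed.

End FibreIntegration.

(** * Representatives of classes and complex integrals *)

Section AeQuotientTheory.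
Context d (X : measurableType d) (R : realType) (mu : {measure set X -> \bar R})
  (D : set X) (W : lmodType R[i]) (S : submodClosed (X -> W)).
Local Open Scope quotient_scope.
Local Notation Q := (aeq mu D S).
Local Notation N := (@ae_null d X R mu D W S).

Lemma aeq_reprP (F : Q) : (F : X -> W) \in S.
Proof. by rewrite /aeq_repr; case: (repr _). Qed.

Lemma aeq_linE (a : R[i]) (F K : Q) :
  {ae mu, forall x, D x -> (a *: F + K : Q) x = a *: F x + K x}.
Proof.
pose f : field S := repr (F : Quotient.quot N).
pose k : field S := repr (K : Quotient.quot N).
have e : a *: F + K = \pi_(Quotient.quot N) (a *: f + k).
  by rewrite [RHS]raddfD /= reprK.
rewrite e.
have /asboolP : repr (\pi_(Quotient.quot N) (a *: f + k)) -
    (a *: f + k) \in N by rewrite Quotient.idealrBE reprK.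
apply: filterS => x h Dx; apply/eqP; rewrite -subr_eq0; apply/eqP.
exact: h.
Qed.

(** The representative of the zero class is an arbitrary choice; writing the class as [-1 *: 0 + 0]
    makes it cancel against itself. *)
Lemma aeq_0E : {ae mu, forall x, D x -> (0 : Q) x = 0}.
Proof.
have := aeq_linE 0 (0 : Q) (0 : Q); rewrite scale0r addr0.
have := aeq_linE (-1) (0 : Q) (0 : Q); rewrite scaler0 addr0.
by apply: filterS2 => x h _ Dx; rewrite h// scaleN1r addrC subrr.
Qed.

End AeQuotientTheory.

Section CIntegral.
Context {R : realType} {d} {T : measurableType d} (mu : {measure set T -> \bar R})
  (D : set T) (mD : measurable D).
Local Notation C := R[i].
Implicit Types f g : T -> C.

Lemma cintegrable_cmeasurable f : cintegrable mu D f -> cmeasurable D f.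
Proof. by move=> [/(rintegrableP _ _ mD)[m _] /(rintegrableP _ _ mD)[m' _]]. Qed.

Lemma cintegrable_lin (k : C) f g : cintegrable mu D f -> cintegrable mu D g ->
  cintegrable mu D (fun x => k * f x + g x).
Proof.
move=> [f1 f2] [g1 g2]; split.
- have h1 := integrableZl mD (complex.Re k) f1.
  have h2 := integrableZl mD (- complex.Im k) f2.
  have := integrableD mD (integrableD mD h1 h2) g1.
  apply: eq_integrable => // x _ /=.
  by rewrite -!EFinM -!EFinD Defs.ReD Defs.ReM mulNr.
- have h1 := integrableZl mD (complex.Re k) f2.
  have h2 := integrableZl mD (complex.Im k) f1.
  have := integrableD mD (integrableD mD h1 h2) g2.
  apply: eq_integrable => // x _ /=.
  by rewrite -!EFinM -!EFinD Defs.ImD Defs.ImM.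
Qed.

Lemma cintegral_lin (k : C) f g : cintegrable mu D f -> cintegrable mu D g ->
  cintegral mu D (fun x => k * f x + g x) = k * cintegral mu D f + cintegral mu D g.
Proof.
have rlin (a b : R) (u v w : T -> R) : mu.-integrable D (EFin \o u) ->
    mu.-integrable D (EFin \o v) -> mu.-integrable D (EFin \o w) ->
    Rintegral mu D (fun x => a * u x + b * v x + w x) =
    a * Rintegral mu D u + b * Rintegral mu D v + Rintegral mu D w.
  move=> iu iv iw.
  have iau : mu.-integrable D (EFin \o (fun x => a * u x)).
    exact: (integrableZl mD a iu).
  have ibv : mu.-integrable D (EFin \o (fun x => b * v x)).
    exact: (integrableZl mD b iv).
  rewrite !RintegralD// ?RintegralZl//.
  exact: (integrableD mD iau ibv).
move=> [f1 f2] [g1 g2]; apply: complex_eq.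
- rewrite Defs.ReD Defs.ReM /cintegral /=.
  rewrite -mulNr -rlin//; apply: eq_Rintegral => x _.
  by rewrite Defs.ReD Defs.ReM mulNr.
- rewrite Defs.ImD Defs.ImM /cintegral /=.
  rewrite -rlin//; apply: eq_Rintegral => x _.
  by rewrite Defs.ImD Defs.ImM.
Qed.

Lemma cintegral_conj f : cintegrable mu D f ->
  cintegral mu D (fun x => conjc (f x)) = conjc (cintegral mu D f).
Proof.
move=> [f1 f2]; apply: complex_eq; rewrite ?Re_conjc ?Im_conjc /cintegral /=.
  by apply: eq_Rintegral => x _; rewrite Re_conjc.
rewrite -mulN1r -RintegralZl//; apply: eq_Rintegral => x _.
by rewrite Im_conjc mulN1r.
Qed.

Lemma ae_eq_Rintegral (f g : T -> R) : measurable_fun D f -> measurable_fun D g ->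
  {ae mu, forall x, D x -> f x = g x} -> Rintegral mu D f = Rintegral mu D g.
Proof.
move=> mf mg fg; congr fine; apply: ae_eq_integral => //.
- exact/measurable_EFinP.
- exact/measurable_EFinP.
- by apply: filterS fg => x fg Dx /=; rewrite fg.
Qed.

Lemma ae_eq_cintegral f g : cmeasurable D f -> cmeasurable D g ->
  {ae mu, forall x, D x -> f x = g x} -> cintegral mu D f = cintegral mu D g.
Proof.
move=> [f1 f2] [g1 g2] fg; rewrite /cintegral; congr Complex;
  by apply: ae_eq_Rintegral => //; apply: filterS fg => x fg Dx; rewrite fg.
Qed.

Lemma eq_cintegral f g : (forall x, D x -> f x = g x) ->
  cintegral mu D f = cintegral mu D g.
Proof.
move=> fg; rewrite /cintegral; congr Complex;
  by apply: eq_Rintegral => x; rewrite inE => Dx; rewrite fg.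
Qed.

End CIntegral.

Section CMeasurable.
Context {R : realType} {d} {T : measurableType d} (D : set T).
Local Notation C := R[i].
Implicit Types f g : T -> C.

Lemma cmeasurableM f g : cmeasurable D f -> cmeasurable D g ->
  cmeasurable D (fun x => f x * g x).
Proof.
move=> [f1 f2] [g1 g2]; split.
  under eq_fun do rewrite Defs.ReM.
  by apply: measurable_funB; exact: measurable_funM.
under eq_fun do rewrite Defs.ImM.
by apply: measurable_funD; exact: measurable_funM.
Qed.

Lemma cmeasurableD f g : cmeasurable D f -> cmeasurable D g ->
  cmeasurable D (fun x => f x + g x).
Proof.
by move=> mf mg; have := cmeasurable_lin 1 mf mg; under eq_fun do rewrite mul1r.
Qed.

Lemma cmeasurable_conj f : cmeasurable D f -> cmeasurable D (fun x => conjc (f x)).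
Proof.
move=> [f1 f2]; split.
  by under eq_fun do rewrite Re_conjc.
by under eq_fun do rewrite Im_conjc; exact: measurable_funN.
Qed.

Lemma cmeasurable_cst (k : C) : cmeasurable D (fun=> k).
Proof. by split; exact: measurable_cst. Qed.

Lemma cmeasurable_sum I (s : seq I) (F : I -> T -> C) :
  (forall i, cmeasurable D (F i)) -> cmeasurable D (fun x => \sum_(i <- s) F i x).
Proof.
move=> mF; elim: s => [|i s IH].
  by under eq_fun do rewrite big_nil; exact: cmeasurable_cst.
by under eq_fun do rewrite big_cons; exact: cmeasurableD.
Qed.

Lemma eq_cmeasurable f g : (forall x, D x -> f x = g x) -> cmeasurable D f ->
  cmeasurable D g.
Proof.
move=> fg [f1 f2]; split.
  by apply: eq_measurable_fun f1 => x; rewrite inE => Dx; rewrite fg.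
by apply: eq_measurable_fun f2 => x; rewrite inE => Dx; rewrite fg.
Qed.

End CMeasurable.

Lemma cmeasurable_patch {R : realType} d (T : measurableType d) (A : set T)
    (f : T -> R[i]) : measurable A -> cmeasurable A f ->
  cmeasurable setT (fun x => if x \in A then f x else 0).
Proof.
move=> mA [f1 f2]; split.
  rewrite (_ : (fun _ => _) = fun x => if x \in A then complex.Re (f x) else 0).
    exact: measurable_fun_patch.
  by apply/funext => x; case: ifP.
rewrite (_ : (fun _ => _) = fun x => if x \in A then complex.Im (f x) else 0).
  exact: measurable_fun_patch.
by apply/funext => x; case: ifP.
Qed.

Lemma cmeasurable_comp {R : realType} d1 d2 (X : measurableType d1)
    (Y : measurableType d2) (D : set X) (f : Y -> R[i]) (g : X -> Y) :
  cmeasurable setT f -> measurable_fun D g -> cmeasurable D (fun x => f (g x)).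
Proof.
move=> [f1 f2] mg; split.
  exact: (measurableT_comp f1 mg).
exact: (measurableT_comp f2 mg).
Qed.

(** * The space [L2 H] seen fibre by fibre *)

Section L2Theory.
Context (R : realType) d0 d (G0 : measurableType d0) (G : measurableType d)
  (H : groupoid R G0 G) (E : edge_cover H).
Local Notation C := R[i].
Local Notation mu := (mu0 H).
Local Notation nu := (mu1 H).

Lemma measurable_esum_rfib (f : G -> \bar R) : (forall a, 0 <= f a)%E ->
  measurable_fun setT f ->
  measurable_fun setT (fun x => \esum_(a in gr H @^-1` [set x]) f a)%E.
Proof.
move=> f0 mf; under eq_fun do rewrite (reindex_esum _ _ _ _ (ginv_bij H _)).
apply: (measurable_esum_sfib E) => //.
exact: measurableT_comp mf (measurable_ginv H).
Qed.

(** All later identities between classes pass through this equivalence: edges move an arrow inside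
    its fibre, so an almost-everywhere statement on arrows can be used only once it holds on the
    whole fibre. *)
Lemma ae_sfib (P : G -> Prop) :
  {ae nu, forall a, P a} <-> {ae mu, forall x, forall a, sfib H x a -> P a}.
Proof.
split.
  apply: ae_fib; first exact: (measurable_esum_sfib E).
  exact: (ge0_integral_gs E).
apply: ae_fib_inv.
- exact: (measurable_esum_sfib E).
- exact: (ge0_integral_gs E).
- move=> N mN _; rewrite (_ : \bigcup_(x in N) _ = gs H @^-1` N).
    by rewrite -[X in measurable X]setTI; exact: (measurable_gs H).
  apply/seteqP; split=> [a [x Nx ax]|a Na]; last by exists (gs H a).
  by rewrite /= (_ : gs H a = x).
- by move=> a; exists (gs H a).
- by move=> x y a /= <- <-.
Qed.

(** Needed since [linf_act] evaluates an essentially bounded function at ranges, while its bound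
    holds almost everywhere on objects. *)
Lemma ae_gr (Q : G0 -> Prop) :
  {ae mu, forall x, Q x} -> {ae nu, forall a, Q (gr H a)}.
Proof.
move=> aQ; apply: (ae_fib_inv (mu := mu) (fib := fun x => gr H @^-1` [set x])).
- exact: measurable_esum_rfib.
- exact: (ge0_integral_gr E).
- move=> N mN _; rewrite (_ : \bigcup_(x in N) _ = gr H @^-1` N).
    by rewrite -[X in measurable X]setTI; exact: (measurable_gr H).
  apply/seteqP; split=> [a [x Nx ax]|a Na]; last by exists (gr H a).
  by rewrite /= (_ : gr H a = x).
- by move=> a; exists (gr H a).
- by move=> x y a /= <- <-.
- by apply: filterS aQ => x Qx a ->.
Qed.

Definition sqint (F : G -> C) :=
  cmeasurable setT F /\ (\int[nu]_a (normsq (F a))%:E < +oo)%E.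

Lemma integral_l2norm2 (F : G -> C) : cmeasurable setT F ->
  (\int[nu]_a (normsq (F a))%:E = \int[mu]_x l2norm2 (sfib H x) F)%E.
Proof.
move=> mF; rewrite (ge0_integral_gs E)// => [a|]; rewrite ?lee_fin ?normsq_ge0//.
exact/measurable_EFinP/measurable_normsq.
Qed.

Lemma measurable_l2norm2_sfib (F : G -> C) : cmeasurable setT F ->
  measurable_fun setT (fun x => l2norm2 (sfib H x) F).
Proof.
move=> mF; apply: (measurable_esum_sfib E) => [a|].
  by rewrite lee_fin normsq_ge0.
exact/measurable_EFinP/measurable_normsq.
Qed.

Lemma sqint_fin2 F : sqint F -> {ae mu, forall x, fin2 (sfib H x) F}.
Proof.
move=> [mF iF].
have iT : mu.-integrable setT (fun x => l2norm2 (sfib H x) F).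
  apply/integrableP; split; first exact: measurable_l2norm2_sfib.
  under eq_integral do rewrite gee0_abs ?l2norm2_ge0//.
  by rewrite -integral_l2norm2.
have := integrable_ae measurableT iT; apply: filterS => x /(_ Logic.I).
by rewrite ge0_fin_numE ?l2norm2_ge0.
Qed.

Lemma L2_predP (F : G -> C) : F \in L2_pred H <-> sqint F.
Proof. by split=> /asboolP. Qed.

Lemma L2P (F : L2 H) : sqint F.
Proof. by apply/L2_predP; exact: aeq_reprP. Qed.

Lemma L2_classE F : sqint F -> {ae nu, forall a, L2_class H F a = F a}.
Proof.
move=> /L2_predP /(aeq_classE nu setT); apply: filterS => a h.
exact: h.
Qed.

Lemma L2_eqP (F K : L2 H) : F = K <-> {ae nu, forall a, F a = K a}.
Proof.
split=> [->|h]; first exact: aeW.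
by apply/aeq_eq; apply: filterS h => a h _.
Qed.

Lemma L2_linE (k : C) (F K : L2 H) :
  {ae nu, forall a, (k *: F + K : L2 H) a = k * F a + K a}.
Proof. by have := aeq_linE k F K; apply: filterS => a h; exact: h. Qed.

Lemma L2_0E : {ae nu, forall a, (0 : L2 H) a = 0}.
Proof. by have := aeq_0E nu setT (L2_pred H); apply: filterS => a h; exact: h. Qed.

Lemma cintegrable_mulJ F K : sqint F -> sqint K ->
  cintegrable nu setT (fun a => F a * conjc (K a)).
Proof.
move=> [mF iF] [mK iK].
have m := cmeasurableM mF (cmeasurable_conj mK).
have key (f : G -> R) : measurable_fun setT f ->
    (forall a, `|f a| <= normsq (F a) + normsq (K a)) ->
    nu.-integrable setT (EFin \o f).
  move=> mf fle; apply/(rintegrableP _ _ measurableT); split=> //.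
  apply: (@le_lt_trans _ _ (\int[nu]_a ((normsq (F a))%:E + (normsq (K a))%:E))%E).
    apply: ge0_le_integral => //.
    - by apply/measurable_EFinP; exact: measurableT_comp.
    - by apply: emeasurable_funD; exact/measurable_EFinP/measurable_normsq.
    - by move=> a _; rewrite -EFinD lee_fin.
  rewrite ge0_integralD//; try by [move=> a _; rewrite lee_fin normsq_ge0
    |exact/measurable_EFinP/measurable_normsq].
  exact: lte_add_pinfty.
split; apply: key.
- by case: m.
- by move=> a; exact: Re_mulJ_le.
- by case: m.
- by move=> a; exact: Im_mulJ_le.
Qed.

Lemma csum_integral (f : G -> C) : cintegrable nu setT f ->
  cintegrable mu setT (fun x => csum (sfib H x) f) /\
  cintegral nu setT f = cintegral mu setT (fun x => csum (sfib H x) f).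
Proof.
move=> [f1 f2].
have [i1 e1] := rsum_integral (measurable_esum_sfib E) (ge0_integral_gs E) f1.
have [i2 e2] := rsum_integral (measurable_esum_sfib E) (ge0_integral_gs E) f2.
by split; [split|apply: complex_eq].
Qed.

Lemma L2_ipE (F K : L2 H) :
  L2_ip F K = cintegral mu setT (fun x => l2ip (sfib H x) F K).
Proof. by have [] := csum_integral (cintegrable_mulJ (L2P F) (L2P K)). Qed.

Lemma cintegrable_l2ip F K : sqint F -> sqint K ->
  cintegrable mu setT (fun x => l2ip (sfib H x) F K).
Proof. by move=> sF sK; have [] := csum_integral (cintegrable_mulJ sF sK). Qed.

Lemma L2_nrm2 (F : L2 H) :
  nrm2 (@L2_ip _ _ _ _ _ H) F = fine (\int[nu]_a (normsq (F a))%:E)%E.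
Proof.
congr fine; apply: eq_integral => a _; congr EFin; exact: Re_mulc_conj.
Qed.

Lemma L2_prehilbert : prehilbert [set: L2 H] (@L2_ip _ _ _ _ _ H).
Proof.
split=> //.
- move=> k u v w _ _ _; rewrite /L2_ip -cintegral_lin//; first last.
  + exact: cintegrable_mulJ (L2P v) (L2P w).
  + exact: cintegrable_mulJ (L2P u) (L2P w).
  apply: ae_eq_cintegral => //.
  + exact/cintegrable_cmeasurable/cintegrable_mulJ/(L2P w)/L2P.
  + apply: cintegrable_cmeasurable => //.
    by apply: cintegrable_lin => //; apply: cintegrable_mulJ; exact: L2P.
  have := L2_linE k u v; apply: filterS => a h _.
  by rewrite h mulrDl mulrA.
- move=> u v _ _; rewrite /L2_ip -cintegral_conj//; last first.
    exact: cintegrable_mulJ (L2P u) (L2P v).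
  by apply: eq_cintegral => a _; rewrite conjcM conjcK mulrC.
- move=> u _; rewrite -/(nrm2 _ u) L2_nrm2 fine_ge0// integral_ge0// => a _.
  by rewrite lee_fin normsq_ge0.
Qed.

Lemma L2_definite (F : L2 H) : nrm2 (@L2_ip _ _ _ _ _ H) F = 0 -> F = 0.
Proof.
have [mF iF] := L2P F.
have m : measurable_fun setT (fun a => (normsq (F a))%:E).
  exact/measurable_EFinP/measurable_normsq.
rewrite L2_nrm2 => F0.
have : (\int[nu]_a `| (normsq (F a))%:E | = 0)%E.
  under eq_integral do rewrite gee0_abs ?lee_fin ?normsq_ge0//.
  apply/eqP; rewrite -fine_eq0 ?F0//.
  by rewrite ge0_fin_numE// integral_ge0// => a _; rewrite lee_fin normsq_ge0.
move=> /(ae_eq_integral_abs _ measurableT m) h.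
apply/L2_eqP; have := L2_0E; apply: filterS2 h => a /(_ Logic.I) /= h ->.
by apply: normsq_eq0; case: h.
Qed.

End L2Theory.

Lemma esum_supp {R : realType} {T : choiceType} (A B : set T) (f : T -> \bar R) :
  (forall a, 0 <= f a)%E -> (forall a, A a -> ~ B a -> f a = 0)%E ->
  (\esum_(a in A) f a = \esum_(a in A `&` B) f a)%E.
Proof.
move=> f0 fB; rewrite (esumID B)/=; last by move=> a _; exact: f0.
by rewrite [X in (_ + X)%E]esum1 ?adde0// => a [Aa Ba]; rewrite fB.
Qed.

Lemma reindex_csum {R : realType} {T T' : choiceType} (P : set T) (Q : set T')
    (e : T -> T') (f : T' -> R[i]) : set_bij P Q e ->
  csum Q f = csum P (fun a => f (e a)).
Proof. by move=> eb; rewrite /csum !(reindex_rsum _ eb). Qed.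

Lemma normsq_le_norm {R : realType} (z : R[i]) (M : R) : `|z| <= M%:C%C ->
  normsq z <= M ^+ 2.
Proof.
move=> zM; rewrite -lecR -[X in X <= _]/(_%:C%C) add_Re2_Im2 rmorphXn.
by rewrite lerXn2r ?nnegrE//; apply: le_trans zM.
Qed.

(** * Operators on the groupoid L2 space *)

Section Operators.
Context (R : realType) d0 d (G0 : measurableType d0) (G : measurableType d)
  (H : groupoid R G0 G) (E : edge_cover H).
Local Notation C := R[i].
Local Notation mu := (mu0 H).
Local Notation nu := (mu1 H).
Local Notation ip := (@L2_ip _ _ _ _ _ H).
Local Notation PH := (L2_prehilbert H).
Implicit Types (phi : edge H) (F K : G -> C) (f : Linf H).

(** The action of the inverse edge, which is the adjoint of [edge_act phi]. *)
Definition edge_adj phi K : G -> C := fun b =>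
  if gr H b \in edge_dom phi then K (rtrans phi b) else 0.

Definition linf_act f F : G -> C := fun a => f (gr H a) * F a.

Lemma cmeasurable_edge_act phi F : cmeasurable setT F ->
  cmeasurable setT (edge_act phi F).
Proof.
move=> mF; apply: (cmeasurable_patch (A := gr H @^-1` edge_inv_dom phi)
  (f := fun a => F (rtransV phi a))).
  exact: (measurable_inv_dom_r E).
exact: cmeasurable_comp mF (@measurable_rtransV _ _ _ _ _ _ E phi).
Qed.

Lemma cmeasurable_edge_adj phi F : cmeasurable setT F ->
  cmeasurable setT (edge_adj phi F).
Proof.
move=> mF; apply: (cmeasurable_patch (A := gr H @^-1` edge_dom phi)
  (f := fun a => F (rtrans phi a))).
  exact: measurable_edge_dom_r.
exact: cmeasurable_comp mF (@measurable_rtrans _ _ _ _ _ _ phi).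
Qed.

Lemma cmeasurable_linf_act f F : cmeasurable setT F ->
  cmeasurable setT (linf_act f F).
Proof.
move=> mF; apply: cmeasurableM => //.
exact: cmeasurable_comp (cmeasurable_linf f) (measurable_gr H).
Qed.

(** Change of variables by [rtrans phi], a bijection between the parts of the fibre that support the
    two sums. *)
Lemma l2ip_edge_act phi F K x :
  l2ip (sfib H x) (edge_act phi F) K = l2ip (sfib H x) F (edge_adj phi K).
Proof.
rewrite /l2ip.
rewrite (@csum_supp _ _ (sfib H x) (sfib H x `&` [set a | edge_inv_dom phi (gr H a)]));
  first last.
- move=> a ax /= na; rewrite /edge_act memNset ?mul0r// => ia.
  by apply: na.
- by move=> a [].
rewrite (reindex_csum _ (rtrans_bij phi x)).
rewrite [RHS](@csum_supp _ _ (sfib H x) (sfib H x `&` [set a | edge_dom phi (gr H a)]));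
  first last.
- move=> a ax /= na; rewrite /edge_adj memNset ?conjc0 ?mulr0// => ia.
  by apply: na.
- by move=> a [].
apply: eq_csum => a [ax pa]; rewrite /edge_adj mem_set// /edge_act mem_set.
  by rewrite -/(rtransV phi _) rtransK.
exact: rtrans_dom.
Qed.

Lemma l2norm2_edge_act phi F x :
  (l2norm2 (sfib H x) (edge_act phi F) <= l2norm2 (sfib H x) F)%E.
Proof.
rewrite /l2norm2.
rewrite (@esum_supp _ _ _ [set a | edge_inv_dom phi (gr H a)]); first last.
- by move=> a _ /= na; rewrite /edge_act memNset// normsq0.
- by move=> a; rewrite lee_fin normsq_ge0.
rewrite (reindex_esum _ _ _ _ (rtrans_bij phi x)).
rewrite [leRHS](esumID [set a | edge_dom phi (gr H a)]); last first.
  by move=> a _; rewrite lee_fin normsq_ge0.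
rewrite -[leLHS]adde0; apply: leeD; last first.
  by apply: esum_ge0 => a _; rewrite lee_fin normsq_ge0.
apply: le_esum => a [ax pa]; rewrite /edge_act mem_set; last exact: rtrans_dom.
by rewrite -/(rtransV phi _) rtransK.
Qed.

Lemma l2norm2_edge_adj phi F x :
  (l2norm2 (sfib H x) (edge_adj phi F) <= l2norm2 (sfib H x) F)%E.
Proof.
rewrite /l2norm2.
rewrite (@esum_supp _ _ _ [set a | edge_dom phi (gr H a)]); first last.
- by move=> a _ /= na; rewrite /edge_adj memNset// normsq0.
- by move=> a; rewrite lee_fin normsq_ge0.
rewrite [leRHS](esumID [set a | edge_inv_dom phi (gr H a)]); last first.
  by move=> a _; rewrite lee_fin normsq_ge0.
rewrite (reindex_esum _ _ _ _ (rtrans_bij phi x)).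
rewrite -[leLHS]adde0; apply: leeD; last first.
  by apply: esum_ge0 => a _; rewrite lee_fin normsq_ge0.
by apply: le_esum => a [ax pa]; rewrite /edge_adj mem_set.
Qed.

Lemma sqint_le (F K : G -> C) : cmeasurable setT K ->
  (forall x, l2norm2 (sfib H x) K <= l2norm2 (sfib H x) F)%E ->
  sqint H F -> sqint H K /\
  (\int[nu]_a (normsq (K a))%:E <= \int[nu]_a (normsq (F a))%:E)%E.
Proof.
move=> mK KF [mF iF].
have le : (\int[nu]_a (normsq (K a))%:E <= \int[nu]_a (normsq (F a))%:E)%E.
  have m1 := measurable_l2norm2_sfib E mK.
  have m2 := measurable_l2norm2_sfib E mF.
  rewrite !(integral_l2norm2 E)//; apply: ge0_le_integral => //.
  by move=> x _; exact: l2norm2_ge0.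
by split=> //; split=> //; exact: le_lt_trans le iF.
Qed.

Lemma sqint_edge_act phi F : sqint H F -> sqint H (edge_act phi F).
Proof.
move=> sF; have [mF _] := sF.
by have [] := sqint_le (cmeasurable_edge_act phi mF) (l2norm2_edge_act phi F) sF.
Qed.

Lemma sqint_edge_adj phi F : sqint H F -> sqint H (edge_adj phi F).
Proof.
move=> sF; have [mF _] := sF.
by have [] := sqint_le (cmeasurable_edge_adj phi mF) (l2norm2_edge_adj phi F) sF.
Qed.

Lemma linf_boundE f : exists2 M : R, 0 <= M &
  {ae nu, forall a, normsq (f (gr H a)) <= M}.
Proof.
have [M fM] := linf_bound f; exists (M ^+ 2); first exact: sqr_ge0.
have := ae_gr E fM; apply: filterS => a; exact: normsq_le_norm.
Qed.

Lemma sqint_ae_le F K (M : R) : cmeasurable setT K -> 0 <= M -> sqint H F ->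
  {ae nu, forall a, normsq (K a) <= M * normsq (F a)} ->
  sqint H K /\
  (\int[nu]_a (normsq (K a))%:E <= M%:E * \int[nu]_a (normsq (F a))%:E)%E.
Proof.
move=> mK M0 [mF iF] KF.
have m1 : measurable_fun setT (fun a => (normsq (K a))%:E).
  exact/measurable_EFinP/measurable_normsq.
have m2 : measurable_fun setT (fun a => (normsq (F a))%:E).
  exact/measurable_EFinP/measurable_normsq.
have le : (\int[nu]_a (normsq (K a))%:E <= M%:E * \int[nu]_a (normsq (F a))%:E)%E.
  rewrite -ge0_integralZl//; last by move=> a _; rewrite lee_fin normsq_ge0.
  apply: ae_ge0_le_integral => //.
  - by move=> a _; rewrite lee_fin normsq_ge0.
  - by move=> a _; rewrite mule_ge0 ?lee_fin ?normsq_ge0.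
  - exact: measurable_funeM.
  - by apply: filterS KF => a KF _; rewrite -EFinM lee_fin.
split=> //; split=> //; apply: le_lt_trans le _.
rewrite lte_mul_pinfty ?lee_fin// ge0_fin_numE//.
Qed.

Lemma linf_act_bound f : exists2 M : R, 0 <= M & forall F, sqint H F ->
  sqint H (linf_act f F) /\
  (\int[nu]_a (normsq (linf_act f F a))%:E <=
   M%:E * \int[nu]_a (normsq (F a))%:E)%E.
Proof.
have [M M0 fM] := linf_boundE f; exists M => // F sF; have [mF _] := sF.
apply: sqint_ae_le => //; first exact: cmeasurable_linf_act.
apply: filterS fM => a fM; rewrite /linf_act normsqM ler_wpM2r//.
exact: normsq_ge0.
Qed.

Lemma sqint_linf_act f F : sqint H F -> sqint H (linf_act f F).
Proof. by have [M _ h] := linf_act_bound f; move=> /h[]. Qed.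

Lemma edge_opE phi (u : L2 H) :
  {ae nu, forall a, edge_op phi u a = edge_act phi u a}.
Proof. exact/L2_classE/sqint_edge_act/L2P. Qed.

Lemma linf_opE f (u : L2 H) : {ae nu, forall a, linf_op f u a = linf_act f u a}.
Proof. exact/L2_classE/sqint_linf_act/L2P. Qed.

Lemma edge_act_fib phi F K x : (forall a, sfib H x a -> F a = K a) ->
  forall a, sfib H x a -> edge_act phi F a = edge_act phi K a.
Proof.
move=> FK a ax; rewrite /edge_act; case: ifPn => //; rewrite inE => pa.
by apply: FK; rewrite /sfib /= -/(rtransV phi a) gs_rtransV.
Qed.

Lemma ae_edge_act phi F K : {ae nu, forall a, F a = K a} ->
  {ae nu, forall a, edge_act phi F a = edge_act phi K a}.
Proof.
move=> /(ae_sfib E _) h; apply/(ae_sfib E _).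
by apply: filterS h => x h; exact: edge_act_fib.
Qed.

Lemma L2_ip_ae (u v : L2 H) F K : sqint H F -> sqint H K ->
  {ae nu, forall a, u a = F a} -> {ae nu, forall a, v a = K a} ->
  ip u v = cintegral mu setT (fun x => l2ip (sfib H x) F K).
Proof.
move=> sF sK uF vK; rewrite (L2_ipE E); apply: ae_eq_cintegral => //.
- exact/cintegrable_cmeasurable/(cintegrable_l2ip E)/L2P/L2P.
- exact/cintegrable_cmeasurable/(cintegrable_l2ip E).
move: uF vK => /(ae_sfib E _) uF /(ae_sfib E _).
by apply: filterS2 uF => x uF vK _; exact: eq_l2ip.
Qed.

(** What is proved by induction over the ring. An existing adjoint is part of it because [adjoint]
    defaults to 0; [rl_local] expresses that [T] does not mix fibres, and will be applied to the
    complement of [D]. *)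
Record ring_like (T : L2 H -> L2 H) : Prop := {
  rl_linear : linear T ;
  rl_bound : exists2 M : R, 0 <= M & forall u, nrm2 ip (T u) <= M * nrm2 ip u ;
  rl_adjoint : exists B : L2 H -> L2 H, forall u v, ip (T u) v = ip u (B v) ;
  rl_local : forall (N : set G0) (u : L2 H),
    {ae nu, forall a, N (gs H a) -> u a = 0} ->
    {ae nu, forall a, N (gs H a) -> T u a = 0} }.

Lemma nrm2_ae (u : L2 H) F : sqint H F -> {ae nu, forall a, u a = F a} ->
  nrm2 ip u = fine (\int[nu]_a (normsq (F a))%:E)%E.
Proof.
move=> [mF _] uF; rewrite L2_nrm2; congr fine; apply: ae_eq_integral => //.
- by have [mu' _] := L2P u; exact/measurable_EFinP/measurable_normsq.
- exact/measurable_EFinP/measurable_normsq.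
- by apply: filterS uF => a -> _.
Qed.

Lemma sqint_fin_num F : sqint H F ->
  (\int[nu]_a (normsq (F a))%:E \is a fin_num)%E.
Proof.
move=> [_ iF]; rewrite ge0_fin_numE// integral_ge0// => a _.
by rewrite lee_fin normsq_ge0.
Qed.

Lemma ring_like_edge phi : ring_like (edge_op phi).
Proof.
have lin k (u v : L2 H) : edge_op phi (k *: u + v) = k *: edge_op phi u + edge_op phi v.
  apply/L2_eqP.
  have h1 := L2_linE k (edge_op phi u) (edge_op phi v).
  have h2 := ae_edge_act phi (L2_linE k u v).
  have h3 := edge_opE phi (k *: u + v).
  have h4 := edge_opE phi u; have h5 := edge_opE phi v.
  near=> a.
  have -> : edge_op phi (k *: u + v) a = edge_act phi (k *: u + v : L2 H) a.
    by near: a.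
  have -> : (k *: edge_op phi u + edge_op phi v : L2 H) a =
      k * edge_op phi u a + edge_op phi v a by near: a.
  have -> : edge_op phi u a = edge_act phi u a by near: a.
  have -> : edge_op phi v a = edge_act phi v a by near: a.
  have -> : edge_act phi (k *: u + v : L2 H) a =
      edge_act phi (fun a => k * u a + v a) a by near: a.
  by rewrite /edge_act; case: ifP => // _; rewrite mulr0 addr0.
split=> //.
- exists 1 => // u; rewrite mul1r (nrm2_ae _ (edge_opE phi u)); last first.
    exact/sqint_edge_act/L2P.
  have su := L2P u; have [mu' _] := su.
  have [_ le] := sqint_le (cmeasurable_edge_act phi mu') (l2norm2_edge_act phi u) su.
  rewrite L2_nrm2 fine_le//; first exact/sqint_fin_num/sqint_edge_act.
  exact: sqint_fin_num.
- exists (fun v => L2_class H (edge_adj phi v)) => u v.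
  have su := L2P u; have sv := L2P v.
  rewrite (L2_ip_ae (sqint_edge_act phi su) sv (edge_opE phi u)); last exact: aeW.
  rewrite (L2_ip_ae su (sqint_edge_adj phi sv)); last 2 first.
  + exact: aeW.
  + exact/L2_classE/sqint_edge_adj.
  by apply: eq_cintegral => x _; exact: l2ip_edge_act.
- move=> N u u0; have h := edge_opE phi u.
  move: u0 => /(ae_sfib E _) u0.
  have {}u0 : {ae nu, forall a, N (gs H a) -> edge_act phi u a = 0}.
    apply/(ae_sfib E _); apply: filterS u0 => x u0 a ax Na.
    rewrite /edge_act; case: ifPn => //; rewrite inE => pa.
    rewrite -/(rtransV phi a) u0//; last by rewrite gs_rtransV.
    by rewrite /sfib /= gs_rtransV.
  by apply: filterS2 h u0 => a -> .
Unshelve. all: by end_near. Qed.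

Lemma ring_like_linf f : ring_like (linf_op f).
Proof.
have lin k (u v : L2 H) : linf_op f (k *: u + v) = k *: linf_op f u + linf_op f v.
  apply/L2_eqP.
  have h1 := L2_linE k (linf_op f u) (linf_op f v).
  have h2 := L2_linE k u v.
  have h3 := linf_opE f (k *: u + v).
  have h4 := linf_opE f u; have h5 := linf_opE f v.
  near=> a.
  have -> : linf_op f (k *: u + v) a = linf_act f (k *: u + v : L2 H) a.
    by near: a.
  have -> : (k *: linf_op f u + linf_op f v : L2 H) a =
      k * linf_op f u a + linf_op f v a by near: a.
  have -> : linf_op f u a = linf_act f u a by near: a.
  have -> : linf_op f v a = linf_act f v a by near: a.
  rewrite /linf_act.
  have -> : (k *: u + v : L2 H) a = k * u a + v a by near: a.
  by rewrite mulrDr mulrCA.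
split=> //.
- have [M M0 h] := linf_act_bound f; exists M => // u; have su := L2P u.
  have [sfu le] := h _ su; rewrite (nrm2_ae sfu (linf_opE f u)) L2_nrm2.
  rewrite -[M]/(fine M%:E) -fineM//; last exact: sqint_fin_num.
  by rewrite fine_le//; [exact: sqint_fin_num|rewrite fin_numM// sqint_fin_num].
- pose fJ (v : G -> C) : G -> C := fun a => conjc (f (gr H a)) * v a.
  have sfJ v : sqint H v -> sqint H (fJ v).
    move=> sv; have [mv _] := sv; have [M M0 fM] := linf_boundE f.
    have [] // := @sqint_ae_le v (fJ v) M.
      apply: cmeasurableM => //.
      apply: cmeasurable_conj.
      exact: cmeasurable_comp (cmeasurable_linf f) (measurable_gr H).
    apply: filterS fM => a fM; rewrite /fJ normsqM normsq_conjc ler_wpM2r//.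
    exact: normsq_ge0.
  exists (fun v => L2_class H (fJ v)) => u v.
  have su := L2P u; have sv := L2P v.
  rewrite (L2_ip_ae (sqint_linf_act f su) sv (linf_opE f u)); last exact: aeW.
  rewrite (L2_ip_ae su (sfJ _ sv)); last 2 first.
  + exact: aeW.
  + exact/L2_classE/sfJ.
  apply: eq_cintegral => x _; apply: eq_csum => a _.
  by rewrite /linf_act /fJ conjcM conjcK mulrCA mulrA.
- move=> N u u0; have h := linf_opE f u.
  by apply: filterS2 h u0 => a -> u0 Na; rewrite /linf_act u0// mulr0.
Unshelve. all: by end_near. Qed.

Lemma ring_like_add S T : ring_like S -> ring_like T -> ring_like (S + T).
Proof.
move=> [lS [M1 M10 b1] [A1 a1] loc1] [lT [M2 M20 b2] [A2 a2] loc2]; split.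
- move=> k u v; rewrite -[LHS]/(S _ + T _) -[RHS]/(k *: (S u + T u) + (S v + T v)).
  by rewrite lS lT scalerDr addrACA.
- exists (2 * M1 + 2 * M2); first by rewrite addr_ge0 ?mulr_ge0.
  move=> u; rewrite -[(S + T) u]/(S u + T u).
  (* Parallelogram law: positivity of the squared norm of [S u - T u] bounds that of [S u + T u]. *)
  have := ph_pos PH (Logic.I : [set: L2 H] (S u + (-1) *: T u)).
  rewrite -/(nrm2 ip _) (nrm2_addZ PH)//.
  have := nrm2_addZ PH 1 (Logic.I : [set: L2 H] (S u)) (Logic.I : [set: L2 H] (T u)).
  rewrite scale1r => ->.
  have -> : normsq (-1 : C) = 1 by rewrite /normsq /= oppr0 expr0n sqrrN expr1n addr0.
  have -> : normsq (1 : C) = 1 by rewrite /normsq /= expr0n expr1n addr0.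
  rewrite conjcN conjc1 mulN1r !mul1r ReN.
  by have := b1 u; have := b2 u; lra.
- exists (fun v => A1 v + A2 v) => u v; rewrite -[(S + T) u]/(S u + T u).
  by rewrite (ph_ipDl PH)// (ph_ipDr PH)// a1 a2.
- move=> N u u0; have h1 := loc1 N u u0; have h2 := loc2 N u u0.
  have h3 := L2_linE 1 (S u) (T u).
  have : {ae nu, forall a, (1 *: S u + T u : L2 H) a = 1 * S u a + T u a} by [].
  rewrite scale1r -[(S + T) u]/(S u + T u) => h4.
  apply: filterS3 h1 h2 h4 => a h1 h2 -> Na.
  by rewrite h1// h2// mulr0 addr0.
Qed.

Lemma ring_like_scale (k : C) T : ring_like T -> ring_like (k *: T).
Proof.
move=> [lT [M M0 b] [A aA] loc]; split.
- move=> l u v; rewrite -[LHS]/(k *: T _) -[RHS]/(l *: (k *: T u) + k *: T v).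
  by rewrite lT scalerDr !scalerA mulrC.
- exists (normsq k * M); first by rewrite mulr_ge0 ?normsq_ge0.
  move=> u; have := nrm2_addZ PH k (Logic.I : [set: L2 H] 0)
    (Logic.I : [set: L2 H] (T u)).
  rewrite add0r -[(k *: T) u]/(k *: T u) => ->.
  rewrite /nrm2 !(ph_ip0l PH)// mulr0 /= mulr0 !add0r -mulrA ler_wpM2l ?normsq_ge0//.
  exact: b.
- exists (fun v => conjc k *: A v) => u v; rewrite -[(k *: T) u]/(k *: T u).
  by rewrite (ph_ipZl PH)// (ph_ipZr PH)// conjcK aA.
- move=> N u u0; have h1 := loc N u u0; have h2 := L2_0E H.
  have := L2_linE k (T u) 0; rewrite addr0 -[(k *: T) u]/(k *: T u) => h3.
  by apply: filterS3 h1 h2 h3 => a h1 h2 -> Na; rewrite h1// h2 mulr0 addr0.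
Qed.

Lemma ring_like_comp S T : ring_like S -> ring_like T -> ring_like (S \o T).
Proof.
move=> [lS [M1 M10 b1] [A1 a1] loc1] [lT [M2 M20 b2] [A2 a2] loc2]; split.
- by move=> k u v /=; rewrite lT lS.
- exists (M1 * M2); first exact: mulr_ge0.
  move=> u /=; apply: le_trans (b1 _) _.
  by rewrite -mulrA ler_wpM2l.
- by exists (A2 \o A1) => u v /=; rewrite a1 a2.
- by move=> N u u0; exact/loc1/loc2.
Qed.

Lemma ring_like_groupoid_ring T : groupoid_ring T -> ring_like T.
Proof.
elim=> [phi|f|S {}T _ IS _ IT|{}T _ IT|S {}T _ IS _ IT].
- exact: ring_like_edge.
- exact: ring_like_linf.
- exact: ring_like_add.
- by rewrite -scaleN1r; exact: ring_like_scale.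
- exact: ring_like_comp.
Qed.

End Operators.

(** * Formal sums as operators on functions *)

Section FormalSums.
Context (R : realType) d0 d (G0 : measurableType d0) (G : measurableType d)
  (H : groupoid R G0 G) (E : edge_cover H).
Local Notation C := R[i].
Local Notation mu := (mu0 H).
Local Notation nu := (mu1 H).
Implicit Types (phi : edge H) (F K : G -> C) (f : Linf H) (p : formal_sum H).

(** The action of [op_of p] on functions instead of classes. Its value at an arrow depends only on
    [F] along the fibre, so it also computes [conv p x]. *)
Definition fam_act p F : G -> C := fun a =>
  \sum_(q <- p) edge_act q.1 (linf_act q.2 F) a.

Lemma sqint_lin (k : C) F K : sqint H F -> sqint H K ->
  sqint H (fun a => k * F a + K a).
Proof.
move=> /L2_predP sF /L2_predP sK; apply/L2_predP.
have [_ h] := @L2_submod _ _ _ _ _ H.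
exact: (h k F K sF sK).
Qed.

Lemma sqint_0 : sqint H (fun=> 0).
Proof. by apply/L2_predP; have [h _] := @L2_submod _ _ _ _ _ H. Qed.

Lemma sqint_fam_act p F : sqint H F -> sqint H (fam_act p F).
Proof.
move=> sF; elim: p => [|q p IH].
  rewrite (_ : fam_act _ _ = fun=> 0); first exact: sqint_0.
  by apply/funext => a; rewrite /fam_act big_nil.
rewrite (_ : fam_act _ _ = fun a =>
    1 * edge_act q.1 (linf_act q.2 F) a + fam_act p F a).
  apply: sqint_lin => //; apply: (sqint_edge_act E).
  exact: (sqint_linf_act E).
by apply/funext => a; rewrite /fam_act big_cons mul1r.
Qed.

Lemma fam_act_fib p F K x : (forall a, sfib H x a -> F a = K a) ->
  forall a, sfib H x a -> fam_act p F a = fam_act p K a.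
Proof.
move=> FK a ax; apply: eq_bigr => q _; apply: edge_act_fib ax => b bx.
by rewrite /linf_act FK.
Qed.

Lemma op_ofE p (u : L2 H) : {ae nu, forall a, op_of p u a = fam_act p u a}.
Proof.
elim: p => [|q p IH].
  rewrite (_ : op_of _ u = 0); last by rewrite /op_of big_nil.
  by have := L2_0E H; apply: filterS => a ->; rewrite /fam_act big_nil.
rewrite (_ : op_of _ u = 1 *: edge_op q.1 (linf_op q.2 u) + op_of p u); last first.
  by rewrite scale1r /op_of big_cons.
have h1 := L2_linE 1 (edge_op q.1 (linf_op q.2 u)) (op_of p u).
have h2 := edge_opE E q.1 (linf_op q.2 u).
have h3 := ae_edge_act E q.1 (linf_opE E q.2 u).
move: h1; apply: filter_app; move: h2; apply: filter_app.
move: h3; apply: filter_app; move: IH; apply: filterS => a h h3 h2 h1.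
by rewrite h1 mul1r h h2 h3 /fam_act big_cons.
Qed.

(** Pushing [zeta a] forward by an edge or pulling it back by the inverse edge is the same, since
    [b = rtrans phi a] iff [rtransV phi b = a] on the domains. *)
Lemma conv_zetaE p a b : conv_zeta p a b = fam_act p (zeta a) b.
Proof.
rewrite /conv_zeta /fam_act sum_fun big_mkcond; apply: eq_bigr => q _.
rewrite /edge_act /linf_act -/(rtransV q.1 b).
have [pa|pa] := pselect (edge_dom q.1 (gr H a)).
  rewrite mem_set//; have [ib|ib] := pselect (edge_inv_dom q.1 (gr H b)).
    rewrite mem_set// -[LHS]/(q.2 (gr H a) * zeta (rtrans q.1 a) b) /zeta.
    have -> : (b == rtrans q.1 a) = (rtransV q.1 b == a).
      by apply/eqP/eqP => [->|<-]; rewrite ?rtransK ?rtransVK.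
    by case: eqP => [->|]; rewrite ?mulr0.
  rewrite memNset// -[LHS]/(q.2 (gr H a) * zeta (rtrans q.1 a) b) /zeta.
  case: eqP => [bE|_]; last by rewrite mulr0.
  by exfalso; apply: ib; rewrite bE; exact: rtrans_dom.
rewrite memNset//; case: ifPn => //; rewrite inE => ib; rewrite /zeta.
case: eqP => [bE|_]; last by rewrite mulr0.
by exfalso; apply: pa; rewrite -bE; exact: rtransV_dom.
Qed.

Lemma conv_out p x xi b : gs H b <> x -> Defs.conv p x xi b = 0.
Proof.
move=> bx; rewrite /Defs.conv fsbig1// => a ax; rewrite conv_zetaE /fam_act.
rewrite big1 ?mulr0// => q _; rewrite /edge_act; case: ifPn => //.
rewrite inE => ib; rewrite /linf_act -/(rtransV q.1 b) /zeta.
case: eqP => [bE|_]; last by rewrite mulr0.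
by exfalso; apply: bx; rewrite -(gs_rtransV ib) bE.
Qed.

Let preim p b := [seq rtransV q.1 b | q <- p].

Lemma fam_act_zeta_supp p a b : a \notin preim p b -> fam_act p (zeta a) b = 0.
Proof.
rewrite /fam_act; elim: p => [|q p IH]; first by rewrite big_nil.
rewrite inE negb_or big_cons => /andP[aq ap]; rewrite IH// addr0.
rewrite /edge_act; case: ifPn => // _.
rewrite /linf_act -/(rtransV q.1 b) /zeta.
by rewrite eq_sym (negbTE aq) mulr0.
Qed.

Lemma fam_act_zeta_finite p b :
  finite_set [set a | fam_act p (zeta a) b <> 0].
Proof.
apply: (@sub_finite_set _ _ [set` preim p b]); last exact: finite_seq.
move=> a /= na; apply: contrapT => /negP ha; apply: na.
exact: fam_act_zeta_supp.
Qed.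

Lemma fam_act_sum p (X : {fset G}) xi b : {subset preim p b <= X} ->
  \sum_(a <- X) xi a * fam_act p (zeta a) b = fam_act p xi b.
Proof.
elim: p => [|q p IH] sX.
  by rewrite {2}/fam_act big_nil big1// => a _; rewrite /fam_act big_nil mulr0.
rewrite [RHS]/fam_act big_cons -/(fam_act p xi b) -IH; last first.
  by move=> a ap; apply: sX; rewrite inE ap orbT.
under eq_bigr do rewrite /fam_act big_cons mulrDr.
rewrite big_split/=; congr (_ + _); rewrite /edge_act.
case: ifPn => [|_]; last by rewrite big1// => a _; rewrite mulr0.
rewrite inE => ib; rewrite -/(rtransV q.1 b).
have Xc : rtransV q.1 b \in X by apply: sX; rewrite mem_head.
rewrite (big_fsetD1 _ Xc)/= /linf_act /zeta eqxx mulr1 mulrC.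
rewrite big_seq big1 ?addr0// => a; rewrite in_fsetD1 => /andP[/negbTE na _].
by rewrite eq_sym na !mulr0.
Qed.

(** Only the finitely many arrows that some edge of [p] sends to [b] contribute, so the sum over a
    possibly infinite fibre reduces to a finite one. *)
Lemma convE p x xi b : gs H b = x -> Defs.conv p x xi b = fam_act p xi b.
Proof.
move=> bx; rewrite /Defs.conv.
under eq_fsbigr do rewrite conv_zetaE.
(* Edges whose inverse is undefined at the range of [b] contribute 0, but would put unspecified
   arrows into [preim p b]; without them it lies in the fibre. *)
pose q := [seq q <- p | gr H b \in edge_inv_dom q.1].
have qE F : fam_act p F b = fam_act q F b.
  rewrite /fam_act big_filter [RHS]big_mkcond; apply: eq_bigr => e _.
  by rewrite /edge_act; case: ifP.
under eq_fsbigr do rewrite qE.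
rewrite qE; pose X := [set` preim q b].
have qx a : a \in preim q b -> sfib H x a.
  rewrite /preim /q {X qE q}; elim: p => //= e p IH.
  case: ifPn => //; rewrite inE => eb; rewrite inE => /predU1P[->|//].
  by rewrite /sfib /= gs_rtransV.
rewrite -(@fsbig_widen _ _ _ _ X); last 2 first.
- by move=> a /qx.
- move=> a [/= ax /negP na]; by rewrite fam_act_zeta_supp ?mulr0.
rewrite fsbig_finite; last exact: finite_seq.
apply: fam_act_sum => a ap; rewrite in_fset_set ?inE//; exact: finite_seq.
Qed.

End FormalSums.

(** * Compression to the direct integral *)

Section DirectIntegral.
Context (R : realType) d0 d (G0 : measurableType d0) (G : measurableType d)
  (H : groupoid R G0 G) (E : edge_cover H) (FD : fundamental_domain H).
Local Notation C := R[i].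
Local Notation D := (fd_set FD).
Local Notation mu := (mu0 H).
Local Notation nu := (mu1 H).
Local Notation ip := (@L2_ip _ _ _ _ _ H).
Local Notation PH := (L2_prehilbert H).
Implicit Types (xi eta : G0 -> G -> C) (F K : G -> C).

Let mD : measurable D. Proof. exact: measurable_fd. Qed.

Definition dint_ext xi : G -> C := fun a =>
  if gs H a \in D then xi (gs H a) a else 0.

Definition dint_res F : G0 -> G -> C := fun x a =>
  if a \in sfib H x then F a else 0.

Lemma dint_ext_fib xi x : D x -> forall a, sfib H x a -> dint_ext xi a = xi x a.
Proof. by move=> Dx a ax; rewrite /dint_ext ax mem_set. Qed.

Lemma dint_ext_out xi x : ~ D x -> forall a, sfib H x a -> dint_ext xi a = 0.
Proof. by move=> Dx a ax; rewrite /dint_ext ax memNset. Qed.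

Lemma dint_res_fib F x : forall a, sfib H x a -> dint_res F x a = F a.
Proof. by move=> a ax; rewrite /dint_res mem_set. Qed.

Lemma l2ip_esection n x (v : G -> C) : l2ip (sfib H x) v (esection (E n) x) =
  if x \in edge_dom (E n) then v (E n x) else 0.
Proof.
rewrite /esection; case: ifPn => [|_]; last exact: l2ip0.
by rewrite inE => nx; rewrite l2ip_zeta//; exact: gs_edge.
Qed.

Lemma sqint_dint_ext xi : xi \in dint_pred E FD -> sqint H (dint_ext xi).
Proof.
move=> /asboolP[xi0 mxi ixi].
have m : cmeasurable setT (dint_ext xi).
  (* On the image of [E n] over [D], the values are the coefficients against the section of [E n],
     which are measurable by the definition of a measurable field. *)
  have key n : cmeasurable (edge_im (E n)) (dint_ext xi).
    pose c x := l2ip (sfib H x) (xi x) (esection (E n) x).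
    have mc : cmeasurable setT (fun x => if x \in D then c x else 0).
      exact: (cmeasurable_patch mD (mxi n)).
    have := cmeasurable_comp (D := edge_im (E n)) mc
      (measurable_funTS (measurable_gs H)).
    apply: eq_cmeasurable => a [x nx <-]; rewrite gs_edge// /dint_ext gs_edge//.
    by case: ifP => // _; rewrite /c l2ip_esection mem_set.
  by split; apply: (@measurable_fun_cover _ _ _ _ _ _ E) => n; have [] := key n.
split=> //; rewrite (integral_l2norm2 E)//.
rewrite (_ : (\int[mu]_x _)%E = (\int[mu]_(x in D) l2norm2 (sfib H x) (xi x))%E)//.
rewrite [RHS]integral_mkcond; apply: eq_integral => x _.
rewrite /patch; case: ifPn => [|]; rewrite ?notin_setE ?inE => Dx.
  by apply: eq_l2norm2; exact: dint_ext_fib.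
by apply: esum1 => a ax; rewrite (dint_ext_out _ Dx)// normsq0.
Qed.

Lemma dint_res_pred F : sqint H F -> dint_res F \in dint_pred E FD.
Proof.
move=> [mF iF]; apply/asboolP; split.
- by move=> x a ax; rewrite /dint_res memNset.
- move=> n.
  suff [m1 m2] : cmeasurable setT
      (fun x => l2ip (sfib H x) (dint_res F x) (esection (E n) x)).
    by split; apply: measurable_funTS.
  rewrite (_ : (fun _ => _) =
      (fun x => if x \in edge_dom (E n) then F (E n x) else 0)).
    apply: (cmeasurable_patch (measurable_edge_dom (E n)) (f := fun x => F (E n x))).
    exact: cmeasurable_comp mF (@measurable_edge_fun _ _ _ _ _ _ (E n)).
  apply/funext => x; rewrite l2ip_esection; case: ifPn => //.
  by rewrite inE => nx; rewrite dint_res_fib//; exact: gs_edge.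
apply: le_lt_trans iF; rewrite (integral_l2norm2 E)//.
have e x : l2norm2 (sfib H x) (dint_res F x) = l2norm2 (sfib H x) F.
  by apply: eq_l2norm2; exact: dint_res_fib.
under eq_integral do rewrite e.
apply: ge0_subset_integral => //; first exact: (measurable_l2norm2_sfib E).
by move=> x _; exact: l2norm2_ge0.
Qed.

(** Applied to [conv p x (xi x)], which is known to agree with a measurable field only for [x] in
    [D]. *)
Lemma dint_pred_eq xi eta : xi \in dint_pred E FD ->
  (forall x a, ~ sfib H x a -> eta x a = 0) ->
  (forall x, D x -> eta x = xi x) -> eta \in dint_pred E FD.
Proof.
move=> /asboolP[xi0 mxi ixi] eta0 ex; apply/asboolP; split=> //.
  move=> n; apply: eq_cmeasurable (mxi n) => x Dx; by rewrite ex.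
rewrite (eq_integral (fun x => l2norm2 (sfib H x) (xi x)))// => x.
by rewrite inE => Dx; rewrite ex.
Qed.

Lemma dintP (xi : dint E FD) : (xi : G0 -> G -> C) \in dint_pred E FD.
Proof. exact: aeq_reprP. Qed.

Lemma dint_out (xi : dint E FD) x a : ~ sfib H x a -> xi x a = 0.
Proof. by have /asboolP[h _ _] := dintP xi; exact: h. Qed.

Lemma dint_classE xi : xi \in dint_pred E FD ->
  {ae mu, forall x, D x -> dint_class E FD xi x = xi x}.
Proof. by move=> /(aeq_classE mu D); apply: filterS => x h; exact: h. Qed.

Lemma dint_eqP (xi eta : dint E FD) :
  xi = eta <-> {ae mu, forall x, D x -> xi x = eta x}.
Proof. exact: aeq_eq. Qed.

Lemma dint_linE (k : C) (xi eta : dint E FD) :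
  {ae mu, forall x, D x -> (k *: xi + eta : dint E FD) x = k *: xi x + eta x}.
Proof. by have := aeq_linE k xi eta; apply: filterS => x h; exact: h. Qed.

(** [dint E FD] is the subspace of [L2 H] of functions supported on the
    arrows with source in [D]; [dint_in] is the inclusion and [dint_out_of] the
    orthogonal projection. *)
Definition dint_in (xi : dint E FD) : L2 H := L2_class H (dint_ext xi).

Definition dint_out_of (u : L2 H) : dint E FD := dint_class E FD (dint_res u).

Lemma dint_inE (xi : dint E FD) :
  {ae nu, forall a, dint_in xi a = dint_ext xi a}.
Proof. exact/L2_classE/sqint_dint_ext/dintP. Qed.

Lemma dint_out_ofE (u : L2 H) :
  {ae mu, forall x, D x -> dint_out_of u x = dint_res u x}.
Proof. exact/dint_classE/dint_res_pred/L2P. Qed.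

Lemma dint_inK (xi : dint E FD) : dint_out_of (dint_in xi) = xi.
Proof.
apply/dint_eqP; have h1 := dint_out_ofE (dint_in xi).
have /(ae_sfib E _) h2 := dint_inE xi.
apply: filterS2 h1 h2 => x h1 h2 Dx; rewrite h1//; apply/funext => a.
have [ax|ax] := pselect (sfib H x a).
  by rewrite dint_res_fib// h2// (dint_ext_fib _ Dx).
by rewrite dint_out// /dint_res memNset.
Qed.

Lemma dint_in_lin (k : C) (xi eta : dint E FD) :
  dint_in (k *: xi + eta) = k *: dint_in xi + dint_in eta.
Proof.
apply/L2_eqP; apply/(ae_sfib E _).
have /(ae_sfib E _) h1 := L2_linE k (dint_in xi) (dint_in eta).
have /(ae_sfib E _) h2 := dint_inE (k *: xi + eta).
have /(ae_sfib E _) h3 := dint_inE xi.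
have /(ae_sfib E _) h4 := dint_inE eta.
have h5 := dint_linE k xi eta.
near=> x => a ax.
have -> : (k *: dint_in xi + dint_in eta : L2 H) a = k * dint_in xi a + dint_in eta a.
  by move: a ax; near: x.
have -> : dint_in (k *: xi + eta) a = dint_ext (k *: xi + eta : dint E FD) a.
  by move: a ax; near: x.
have -> : dint_in xi a = dint_ext xi a by move: a ax; near: x.
have -> : dint_in eta a = dint_ext eta a by move: a ax; near: x.
have [Dx|Dx] := pselect (D x); last first.
  by rewrite !(dint_ext_out _ Dx)// mulr0 addr0.
rewrite !(dint_ext_fib _ Dx)//.
have -> : (k *: xi + eta : dint E FD) x = k *: xi x + eta x.
  by move: Dx; near: x.
by [].
Unshelve. all: by end_near. Qed.

Lemma dint_out_of_lin (k : C) (u v : L2 H) :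
  dint_out_of (k *: u + v) = k *: dint_out_of u + dint_out_of v.
Proof.
apply/dint_eqP.
have /(ae_sfib E _) h1 := L2_linE k u v.
have h2 := dint_out_ofE (k *: u + v).
have h3 := dint_out_ofE u; have h4 := dint_out_ofE v.
have h5 := dint_linE k (dint_out_of u) (dint_out_of v).
near=> x => Dx.
have -> : (k *: dint_out_of u + dint_out_of v : dint E FD) x =
    k *: dint_out_of u x + dint_out_of v x by move: Dx; near: x.
have -> : dint_out_of (k *: u + v) x = dint_res (k *: u + v : L2 H) x.
  by move: Dx; near: x.
have -> : dint_out_of u x = dint_res u x by move: Dx; near: x.
have -> : dint_out_of v x = dint_res v x by move: Dx; near: x.
apply/funext => a.
rewrite -[RHS]/(k * dint_res u x a + dint_res v x a) /dint_res.
have [ax|ax] := pselect (sfib H x a); last first.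
  by rewrite memNset// mulr0 addr0.
by rewrite mem_set//; move: a ax; near: x.
Unshelve. all: by end_near. Qed.

Lemma dint_out_ofK (u : L2 H) : {ae nu, forall a, ~ D (gs H a) -> u a = 0} ->
  dint_in (dint_out_of u) = u.
Proof.
move=> /(ae_sfib E _) u0; apply/L2_eqP/(ae_sfib E _).
have /(ae_sfib E _) h1 := dint_inE (dint_out_of u).
have h2 := dint_out_ofE u.
apply: filterS3 u0 h1 h2 => x u0 h1 h2 a ax; rewrite h1//.
have [Dx|Dx] := pselect (D x); last by rewrite (dint_ext_out _ Dx)// u0// ax.
by rewrite (dint_ext_fib _ Dx)// h2// dint_res_fib.
Qed.

Lemma dint_in_supp (xi : dint E FD) : {ae nu, forall a, ~ D (gs H a) -> dint_in xi a = 0}.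
Proof.
have := dint_inE xi; apply: filterS => a -> Da.
by rewrite /dint_ext memNset.
Qed.

Lemma dint_ipE (xi eta : dint E FD) : dint_ip xi eta = ip (dint_in xi) (dint_in eta).
Proof.
rewrite (L2_ip_ae E (sqint_dint_ext (dintP xi)) (sqint_dint_ext (dintP eta))
  (dint_inE xi) (dint_inE eta)).
have e x : D x -> l2ip (sfib H x) (xi x) (eta x) =
    l2ip (sfib H x) (dint_ext xi) (dint_ext eta).
  by move=> Dx; apply: eq_l2ip => a ax; rewrite (dint_ext_fib _ Dx).
have e0 x : ~ D x -> l2ip (sfib H x) (dint_ext xi) (dint_ext eta) = 0.
  move=> Dx; rewrite (@eq_l2ip _ _ _ (dint_ext xi) (dint_ext xi) (dint_ext eta) 0).
  - exact: l2ip0.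
  - by [].
  - exact: dint_ext_out Dx.
rewrite /dint_ip /cintegral; congr Complex; rewrite Rintegral_mkcond;
  apply: eq_Rintegral => x _; rewrite /patch; case: ifPn => [|]; rewrite ?inE ?notin_setE => Dx;
  by [rewrite e|rewrite e0].
Qed.

(** With [dint_ipE] this makes [dint_out_of] the adjoint of the isometry [dint_in]. *)
Lemma ip_dint_in (xi : dint E FD) (u : L2 H) :
  ip (dint_in xi) u = ip (dint_in xi) (dint_in (dint_out_of u)).
Proof.
have sx := sqint_dint_ext (dintP xi).
rewrite (L2_ip_ae E sx (L2P u) (dint_inE xi)); last exact: aeW.
rewrite (L2_ip_ae E sx (sqint_dint_ext (dintP (dint_out_of u))) (dint_inE xi)
  (dint_inE _)).
apply: ae_eq_cintegral => //.
- exact/cintegrable_cmeasurable/(cintegrable_l2ip E)/L2P.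
- exact/cintegrable_cmeasurable/(cintegrable_l2ip E)/sqint_dint_ext/dintP.
have := dint_out_ofE u; apply: filterS => x h _.
have [Dx|Dx] := pselect (D x).
  by apply: eq_l2ip => // a ax; rewrite (dint_ext_fib _ Dx)// h// dint_res_fib.
have z K : l2ip (sfib H x) (dint_ext xi) K = 0.
  rewrite l2ip_herm (@eq_l2ip _ _ _ K K (dint_ext xi) 0) ?l2ip0 ?conjc0// => a ax.
  exact: dint_ext_out Dx _ ax.
by rewrite !z.
Qed.

Lemma dint_in_inj : injective dint_in.
Proof. exact: can_inj dint_inK. Qed.

Definition compress (T : L2 H -> L2 H) : dint E FD -> dint E FD :=
  fun xi : dint E FD => dint_out_of (T (dint_in xi)).

(** By locality [T] preserves the functions supported over [D], so the projection loses nothing.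
    Multiplicativity of the compression depends on this. *)
Lemma compressK T (xi : dint E FD) : ring_like T -> dint_in (compress T xi) = T (dint_in xi).
Proof.
move=> rT; apply: dint_out_ofK.
exact: (@rl_local _ _ _ _ _ _ T rT (~` D) _ (dint_in_supp xi)).
Qed.

Lemma compress_lin T (k : C) (xi eta : dint E FD) : ring_like T ->
  compress T (k *: xi + eta) = k *: compress T xi + compress T eta.
Proof.
move=> rT; apply: dint_in_inj.
transitivity (k *: T (dint_in xi) + T (dint_in eta)).
  apply: (etrans (compressK _ rT)).
  exact: (etrans (congr1 T (dint_in_lin k xi eta)) (rl_linear rT _ _ _)).
apply/esym/(etrans (dint_in_lin k (compress T xi) (compress T eta))).
exact: (f_equal2 (fun u v => k *: u + v) (compressK xi rT) (compressK eta rT)).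
Qed.

Lemma compress_star_representation : star_representation (compress).
Proof.
have pos (u : L2 H) : 0 <= nrm2 ip u by exact: (ph_pos PH).
split.
- move=> T /(ring_like_groupoid_ring E) rT; split.
    by move=> k xi eta; exact: compress_lin.
  have [M M0 TM] := rl_bound rT; exists (Num.sqrt M) => xi.
  rewrite /ipnorm !dint_ipE compressK// -sqrtrM// ler_sqrt; first exact: TM.
  by rewrite mulr_ge0// pos.
- by apply/funext => xi; exact: dint_inK.
- move=> S T _ _; apply/funext => xi; rewrite /compress.
  rewrite -[(S + T) _]/(S (dint_in xi) + T (dint_in xi)).
  have := dint_out_of_lin 1 (S (dint_in xi)) (T (dint_in xi)).
  by rewrite !scale1r.
- move=> c T _; apply/funext => xi; rewrite /compress.
  rewrite -[(c *: T) _]/(c *: T (dint_in xi)) -[RHS]/(c *: dint_out_of _).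
  have out0 : dint_out_of 0 = 0.
    have := dint_out_of_lin (-1) 0 0; rewrite scaler0 addr0 => ->.
    by rewrite scaleN1r addrC subrr.
  have := dint_out_of_lin c (T (dint_in xi)) 0.
  by rewrite out0 !addr0.
- move=> S T /(ring_like_groupoid_ring E) rS /(ring_like_groupoid_ring E) rT.
  apply/funext => xi; apply: dint_in_inj.
  by rewrite /= compressK ?compressK//; exact: ring_like_comp.
- move=> T /(ring_like_groupoid_ring E) rT.
  have aT : forall u v, ip (T u) v = ip u (adjoint ip T v).
    apply: (@xgetPex _ 0 [set B | forall u v, ip (T u) v = ip u (B v)]).
    exact: rl_adjoint.
  have arT (xi eta : dint E FD) : dint_ip (compress T xi) eta =
      dint_ip xi (compress (adjoint ip T) eta).
    apply: (etrans (dint_ipE _ _)); apply/esym/(etrans (dint_ipE _ _))/esym.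
    apply: (etrans (congr1 (ip ^~ (dint_in eta)) (compressK xi rT))).
    exact: (etrans (aT _ _) (ip_dint_in _ _)).
  (* By [arT] the compression of the adjoint is an adjoint of the compression, so the adjoint chosen
     on [dint E FD] is a genuine one. *)
  have aR : forall xi eta : dint E FD, dint_ip (compress T xi) eta =
      dint_ip xi (adjoint (@dint_ip _ _ _ _ _ H E FD) (compress T) eta).
    apply: (@xgetPex _ 0 [set B | forall u v, dint_ip (compress T u) v =
      dint_ip u (B v)]).
    by exists (compress (adjoint ip T)) => xi eta.
  (* Uniqueness: the difference of the two candidates lies in the range of [dint_in], so it can be
     tested against itself. *)
  apply/funext => eta; apply: dint_in_inj; apply/eqP; rewrite -subr_eq0; apply/eqP.
  set v := dint_in _; set w := dint_in _; apply: (L2_definite (H := H)).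
  set z : dint E FD := - 1 *: adjoint (@dint_ip _ _ _ _ _ H E FD) (compress T) eta +
      compress (adjoint ip T) eta.
  have vw : v - w = dint_in z by rewrite /z dint_in_lin scaleN1r addrC.
  have h : ip (dint_in z) v = ip (dint_in z) w.
    apply: (etrans (esym (dint_ipE _ _))); apply: (etrans (esym (arT z eta))).
    exact: (etrans (aR z eta) (dint_ipE _ _)).
  have e : ip (v - w) v - ip (v - w) w = 0.
    by apply/eqP; rewrite subr_eq0 vw; apply/eqP; exact: h.
  have I (u : L2 H) : [set: L2 H] u by [].
  exact: (congr1 (@complex.Re R) (etrans (ph_ipBr PH (I v) (I w) (I (v - w))) e)).
Qed.

(** On almost every fibre over [D] both sides are [fam_act p] applied to [xi x]. *)
Lemma compress_op_of (p : formal_sum H) : compress (op_of p) = dint_conv p.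
Proof.
apply/funext => xi; apply/dint_eqP.
have sx := sqint_dint_ext (dintP xi).
have sf := sqint_fam_act E p sx.
have cE x : D x -> Defs.conv p x (xi x) = dint_res (fam_act p (dint_ext xi)) x.
  move=> Dx; apply/funext => b; have [bx|bx] := pselect (sfib H x b).
    rewrite dint_res_fib// convE//; apply: fam_act_fib bx => a ax.
    by rewrite (dint_ext_fib _ Dx).
  by rewrite conv_out// /dint_res memNset.
have pc : (fun x => Defs.conv p x (xi x)) \in dint_pred E FD.
  apply: dint_pred_eq (dint_res_pred sf) _ cE => x a ax.
  exact: conv_out.
have h1 := dint_classE pc.
have h2 := dint_out_ofE (op_of p (dint_in xi)).
have /(ae_sfib E _) h3 := op_ofE E p (dint_in xi).
have /(ae_sfib E _) h4 := dint_inE xi.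
near=> x => Dx.
have -> : dint_conv p xi x = Defs.conv p x (xi x) by move: Dx; near: x.
have -> : compress (op_of p) xi x = dint_res (op_of p (dint_in xi)) x.
  by move: Dx; near: x.
rewrite cE//; apply/funext => a; have [ax|ax] := pselect (sfib H x a); last first.
  by rewrite /dint_res memNset.
rewrite !dint_res_fib//.
have -> : op_of p (dint_in xi) a = fam_act p (dint_in xi) a by move: a ax; near: x.
by apply: fam_act_fib ax; near: x.
Unshelve. all: by end_near. Qed.

End DirectIntegral.

(** * Measurability of fibre sums and of stabilizer cardinals *)

Section Fibrewise.
Context (R : realType) d0 d (G0 : measurableType d0) (G : measurableType d)
  (H : groupoid R G0 G) (E : edge_cover H).
Local Notation C := R[i].
Local Notation mu := (mu0 H).

Lemma measurable_rsum_sfib (f : G -> R) : measurable_fun setT f ->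
  measurable_fun setT (fun x => rsum (sfib H x) f).
Proof.
have key (h : G -> R) : measurable_fun setT h -> measurable_fun setT
    (fun x => fine (\esum_(a in sfib H x) (Num.max (h a) 0)%:E)%E).
  move=> mh; apply: measurableT_comp => //; apply: (measurable_esum_sfib E).
    by move=> a; rewrite lee_fin le_max lexx orbT.
  by apply/measurable_EFinP; exact: measurable_maxr.
move=> mf; apply: measurable_funB; first exact: key.
by apply: key; exact: measurable_funN.
Qed.

Lemma cmeasurable_csum_sfib (f : G -> C) : cmeasurable setT f ->
  cmeasurable setT (fun x => csum (sfib H x) f).
Proof. by move=> [f1 f2]; split; exact: measurable_rsum_sfib. Qed.

(** A finitary sum is 0 by convention when its support is infinite. The counting sum detects this
    case in a way that depends measurably on the fibre. *)
Lemma fsbig_esum (T : choiceType) (A : set T) (f : T -> C) :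
  \sum_(a \in A) f a =
  if (\esum_(a in A) ((f a != 0)%:R)%:E < +oo :> \bar R)%E then csum A f else 0.
Proof.
pose S := A `&` [set a | f a <> 0].
have eS : (\esum_(a in A) ((f a != 0)%:R)%:E = counting S :> \bar R)%E.
  rewrite (@esum_supp _ _ A [set a | f a <> 0]); last 2 first.
  - by move=> a; rewrite lee_fin ler0n.
  - by move=> a _ /= /contrapT ->; rewrite eqxx.
  by rewrite counting_esum; apply: eq_esum => a [_ /= /eqP ->].
rewrite eS /counting; case: asboolP => fS; last first.
  by rewrite ltxx fsbig_dflt.
rewrite ltry -(@fsbig_widen _ _ _ _ S); last 2 first.
- by move=> a [].
- by move=> a [/= Aa na]; apply: contrapT => fa; apply: na.
rewrite (@csum_supp _ _ A S) ?csum_fset//; first by move=> a [].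
by move=> a Aa na; apply: contrapT => fa; apply: na.
Qed.

Lemma cmeasurable_fsbig_sfib (f : G -> C) : cmeasurable setT f ->
  cmeasurable setT (fun x => \sum_(a \in sfib H x) f a).
Proof.
move=> mf; under eq_fun do rewrite fsbig_esum.
pose A := [set x | (\esum_(a in sfib H x) ((f a != 0)%:R)%:E < +oo :> \bar R)%E].
have mA : measurable A.
  rewrite -[A]setTI; apply: emeasurable_fun_infty_o => //.
  apply: (measurable_esum_sfib E) => [a|]; first by rewrite lee_fin ler0n.
  have -> : (fun a => ((f a != 0)%:R)%:E : \bar R) =
      fun a => (\1_(~` [set a | normsq (f a) = 0]) a)%:E.
    apply/funext => a; rewrite indicE; congr (_%:R%:E); congr nat_of_bool.
    apply/idP/idP => [/eqP fa|].
      by rewrite inE => /normsq_eq0.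
    by rewrite inE /= => fa; apply/eqP => f0; apply: fa; rewrite f0 normsq0.
  apply/measurable_EFinP/measurable_indic/measurableC.
  rewrite -[X in measurable X]setTI.
  exact: (measurable_normsq mf measurableT (measurable_set1 0)).
have := cmeasurable_patch mA (f := fun x => csum (sfib H x) f).
have [m1 m2] := cmeasurable_csum_sfib mf.
move=> h; apply: eq_cmeasurable (h _); last by split; exact: measurable_funTS.
by move=> x _; congr (if _ then _ else _); apply/idP/idP; rewrite inE.
Qed.

(** An infinite stabilizer gives 0 on both sides, through the default of [fset_set] and through
    [fine]. *)
Lemma stab_cardE x :
  (stab_card H x)%:R =
  fine (\esum_(a in sfib H x) ((gr H a == gs H a)%:R)%:E : \bar R)%E.
Proof.
have -> : (\esum_(a in sfib H x) ((gr H a == gs H a)%:R)%:E =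
    counting (stab H x) :> \bar R)%E.
  rewrite (@esum_supp _ _ _ [set a | gr H a = gs H a]); last 2 first.
  - by move=> a; rewrite lee_fin ler0n.
  - by move=> a _ /= /eqP/negbTE ->.
  have -> : sfib H x `&` [set a | gr H a = gs H a] = stab H x.
    by apply/seteqP; split=> a; rewrite /sfib /stab /= => -[ax ra];
      rewrite ?ra ?ax.
  by rewrite counting_esum; apply: eq_esum => a [/= sa ra]; rewrite ra sa eqxx.
rewrite /counting /stab_card; case: asboolP => // fS.
by rewrite /fset_set; case: pselect => //= _; rewrite cardfs0.
Qed.

Lemma measurable_stab_card : measurable_fun setT (fun x => (stab_card H x)%:R : R).
Proof.
under eq_fun do rewrite stab_cardE.
apply: measurableT_comp => //; apply: (measurable_esum_sfib E) => [a|].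
  by rewrite lee_fin ler0n.
apply/measurable_EFinP.
rewrite (_ : (fun a => _) = \1_[set a | gr H a = gs H a]); last first.
  by apply/funext => a; rewrite indicE; congr (_%:R); congr nat_of_bool;
    apply/eqP/idP; rewrite inE.
apply: measurable_indic; rewrite -[X in measurable X]setTI.
apply: (measurable_fun_eq_set (standard_borelG0 H)) => //.
  exact: measurable_gr.
exact: measurable_gs.
Qed.

Lemma measurable_fun_inv_nat (f : G0 -> R) : measurable_fun setT f ->
  (forall x, 0 <= f x) -> measurable_fun setT (fun x => (f x)^-1).
Proof.
move=> mf f0; rewrite (_ : (fun _ => _) = fun x => f x `^ (-1)).
  exact: measurableT_comp (measurable_powR _) mf.
by apply/funext => x; rewrite powR_inv1.
Qed.

(** A part with infinite sum keeps an infinite sum for [k > 0] and still reads 0 through [fine], so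
    the identity holds for every family. *)
Lemma rsum_ge0Zl (T : choiceType) (A : set T) (k : R) (f : T -> R) : 0 <= k ->
  rsum A (fun a => k * f a) = k * rsum A f.
Proof.
have key (h : T -> R) : 0 <= k -> (forall a, 0 <= h a) ->
    fine (\esum_(a in A) (k * h a)%:E)%E = k * fine (\esum_(a in A) (h a)%:E)%E.
  move=> k0 h0; rewrite ge0_esumZl//.
  have : (0 <= \esum_(a in A) (h a)%:E)%E by apply: esum_ge0 => a _; rewrite lee_fin.
  case: (\esum_(a in A) _)%E => //= _; rewrite mulr0.
  move: k0; rewrite le_eqVlt => /predU1P[<-|k0]; first by rewrite mul0e.
  by rewrite gt0_muley.
move=> k0; rewrite /rsum mulrBr -!key//; try by move=> a; rewrite le_max lexx orbT.
congr (fine _ - fine _); apply: eq_esum => a _.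
  by rewrite maxr_pMr// mulr0.
by rewrite -mulrN maxr_pMr// mulr0.
Qed.

(** * Transport to the fundamental domain *)

Section Transport.
Context (FD : fundamental_domain H) (Hfin : finite_groupoid H).
Local Notation D := (fd_set FD).

Let stabi x : R := (stab_card H x)%:R^-1.

(** The arrows into [y] whose source is the point of the orbit of [y] in [D]
    form a torsor under the stabilizer of that point. *)
Let esum_torsor (g : G0 -> R) y : (forall z, 0 <= g z) -> finite_set (sfib H y) ->
  (\esum_(a in gr H @^-1` [set y])
     (if gs H a \in D then stabi (gs H a) * g (gr H a) else 0)%:E = (g y)%:E)%E.
Proof.
move=> g0 fy.
have forb : finite_set (Defs.orbit H y) by exact: finite_image.
have [x0 [[[b by_ bx] Dx0] ux0]] := @fdP _ _ _ _ _ _ FD y forb.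
have by' : gs H b = y by exact: by_.
pose B := gr H @^-1` [set y] `&` [set a | gs H a \in D].
have BE a : B a -> gr H a = y /\ gs H a = x0.
  move=> [/= ay aD]; split=> //; apply/esym/ux0; split; last by rewrite inE in aD.
  by exists (ginv H a); rewrite ?gr_inv// /sfib /= gs_inv.
have fB : finite_set B.
  apply: (@sub_finite_set _ _ (ginv H @` sfib H y)); last exact: finite_image.
  move=> a /BE[ay _]; exists (ginv H a); rewrite ?ginvK//.
  by rewrite /sfib /= gs_inv.
have s0 z : 0 <= stabi z by rewrite invr_ge0 ler0n.
rewrite (@esum_supp _ _ _ [set a | gs H a \in D]); last 2 first.
- by move=> a; case: ifP => _; rewrite lee_fin ?mulr_ge0.
- by move=> a _ /= /negP/negbTE ->.
rewrite -/B (eq_esum (b := fun a => (stabi x0 * g y * 1)%:E)%E); last first.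
  by move=> a Ba; have [ay ax] := BE a Ba; case: Ba => _ /= ->; rewrite ay ax mulr1.
rewrite ge0_esumZl ?mulr_ge0// -counting_esum.
have cB : counting B = counting (stab H x0) :> \bar R.
  (* [b] goes from [y] to the point [x0] of [D], so composing loops at [x0] with its inverse
     enumerates the arrows from [x0] to [y]. *)
  rewrite !counting_esum; apply: (@reindex_esum _ _ _ _ _ (fun c => gcomp H c (ginv H b))).
  split.
  - move=> c [/= sc rc]; split=> /=.
      by rewrite gr_comp ?gs_inv ?gr_inv// rc.
    by rewrite gs_comp ?gs_inv ?rc// sc inE.
  - move=> c c'; rewrite !inE => -[_ rc] [_ rc'] /(congr1 (fun e => gcomp H e b)).
    by rewrite !gcompKV ?rc ?rc'.
  - move=> a /BE[ra sa]; exists (gcomp H a b).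
      by split; rewrite ?gs_comp ?gr_comp ?ra.
    by rewrite gcompK// ra.
have cfin : (counting B : \bar R)%E = (stab_card H x0)%:R%:E.
  have cBfin : counting B = (#|` fset_set B|)%:R%:E :> \bar R.
    by rewrite /counting asboolT.
  rewrite cB /counting /stab_card; case: asboolP => // iS.
  by move: cB; rewrite cBfin /counting asboolF.
rewrite cfin -EFinM; congr EFin; rewrite /stabi.
suff : (stab_card H x0)%:R != 0 :> R by move=> n0; rewrite mulrAC mulVf// mul1r.
(* The inverse of [b] belongs to [B], so the cardinal in the denominator is not 0. *)
apply/eqP => n0; have : (1 <= counting B :> \bar R)%E.
  rewrite counting_esum; apply: esum_ge; exists [set ginv H b].
    split; first exact: finite_set1.
    by move=> _ ->; split => /=; rewrite ?gr_inv ?gs_inv ?bx ?inE.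
  by rewrite fsbig_set1.
by rewrite cfin n0 lee_fin ler10.
Qed.

Lemma integral_fundamental_domain (t : G0 -> R) :
  mu.-integrable setT (EFin \o t) ->
  mu.-integrable D
    (EFin \o (fun x => rsum (sfib H x) (fun a => t (gr H a)) / (stab_card H x)%:R)) /\
  Rintegral mu D (fun x => rsum (sfib H x) (fun a => t (gr H a)) / (stab_card H x)%:R) =
  Rintegral mu setT t.
Proof.
move=> it; have /(rintegrableP _ _ measurableT)[mt tfin] := it.
have mD : measurable D by exact: measurable_fd.
pose w a := if gs H a \in D then stabi (gs H a) * t (gr H a) else 0.
have s0 z : 0 <= stabi z by rewrite invr_ge0 ler0n.
have mw : measurable_fun setT w.
  apply: (measurable_fun_patch (D := gs H @^-1` D)
    (f := fun a => stabi (gs H a) * t (gr H a))).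
    by rewrite -[X in measurable X]setTI; exact: (measurable_gs H).
  apply: measurable_funTS; apply: measurable_funM.
    apply: measurableT_comp (measurable_gs H).
    by apply: measurable_fun_inv_nat measurable_stab_card _ => x; rewrite ler0n.
  exact: measurableT_comp mt (measurable_gr H).
(* Serves the absolute value, for integrability, and both signed parts, for the value; positive
   homogeneity moves [j] past the weight. *)
have esum_part (j : R -> R) y : (forall z, 0 <= j z) -> j 0 = 0 ->
    (forall k z, 0 <= k -> j (k * z) = k * j z) -> finite_set (sfib H y) ->
    (\esum_(a in gr H @^-1` [set y]) (j (w a))%:E = (j (t y))%:E)%E.
  move=> j_ge0 j0 jM fy; rewrite -(esum_torsor (g := j \o t))//.
    by apply: eq_esum => a _; rewrite /w; case: ifP => _; rewrite ?j0 ?jM.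
  by move=> z; exact: j_ge0.
have iw : (mu1 H).-integrable setT (EFin \o w).
  apply/(rintegrableP _ _ measurableT); split=> //.
  have mnw : measurable_fun setT (fun a => (`|w a|)%:E).
    by apply/measurable_EFinP; exact: measurableT_comp.
  rewrite (ge0_integral_gr E)//; apply: le_lt_trans tfin.
  apply: ae_ge0_le_integral => //.
  - by move=> x _; exact: esum_ge0.
  - exact: (measurable_esum_rfib E).
  - by apply/measurable_EFinP; exact: measurableT_comp.
  apply: filterS Hfin => y fy _; rewrite (esum_part (fun z => `|z|))//.
  - by rewrite normr0.
  - by move=> k z k0; rewrite normrM ger0_norm.
have [_ er] := rsum_integral (measurable_esum_rfib E) (ge0_integral_gr E) iw.
have [is_ es] := rsum_integral (measurable_esum_sfib E) (ge0_integral_gs E) iw.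
have e : (fun x => rsum (sfib H x) w) =
    (fun x => rsum (sfib H x) (fun a => t (gr H a)) / (stab_card H x)%:R) \_ D.
  apply/funext => x; rewrite /patch; case: ifPn => Dx.
    rewrite mulrC -rsum_ge0Zl//; apply: eq_rsum => a ax.
    by rewrite /w ax Dx.
  apply: etrans (rsum0 (sfib H x)); apply: eq_rsum => a ax.
  by rewrite /w ax (negbTE Dx).
split.
  apply/(integrable_mkcond _ mD); apply: eq_integrable is_ => // x _.
  have /= -> := congr1 (fun f => f x) e.
  by rewrite /patch /=; case: ifP.
rewrite [LHS]Rintegral_mkcond -e -es er.
apply: ae_eq_Rintegral => //.
  have [i _] := rsum_integral (measurable_esum_rfib E) (ge0_integral_gr E) iw.
  by move: i => /(rintegrableP _ _ measurableT)[].
apply: filterS Hfin => y fy _; rewrite /rsum.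
rewrite (esum_part (fun z => Num.max z 0))//; last 3 first.
- by move=> z; rewrite le_max lexx orbT.
- by rewrite maxxx.
- by move=> k z k0; rewrite maxr_pMr// mulr0.
rewrite (esum_part (fun z => Num.max (- z) 0))//; last 3 first.
- by move=> z; rewrite le_max lexx orbT.
- by rewrite oppr0 maxxx.
- by move=> k z k0; rewrite -mulrN maxr_pMr// mulr0.
by rewrite /=; case: (lerP (t y) 0); case: (lerP (- t y) 0); lra.
Qed.

End Transport.

End Fibrewise.

Lemma cmeasurable_csum_nat {R : realType} d (X : measurableType d)
    (f : nat -> X -> R[i]) : (forall n, cmeasurable setT (f n)) ->
  cmeasurable setT (fun x => csum setT (fun n => f n x)).
Proof.
have key (h : nat -> X -> R) : (forall n, measurable_fun setT (h n)) ->
    measurable_fun setT (fun x => rsum setT (fun n => h n x)).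
  have part (k : nat -> X -> R) : (forall n, measurable_fun setT (k n)) ->
      measurable_fun setT
        (fun x => fine (\esum_(n in setT) (Num.max (k n x) 0)%:E)%E).
    move=> mk; apply: measurableT_comp => //.
    have k0 n x : (0 <= (Num.max (k n x) 0)%:E)%E.
      by rewrite lee_fin le_max lexx orbT.
    rewrite (_ : (fun x => _) =
      (fun x => \sum_(0 <= n <oo) (Num.max (k n x) 0)%:E)%E).
      apply: ge0_emeasurable_sum => [n x _ _|n _]; first exact: k0.
      by apply/measurable_EFinP; exact: measurable_maxr.
    by apply/funext => x; rewrite nneseries_esumT.
  by move=> mh; apply: measurable_funB; apply: part => // n; exact: measurable_funN.
by move=> mf; split; apply: key => n; have [] := mf n.
Qed.

(** * The trace formula *)

Section Trace.
Context (R : realType) d0 d (G0 : measurableType d0) (G : measurableType d)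
  (H : groupoid R G0 G) (E : edge_cover H).
Local Notation C := R[i].
Local Notation mu := (mu0 H).
Local Notation nu := (mu1 H).
Local Notation ip := (@L2_ip _ _ _ _ _ H).
Implicit Types (F K : G -> C) (p : formal_sum H).

(** Ring elements act by right translations, which commute with left translation by [c]. *)
Lemma fam_act_ltrans p F c b : gr H c = gs H b ->
  fam_act p F (gcomp H c b) = fam_act p (fun a => F (gcomp H c a)) b.
Proof.
move=> cb; apply: eq_bigr => q _; rewrite /edge_act gr_comp//.
case: ifPn => //; rewrite inE => ib.
have be : gr H b = gs H (edge_inv q.1 (gr H b)).
  by have /edge_inv_domP[x px ->] := ib; rewrite edge_invE// gs_inv.
by rewrite -gcompA// /linf_act gr_comp// gs_comp.
Qed.

Lemma fam_act_lin p (k : C) F K a :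
  fam_act p (k *: F + K) a = k * fam_act p F a + fam_act p K a.
Proof.
rewrite /fam_act mulr_sumr -big_split; apply: eq_bigr => q _ /=.
rewrite /edge_act; case: ifP => _; last by rewrite mulr0 addr0.
rewrite /linf_act -[(k *: F + K) _]/(k * F _ + K _); ring.
Qed.

(** Left translation by [a] carries the identity at the range of [a] to [a], and the diagonal
    coefficient along with it. *)
Lemma fam_act_diag p a :
  fam_act p (zeta a) a = fam_act p (zeta (gid H (gr H a))) (gid H (gr H a)).
Proof.
rewrite -{2}(gcompg1 H a) fam_act_ltrans ?gs_id//.
apply: fam_act_fib (gr H a) _ _ _; last by rewrite /sfib /= gs_id.
move=> b bx; rewrite /zeta; congr (_%:R); congr nat_of_bool.
have ab : gr H a = gs H b by rewrite bx.
apply/eqP/eqP => [|->]; last by rewrite gcompg1.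
rewrite -{2}(gcompg1 H a); apply: gcompIl => //; by rewrite gs_id.
Qed.

Definition chi0_fun : G -> C := fun a => (a \in range (gid H))%:R.

Lemma chi0_funE x a : sfib H x a -> chi0_fun a = zeta (gid H x) a.
Proof.
move=> ax; rewrite /chi0_fun /zeta; congr (_%:R); congr nat_of_bool.
apply/idP/eqP => [|->]; last by rewrite inE; exists x.
by rewrite inE => -[z _ zE]; rewrite -zE -ax -zE gs_id.
Qed.

Lemma sfib_gid x : sfib H x (gid H x).
Proof. by rewrite /sfib /= gs_id. Qed.

Lemma sqint_chi0 : sqint H chi0_fun.
Proof.
have m : cmeasurable setT chi0_fun.
  have := cmeasurable_patch (measurable_range_gid H) (cmeasurable_cst (range (gid H)) (1 : C)).
  by apply: eq_cmeasurable => a _; rewrite /chi0_fun; case: ifP.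
split=> //; rewrite (integral_l2norm2 E)//.
under eq_integral => x _.
  rewrite (eq_l2norm2 (chi0_funE (x := x))) l2norm2_zeta; last exact: sfib_gid.
  over.
by rewrite integral_cst// mul1e; exact: fin_num_fun_lty.
Qed.

Lemma chi0E : {ae nu, forall a, chi0 H a = chi0_fun a}.
Proof. exact: L2_classE sqint_chi0. Qed.

(** Restricted to the fibre over [x], [chi0] is the unit vector at the identity of [x], so pairing
    with it is evaluation there. *)
Lemma ip_chi0 (u : L2 H) F : sqint H F -> {ae nu, forall a, u a = F a} ->
  cintegrable mu setT (fun x => F (gid H x)) /\
  ip u (chi0 H) = cintegral mu setT (fun x => F (gid H x)).
Proof.
move=> sF uF.
have e : (fun x => l2ip (sfib H x) F chi0_fun) = (fun x => F (gid H x)).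
  apply/funext => x; rewrite (eq_l2ip (f' := F) (g' := zeta (gid H x)))//.
    by rewrite l2ip_zeta//; exact: sfib_gid.
  exact: chi0_funE.
rewrite -e; split; first exact: (cintegrable_l2ip E sF sqint_chi0).
exact: (L2_ip_ae E sF sqint_chi0 uF chi0E).
Qed.

Lemma ae_integrable_eq (D : set G0) (f g : G0 -> R) : measurable D ->
  mu.-integrable D (EFin \o f) -> measurable_fun D g ->
  {ae mu, forall x, D x -> g x = f x} ->
  mu.-integrable D (EFin \o g) /\ Rintegral mu D g = Rintegral mu D f.
Proof.
move=> mD /[dup] fi /(rintegrableP _ _ mD)[mf ioo] mg gf; split; last first.
  exact: ae_eq_Rintegral.
apply/(rintegrableP _ _ mD); split=> //; apply: le_lt_trans ioo.
apply: ae_ge0_le_integral => //.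
- by apply/measurable_EFinP; exact: measurableT_comp.
- by apply/measurable_EFinP; exact: measurableT_comp.
- by apply: filterS gf => x gf Dx; rewrite gf.
Qed.

Lemma Re_divn (z : C) n : complex.Re (z / n%:R) = complex.Re z / n%:R.
Proof.
have -> : (n%:R : C) = (n%:R : R)%:C%C by rewrite rmorph_nat.
by rewrite -fmorphV Defs.ReM /= mulr0 subr0.
Qed.

Lemma Im_divn (z : C) n : complex.Im (z / n%:R) = complex.Im z / n%:R.
Proof.
have -> : (n%:R : C) = (n%:R : R)%:C%C by rewrite rmorph_nat.
by rewrite -fmorphV Defs.ImM /= mulr0 add0r.
Qed.

Section Main.
Context (FD : fundamental_domain H) (Hfin : finite_groupoid H).
Local Notation D := (fd_set FD).
Context (p : formal_sum H).

Let t x : C := fam_act p (zeta (gid H x)) (gid H x).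

Let traceE : cintegrable mu setT t /\ trace (op_of p) = cintegral mu setT t.
Proof.
have sf := sqint_fam_act E p sqint_chi0.
have e : (fun x => fam_act p chi0_fun (gid H x)) = t.
  apply/funext => x; apply: (fam_act_fib p) (sfib_gid x) => a.
  exact: chi0_funE.
rewrite -e; apply: ip_chi0 => //.
have /(ae_sfib E _) h1 := op_ofE E p (chi0 H).
have /(ae_sfib E _) h2 := chi0E.
apply/(ae_sfib E _); apply: filterS2 h1 h2 => x h1 h2 a ax.
by rewrite h1//; apply: fam_act_fib ax.
Qed.

Lemma conv_trE x : conv_tr p x = \sum_(a \in sfib H x) t (gr H a).
Proof.
apply: eq_fsbigr => a; rewrite inE => ax.
by rewrite convE// fam_act_diag.
Qed.

Lemma trace_fundamental_domain :
  cintegrable mu D (fun x => conv_tr p x / (stab_card H x)%:R) /\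
  trace (op_of p) = cintegral mu D (fun x => conv_tr p x / (stab_card H x)%:R).
Proof.
have mD : measurable D by exact: measurable_fd.
have [[t1 t2] ->] := traceE.
have [mt1 mt2] := cintegrable_cmeasurable measurableT (conj t1 t2).
(* Equality almost everywhere with a measurable function, as in [fin_tr], does not by itself give
   measurability, hence the separate argument. *)
have mtr : cmeasurable setT (fun x => conv_tr p x).
  apply: (@eq_cmeasurable _ _ _ _ (fun x => \sum_(a \in sfib H x) t (gr H a))).
    by move=> x _; rewrite conv_trE.
  apply: (cmeasurable_fsbig_sfib E).
  exact: (cmeasurable_comp (conj mt1 mt2) (measurable_gr H)).
have mi : measurable_fun D (fun x => (stab_card H x)%:R^-1 : R).
  apply: measurable_funTS; apply: measurable_fun_inv_nat (measurable_stab_card E) _.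
  by move=> x; rewrite ler0n.
have fin_tr : {ae mu, forall x, conv_tr p x = csum (sfib H x) (fun a => t (gr H a))}.
  by apply: filterS Hfin => x fx; rewrite conv_trE csum_fset.
case: mtr => mr mI.
have [i1 e1] := integral_fundamental_domain E FD Hfin t1.
have [i2 e2] := integral_fundamental_domain E FD Hfin t2.
have [j1 f1] : mu.-integrable D (EFin \o (fun x => complex.Re (conv_tr p x / (stab_card H x)%:R))) /\
    Rintegral mu D (fun x => complex.Re (conv_tr p x / (stab_card H x)%:R)) =
    Rintegral mu setT (fun x => complex.Re (t x)).
  rewrite -e1; apply: ae_integrable_eq => //.
    under eq_fun do rewrite Re_divn.
    by apply: measurable_funM => //; exact: measurable_funTS.
  by apply: filterS fin_tr => x h _; rewrite Re_divn h.
have [j2 f2] : mu.-integrable D (EFin \o (fun x => complex.Im (conv_tr p x / (stab_card H x)%:R))) /\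
    Rintegral mu D (fun x => complex.Im (conv_tr p x / (stab_card H x)%:R)) =
    Rintegral mu setT (fun x => complex.Im (t x)).
  rewrite -e2; apply: ae_integrable_eq => //.
    under eq_fun do rewrite Im_divn.
    by apply: measurable_funM => //; exact: measurable_funTS.
  by apply: filterS fin_tr => x h _; rewrite Im_divn h.
by split=> //; rewrite /cintegral f1 f2.
Qed.

End Main.
End Trace.

(** * Kernel projections *)

Section Kernel.
Context (R : realType) d0 d (G0 : measurableType d0) (G : measurableType d)
  (H : groupoid R G0 G) (E : edge_cover H) (p : formal_sum H).
Local Notation C := R[i].
Local Notation mu := (mu0 H).
Local Notation nu := (mu1 H).
Local Notation ip := (@L2_ip _ _ _ _ _ H).
Local Notation PH := (L2_prehilbert H).
Local Notation fip x := (l2ip (sfib H x) : (G -> C) -> (G -> C) -> C).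
Local Notation fPH x := (l2_prehilbert (sfib H x)).
Implicit Types (F K : G -> C).

(** On the fibre over [x], the vector [rows n] is the conjugate of row [E n x]
    of the matrix of [T_x], so that [ker T_x] is its orthogonal complement. *)
Definition rows n : G -> C := fun c =>
  if gs H c \in edge_dom (E n) then conjc (fam_act p (zeta c) (E n (gs H c)))
  else 0.

Lemma rows_out x n c : ~ edge_dom (E n) x -> sfib H x c -> rows n c = 0.
Proof. by move=> nx cx; rewrite /rows cx memNset. Qed.

Lemma rows_fib x n c : edge_dom (E n) x -> sfib H x c ->
  rows n c = conjc (fam_act p (zeta c) (E n x)).
Proof. by move=> nx cx; rewrite /rows cx mem_set. Qed.

(** Finite support puts the rows in l^2 and lets inner products with them pass to pointwise limits
    of residuals. *)
Lemma rows_finite x n : finite_set (sfib H x `&` [set c | rows n c <> 0]).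
Proof.
apply: sub_finite_set (fam_act_zeta_finite p (E n x)) => c [cx /= rc].
have [nx|nx] := pselect (edge_dom (E n) x); last by rewrite (rows_out nx cx) in rc.
by move=> f0; apply: rc; rewrite (rows_fib nx cx) f0 conjc0.
Qed.

Lemma fin2_rows x n : fin2 (sfib H x) (rows n).
Proof. exact/fin2_fset/rows_finite. Qed.

Lemma ip_rows x n F : edge_dom (E n) x ->
  fip x F (rows n) = fam_act p F (E n x).
Proof.
move=> nx; have sx : gs H (E n x) = x by exact: gs_edge.
rewrite -(convE _ _ sx) /Defs.conv.
under eq_fsbigr do rewrite conv_zetaE.
pose S := sfib H x `&` [set c | fam_act p (zeta c) (E n x) <> 0].
have fS : finite_set S by apply: finite_setIr; exact: fam_act_zeta_finite.
rewrite /l2ip (@csum_supp _ _ (sfib H x) S); last 2 first.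
- by move=> a [].
- move=> a ax na; rewrite (rows_fib nx ax) conjcK.
  have -> : fam_act p (zeta a) (E n x) = 0 by apply: contrapT => h; apply: na.
  by rewrite mulr0.
rewrite csum_fset// -(@fsbig_widen _ _ _ _ S (sfib H x)); last 2 first.
- by move=> a [].
- move=> a [/= ax na].
  have -> : fam_act p (zeta a) (E n x) = 0 by apply: contrapT => h; apply: na.
  by rewrite mulr0.
by apply: eq_fsbigr => a; rewrite inE => -[ax _]; rewrite (rows_fib nx ax) conjcK.
Qed.

Lemma ip_rows_out x n F : ~ edge_dom (E n) x -> fip x F (rows n) = 0.
Proof.
move=> nx; rewrite (eq_l2ip (f' := F) (g' := 0)) ?l2ip0// => a ax.
exact: rows_out nx ax.
Qed.

(** An edge of [p] contributes at [c] only when [c] is the translate of [E n (gs H c)] by its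
    inverse; this equation is a measurable condition on [c]. *)
Lemma cmeasurable_rows n : cmeasurable setT (rows n).
Proof.
pose D := gs H @^-1` edge_dom (E n).
have mD : measurable D by exact: measurable_edge_dom_s.
apply: (cmeasurable_patch (A := D)
  (f := fun c => conjc (fam_act p (zeta c) (E n (gs H c))))) => //.
apply: cmeasurable_conj; apply: cmeasurable_sum => q.
have me : measurable_fun D (fun c => E n (gs H c)).
  by apply: measurable_fun_edge => //; exact: measurable_funTS (measurable_gs H).
pose B := D `&` [set c | edge_inv_dom q.1 (gr H (E n (gs H c)))].
have mB : measurable B.
  apply: (measurable_preimage (f := fun c => gr H (E n (gs H c)))) => //.
    exact: (measurable_edge_inv_dom E).
  exact: measurableT_comp (measurable_gr H) me.
pose A := B `&` [set c | rtransV q.1 (E n (gs H c)) = c].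
have mA : measurable A.
  apply: (measurable_fun_eq_set (standard_borelG H)) => //.
  apply: (measurable_comp (F := gr H @^-1` edge_inv_dom q.1) (f := rtransV q.1)).
  - exact: (measurable_inv_dom_r E).
  - by move=> _ [c [_ Bc] <-].
  - exact: (@measurable_rtransV _ _ _ _ _ _ E).
  - by apply: measurable_funS me => // c [].
have [m1 m2] : cmeasurable setT (fun c => if c \in A then q.2 (gr H c) else 0).
  apply: (cmeasurable_patch (f := fun c => q.2 (gr H c))) => //.
  have [m1 m2] := cmeasurable_comp (cmeasurable_linf q.2) (measurable_gr H).
  by split; exact: measurable_funTS.
apply: (@eq_cmeasurable _ _ _ _ (fun c => if c \in A then q.2 (gr H c) else 0));
  last by split; exact: measurable_funTS.
move=> c Dc; rewrite /edge_act /linf_act -/(rtransV _ _) /zeta.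
have [Ac|Ac] := pselect (A c).
  have [[_ ib] /= ec] := Ac.
  by rewrite !mem_set// ec eqxx mulr1.
rewrite memNset//; case: ifPn => //; rewrite inE => ib.
case: eqP => [ec|_]; last by rewrite mulr0.
by exfalso; apply: Ac.
Qed.

Definition basis x : nat -> G -> C := gram_schmidt (fip x) rows.

Lemma ortho_basis x : ortho_seq (fin2 (sfib H x)) (fip x) (basis x).
Proof. exact: (gs_ortho_seq (fPH x) (fin2_rows x)). Qed.

Lemma basisE x n :
  basis x n = normalise (fip x) (residual (fip x) (basis x) (rows n) n).
Proof. exact: gsE. Qed.

Lemma ortho_basis_rows x F : fin2 (sfib H x) F ->
  (forall n, fip x (rows n) F = 0) -> forall n, fip x (basis x n) F = 0.
Proof. exact: (ortho_gs (fPH x) (fin2_rows x)). Qed.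

Lemma ortho_basis_rows_inv x F n : fin2 (sfib H x) F ->
  (forall k, (k <= n)%N -> fip x (basis x k) F = 0) -> fip x (rows n) F = 0.
Proof. exact: (ortho_gs_inv (fPH x) (fin2_rows x)). Qed.

(* Otherwise unification unfolds the Gram-Schmidt recursion. *)
#[local] Opaque basis.

(** Glues the bases of all fibres into functions on arrows, for which measurability can be
    stated. *)
Definition basis_field n : G -> C := fun c => basis (gs H c) n c.

Lemma basis_fieldE x n c : sfib H x c -> basis_field n c = basis x n c.
Proof. by move=> cx; rewrite /basis_field cx. Qed.

Lemma cmeasurable_fip F K : cmeasurable setT F -> cmeasurable setT K ->
  cmeasurable setT (fun x => fip x F K).
Proof.
move=> mF mK; apply: (cmeasurable_csum_sfib E (f := fun a => F a * conjc (K a))).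
exact: cmeasurableM mF (cmeasurable_conj mK).
Qed.

Lemma cmeasurable_basis n : cmeasurable setT (basis_field n).
Proof.
elim/ltn_ind: n => n IH.
pose res c := rows n c -
  \sum_(k < n) fip (gs H c) (rows n) (basis_field k) * basis_field k c.
have mr : cmeasurable setT res.
  have ms : cmeasurable setT (fun c =>
      \sum_(k < n) fip (gs H c) (rows n) (basis_field k) * basis_field k c).
    apply: cmeasurable_sum => k; apply: cmeasurableM; last exact: IH.
    apply: (cmeasurable_comp (f := fun x => fip x (rows n) (basis_field k)))
      (measurable_gs H).
    by apply: cmeasurable_fip; [exact: cmeasurable_rows|exact: IH].
  have := cmeasurable_lin (-1) ms (cmeasurable_rows n).
  by apply: eq_cmeasurable => c _; rewrite mulN1r addrC.
have resE x c : sfib H x c ->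
    res c = residual (fip x) (basis x) (rows n) n c.
  move=> cx; apply/esym/(etrans (residualE _ _ _ _ _)); rewrite /res cx.
  apply: (f_equal2 (fun u v : C => u - v) erefl); apply: eq_bigr => k _.
  apply: (f_equal2 (fun u v : C => u * v)); last exact/esym/basis_fieldE.
  exact: (eq_l2ip (fun _ _ => erefl) (fun a ax => esym (basis_fieldE k ax))).
pose N x := (Num.sqrt (fine (l2norm2 (sfib H x) res)))^-1.
have mN : measurable_fun setT N.
  (* As a real power, the inverse square root is measurable also where the norm vanishes. *)
  rewrite (_ : N = (fun x => fine (l2norm2 (sfib H x) res) `^ (- 2^-1))).
    apply: measurableT_comp (measurable_powR _) _; apply: measurableT_comp => //.
    exact: (measurable_l2norm2_sfib E).
  apply/funext => x; rewrite powRN powR12_sqrt// fine_ge0 ?l2norm2_ge0//.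
have [m1 m2] : cmeasurable setT (fun c => (N (gs H c))%:C%C * res c).
  apply: cmeasurableM => //; split; last exact: measurable_cst.
  exact: measurableT_comp mN (measurable_gs H).
apply: (@eq_cmeasurable _ _ _ _ (fun c => (N (gs H c))%:C%C * res c)) => // c _.
have cx : sfib H (gs H c) c by [].
rewrite /basis_field basisE.
rewrite -[RHS]/(_%:C%C * residual (fip (gs H c)) (basis (gs H c)) (rows n) n c).
rewrite -(resE _ _ cx) l2_nrm2; congr (_%:C%C * _); rewrite /N; congr (_^-1).
congr (Num.sqrt (fine _)); apply: eq_l2norm2 => a ax; exact: resE.
Qed.

Lemma ortho_basis_kernel x F : fin2 (sfib H x) F ->
  (forall b, sfib H x b -> fam_act p F b = 0) ->
  forall n, fip x (basis x n) F = 0.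
Proof.
move=> fF F0; apply: ortho_basis_rows fF _ => n.
rewrite l2ip_herm; have [nx|nx] := pselect (edge_dom (E n) x).
  by rewrite ip_rows// F0 ?conjc0//; exact: gs_edge.
by rewrite ip_rows_out// conjc0.
Qed.

(** The arrow [b] is some [E n x], where the value of [fam_act p] is the inner product with
    [rows n]; all late residuals are orthogonal to that row. *)
Lemma fam_act_proj_orth x F b : fin2 (sfib H x) F -> sfib H x b ->
  fam_act p (proj_orth (sfib H x) (basis x) F) b = 0.
Proof.
move=> fF bx; have [_ _ /(_ b bx)[n /= nx <-]] := sfib_bij E x.
rewrite -ip_rows//; apply: (proj_orth_ortho (ortho_basis x) fF).
  exact: rows_finite.
(* [rows n] involves the basis vectors up to index [n] included. *)
exists n.+1 => m nm.
have Sr := residualS (fPH x) (ortho_basis x) m fF.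
rewrite l2ip_herm; apply/eqP; rewrite conjc_eq0; apply/eqP.
apply: (ortho_basis_rows_inv Sr) => k kn.
rewrite l2ip_herm; apply/eqP; rewrite conjc_eq0; apply/eqP.
apply: (residual_ortho (fPH x) (ortho_basis x) fF).
exact: leq_ltn_trans kn nm.
Qed.

Lemma conv_kerP x k : conv_ker p x k <->
  l2 (sfib H x) k /\ (forall b, sfib H x b -> fam_act p k b = 0).
Proof.
split=> [[lk /= ck]|[lk ck]]; split=> //=.
  by move=> b bx; rewrite -(convE _ _ bx) ck.
apply/funext => b; have [bx|bx] := pselect (sfib H x b).
  by rewrite (convE _ _ bx) ck.
by rewrite conv_out.
Qed.

(** The diagonal coefficient at [a] of the projection onto [ker T_x], with [x] the source of [a]. *)
Definition kernel_diag a : R := proj_diag (basis (gs H a)) a.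

Lemma kernel_diagE x a : sfib H x a -> kernel_diag a = proj_diag (basis x) a.
Proof. by move=> ax; rewrite /kernel_diag ax. Qed.

Lemma kernel_diag_ge0 a : 0 <= kernel_diag a.
Proof. exact: (proj_diag_ge0 (ortho_basis (gs H a))). Qed.

Lemma kernel_diag_le x k a : conv_ker p x k -> sfib H x a ->
  normsq (k a) <= kernel_diag a * fine (l2norm2 (sfib H x) k).
Proof.
move=> /conv_kerP[[_ fk] k0] ax; rewrite (kernel_diagE ax).
apply: (proj_diag_reproducing (ortho_basis x)) => //.
exact: ortho_basis_kernel.
Qed.

Lemma kernel_diag_ge x a : sfib H x a -> exists2 k, conv_ker p x k &
  k a = (kernel_diag a)%:C%C /\ fine (l2norm2 (sfib H x) k) <= kernel_diag a.
Proof.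
move=> ax; pose P := proj_orth (sfib H x) (basis x) (zeta a).
(* [proj_orth] has meaning on the fibre only, while members of [conv_ker] have to vanish outside
   it. *)
pose k : G -> C := fun b => if b \in sfib H x then P b else 0.
have kP b : sfib H x b -> k b = P b by move=> bx; rewrite /k mem_set.
have fz := fin2_zeta (R := R) (sfib H x) a.
have fP : fin2 (sfib H x) P by exact: (fin2_proj_orth (ortho_basis x)).
exists k.
  apply/conv_kerP; split.
    split=> [b bx|]; first by rewrite /k memNset.
    by rewrite (eq_l2norm2 kP).
  move=> b bx; rewrite (fam_act_fib p kP bx).
  exact: fam_act_proj_orth.
rewrite kP// (eq_l2norm2 kP) (kernel_diagE ax); split.
  exact: proj_orth_zeta_diag.
exact: (proj_orth_zeta_norm (ortho_basis x)).
Qed.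

Lemma dimension_conv_ker x : (dimension (conv_ker p x))%:R =
  fine (\esum_(a in sfib H x) (kernel_diag a)%:E)%E.
Proof.
apply: dimension_esum.
- apply/conv_kerP; split.
    by split=> //; exact: fin2_0.
  move=> b bx; rewrite /fam_act big1// => q _.
  by rewrite /edge_act; case: ifP => // _; rewrite /linf_act mulr0.
- move=> c u v /conv_kerP[[u0 fu] ku] /conv_kerP[[v0 fv] kv].
  apply/conv_kerP; split.
    split=> [b bx|]; last exact: fin2_lin.
    by rewrite -[LHS]/(c * u b + v b) u0// v0// mulr0 addr0.
  by move=> b bx; rewrite fam_act_lin ku// kv// mulr0 addr0.
- by move=> k [].
- by move=> k a; exact: kernel_diag_le.
- exact: kernel_diag_ge.
Qed.

(** Left translation by [c] identifies [ker T_x] with [ker T_y]; as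
    [kernel_diag] is determined by [kernel_diag_le] and [kernel_diag_ge], it
    is invariant. *)
Lemma kernel_diag_ltrans c b : gr H c = gs H b ->
  kernel_diag (gcomp H c b) <= kernel_diag b.
Proof.
move=> cb; set x := gs H c; set y := gs H b.
have cbx : sfib H x (gcomp H c b) by rewrite /sfib /= gs_comp.
have [k /conv_kerP[[k0 fk] kk] [kE kn]] := kernel_diag_ge cbx.
(* The extremal vector at [gcomp H c b], translated back to the fibre over [y], is a competitor at
   [b]. *)
pose k' : G -> C := fun a => if a \in sfib H y then k (gcomp H c a) else 0.
have k'E a : sfib H y a -> k' a = k (gcomp H c a) by move=> ay; rewrite /k' mem_set.
have bij : set_bij (sfib H y) (sfib H x) (gcomp H c).
  split.
  - by move=> a ay; rewrite /sfib /= gs_comp// cb ay.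
  - by move=> a a'; rewrite !inE => ay a'y; apply: gcompIl; rewrite cb ?ay ?a'y.
  - move=> a ax; exists (gcomp H (ginv H c) a).
      by rewrite /sfib /= gs_comp ?gs_inv// gr_inv; exact/esym.
    by rewrite gcompVK.
have nk : l2norm2 (sfib H y) k' = l2norm2 (sfib H x) k.
  rewrite /l2norm2 (reindex_esum _ _ _ _ bij); apply: eq_esum => a ay.
  by rewrite k'E.
have Kk' : conv_ker p y k'.
  apply/conv_kerP; split.
    split=> [a ay|]; first by rewrite /k' memNset.
    by rewrite nk.
  move=> a ay; rewrite (fam_act_fib p k'E ay).
  have ca : gr H c = gs H a by rewrite cb ay.
  apply: (etrans (esym (fam_act_ltrans p k ca))); apply: kk.
  by rewrite /sfib /= gs_comp.
have := kernel_diag_le Kk' (erefl : sfib H y b).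
rewrite nk k'E// kE /normsq /= expr0n addr0 expr2 => h.
have q0 := kernel_diag_ge0 (gcomp H c b).
have [->|qn0] := eqVneq (kernel_diag (gcomp H c b)) 0; first exact: kernel_diag_ge0.
have qp : 0 < kernel_diag (gcomp H c b) by rewrite lt_neqAle eq_sym qn0.
rewrite -(ler_pM2r qp); apply: le_trans h _.
by rewrite ler_wpM2l// kernel_diag_ge0.
Qed.

(** Translating the identity by [a] gives one inequality, translating [a] by its inverse the
    other. *)
Lemma kernel_diag_invariant a : kernel_diag a = kernel_diag (gid H (gr H a)).
Proof.
apply/eqP; rewrite eq_le; apply/andP; split.
  by rewrite -{1}(gcompg1 H a); apply: kernel_diag_ltrans; rewrite gs_id.
by rewrite -(gcompVg H a); apply: kernel_diag_ltrans; rewrite gr_inv.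
Qed.

Definition ker_proj F : G -> C := fun b =>
  proj_orth (sfib H (gs H b)) (basis (gs H b)) F b.

Lemma ker_projE F x b : sfib H x b ->
  ker_proj F b = proj_orth (sfib H x) (basis x) F b.
Proof. by move=> bx; rewrite /ker_proj bx. Qed.

Lemma ker_proj_fib F K x : (forall a, sfib H x a -> F a = K a) ->
  forall a, sfib H x a -> ker_proj F a = ker_proj K a.
Proof.
move=> FK a ax; rewrite !(ker_projE _ ax) /proj_orth FK//; congr (_ - _).
by apply: eq_csum => n _; congr (_ * _); exact: eq_l2ip.
Qed.

Lemma sqint_ker_proj F : sqint H F -> sqint H (ker_proj F).
Proof.
move=> sF; have [mF iF] := sF.
have mP : cmeasurable setT (ker_proj F).
  have mc : cmeasurable setT (fun b => csum setT (fun n =>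
      fip (gs H b) F (basis_field n) * basis_field n b)).
    apply: cmeasurable_csum_nat => n; apply: cmeasurableM.
      apply: (cmeasurable_comp (f := fun x => fip x F (basis_field n)))
        (measurable_gs H).
      exact: cmeasurable_fip mF (cmeasurable_basis n).
    exact: cmeasurable_basis.
  have := cmeasurable_lin (-1) mc mF; apply: eq_cmeasurable => b _.
  rewrite mulN1r addrC; apply: (f_equal2 (fun u v : C => u - v) erefl).
  apply: eq_csum => n _; apply: (f_equal2 (fun u v : C => u * v)) erefl.
  exact: (eq_l2ip (fun _ _ => erefl) (fun a ax => basis_fieldE n ax)).
split=> //; apply: le_lt_trans iF; rewrite !(integral_l2norm2 E)//.
apply: ae_ge0_le_integral => //.
- by move=> x _; exact: l2norm2_ge0.
- exact: (measurable_l2norm2_sfib E).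
- by move=> x _; exact: l2norm2_ge0.
- exact: (measurable_l2norm2_sfib E).
apply: filterS (sqint_fin2 E sF) => x fx _.
rewrite (eq_l2norm2 (ker_projE F (x := x))).
exact: (proj_orth_le (ortho_basis x)).
Qed.

Definition ker_proj_op (u : L2 H) : L2 H := L2_class H (ker_proj u).

Lemma ker_proj_opE (u : L2 H) : {ae nu, forall a, ker_proj_op u a = ker_proj u a}.
Proof. exact/L2_classE/sqint_ker_proj/L2P. Qed.

Lemma op_of_ker_proj (u : L2 H) : op_of p (ker_proj_op u) = 0.
Proof.
apply/L2_eqP/(ae_sfib E _).
have /(ae_sfib E _) h1 := op_ofE E p (ker_proj_op u).
have /(ae_sfib E _) h2 := ker_proj_opE u.
have /(ae_sfib E _) h3 := L2_0E H.
have h4 := sqint_fin2 E (L2P u).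
move: h1; apply: filter_app; move: h2; apply: filter_app.
move: h3; apply: filter_app; apply: filterS h4 => x h4 h3 h2 h1 a ax.
rewrite h1// h3// (fam_act_fib p h2 ax) (fam_act_fib p (ker_projE u (x := x)) ax).
exact: fam_act_proj_orth.
Qed.

Lemma ker_proj_orthogonal (u w : L2 H) : op_of p w = 0 ->
  ip (u - ker_proj_op u) w = 0.
Proof.
move=> w0.
have /(ae_sfib E _) h1 := op_ofE E p w; rewrite w0 in h1.
have /(ae_sfib E _) h2 := ker_proj_opE u.
have /(ae_sfib E _) h3 := L2_0E H.
have h4 := sqint_fin2 E (L2P u); have h5 := sqint_fin2 E (L2P w).
have /(ae_sfib E _) h6 := L2_linE (-1) (ker_proj_op u) u.
have m := cintegrable_cmeasurable measurableT
  (cintegrable_l2ip E (L2P (u - ker_proj_op u)) (L2P w)).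
rewrite (L2_ipE E) (ae_eq_cintegral measurableT m (cmeasurable_cst setT 0))//; last first.
  move: h1; apply: filter_app; move: h2; apply: filter_app.
  move: h3; apply: filter_app; move: h4; apply: filter_app.
  move: h5; apply: filter_app; apply: filterS h6.
  move=> x h6 h5 h4 h3 h2 h1 _.
  have kw b : sfib H x b -> fam_act p w b = 0.
    by move=> bx; rewrite -h1// h3.
  rewrite -[RHS](proj_orth_ip (ortho_basis x) h4 h5 (ortho_basis_kernel h5 kw)).
  apply: eq_l2ip => // a ax.
  rewrite -[RHS]/(u a - _ a) -(ker_projE u ax) -h2// addrC.
  by move: (h6 a ax); rewrite scaleN1r mulN1r => ->; rewrite addrC.
by apply: complex_eq; rewrite /cintegral /Rintegral /= integral0.
Qed.

(** * The dimension formula *)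

Section Dim.
Context (FD : fundamental_domain H) (Hfin : finite_groupoid H).
Local Notation D := (fd_set FD).
Hypothesis ring_T : ring_like (op_of p).

Let T := op_of p.

Let adjointP : forall u v, ip (T u) v = ip u (adjoint ip T v).
Proof.
apply: (@xgetPex _ 0 [set B | forall u v, ip (T u) v = ip u (B v)]).
exact: rl_adjoint ring_T.
Qed.

Let I (u : L2 H) : [set: L2 H] u. Proof. by []. Qed.

Let ker_adjoint (u : L2 H) : (adjoint ip T \o T) u = 0 <-> T u = 0.
Proof.
split=> [Tu|/= ->].
  apply: L2_definite; rewrite /nrm2 adjointP -[adjoint _ _ _]/((adjoint ip T \o T) u).
  by rewrite Tu (ph_ip0r PH).
(* The chosen adjoint is known only through its defining identity, so that it sends 0 to 0 is
   derived from definiteness. *)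
apply: L2_definite; rewrite /nrm2 -adjointP (ph_ip0r PH)//.
Qed.

(** [ker_proj_op] shows that an orthogonal projection exists. The difference of two candidates at
    [u] lies in the kernel and is orthogonal to it, hence is 0. *)
Let orthoprojE u : orthoproj ip (ker (adjoint ip T \o T)) u = ker_proj_op u.
Proof.
set K := ker _; set Q := orthoproj _ _.
have QP : forall v, K (Q v) /\ forall w, K w -> ip (v - Q v) w = 0.
  apply: (@xgetPex _ 0 [set P | forall v, K (P v) /\
    forall w, K w -> ip (v - P v) w = 0]).
  exists ker_proj_op => v; split.
    exact/ker_adjoint/op_of_ker_proj.
  by move=> w /ker_adjoint; exact: ker_proj_orthogonal.
have [/ker_adjoint TQ oQ] := QP u.
set P := ker_proj_op u; have TP : T P = 0 by exact: op_of_ker_proj.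
set w := Q u - P.
have Tw : T w = 0.
  rewrite /w addrC -scaleN1r; apply: (etrans (rl_linear ring_T (-1) P (Q u))).
  by rewrite -[op_of p P]/(T P) -[op_of p (Q u)]/(T (Q u)) TP TQ scaler0 addr0.
apply/eqP; rewrite -subr_eq0; apply/eqP; apply: L2_definite; rewrite -/w.
have h1 : ip (u - Q u) w = 0 by apply: oQ; exact/ker_adjoint.
have h2 : ip (u - P) w = 0 by exact: ker_proj_orthogonal.
have e : ip w w = ip (u - P) w - ip (u - Q u) w.
  rewrite -(ph_ipBl PH (I (u - P)) (I (u - Q u)) (I w)); congr (ip _ w).
  by rewrite /w opprB [RHS]addrC addrA subrK.
by rewrite /nrm2 e h1 h2 subrr.
Qed.

Let t x : R := kernel_diag (gid H x).

Let dim_vNE : cintegrable mu setT (fun x => (t x)%:C%C) /\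
  dim_vN_ker T = cintegral mu setT (fun x => (t x)%:C%C).
Proof.
have s0 := sqint_ker_proj (sqint_chi0 E).
have e : (fun x => ker_proj (chi0_fun H) (gid H x)) = (fun x => (t x)%:C%C).
  apply/funext => x; rewrite (ker_proj_fib (chi0_funE (x := x)) (sfib_gid H x)).
  rewrite (ker_projE _ (sfib_gid H x)).
  rewrite (proj_orth_zeta_diag _ (sfib_gid H x)).
  by rewrite /t (kernel_diagE (sfib_gid H x)).
rewrite /dim_vN_ker /dim_vN_ker_sa /trace orthoprojE -e.
apply: (ip_chi0 E s0).
have /(ae_sfib E _) h1 := ker_proj_opE (chi0 H).
have /(ae_sfib E _) h2 := chi0E E.
apply/(ae_sfib E _); apply: filterS2 h1 h2 => x h1 h2 a ax.
by rewrite h1//; apply: ker_proj_fib ax.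
Qed.

Lemma dim_fundamental_domain :
  cintegrable mu D (fun x => (dimension (conv_ker p x))%:R / (stab_card H x)%:R) /\
  dim_vN_ker (op_of p) =
  cintegral mu D (fun x => (dimension (conv_ker p x))%:R / (stab_card H x)%:R).
Proof.
have [[t1 t2] ->] := dim_vNE.
have [i1 e1] := integral_fundamental_domain E FD Hfin t1.
have [i2 e2] := integral_fundamental_domain E FD Hfin t2.
(* This holds on every fibre, infinite ones included, because [dimension] and [fine] have matching
   conventions. *)
have re x : complex.Re ((dimension (conv_ker p x))%:R / (stab_card H x)%:R : C) =
    rsum (sfib H x) (fun a => t (gr H a)) / (stab_card H x)%:R.
  rewrite Re_divn; congr (_ / _).
  have -> : complex.Re ((dimension (conv_ker p x))%:R : C) =
      (dimension (conv_ker p x))%:R.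
    have -> : ((dimension (conv_ker p x))%:R : C) =
      ((dimension (conv_ker p x))%:R : R)%:C%C by rewrite rmorph_nat.
    by [].
  rewrite dimension_conv_ker rsum_ge0E => [|a _]; last exact: kernel_diag_ge0.
  by congr fine; apply: eq_esum => a _; rewrite /t kernel_diag_invariant.
have im x : complex.Im ((dimension (conv_ker p x))%:R / (stab_card H x)%:R : C) =
    rsum (sfib H x) (fun a => 0 : R) / (stab_card H x)%:R.
  rewrite Im_divn; congr (_ / _); rewrite rsum0.
  have -> : ((dimension (conv_ker p x))%:R : C) =
    ((dimension (conv_ker p x))%:R : R)%:C%C by rewrite rmorph_nat.
  by [].
split.
  split; first by apply: eq_integrable i1 => [|x _]; [exact: measurable_fd|rewrite /= re].
  by apply: eq_integrable i2 => [|x _]; [exact: measurable_fd|rewrite /= im].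
apply: complex_eq; rewrite /cintegral /=.
  by rewrite -e1; apply: eq_Rintegral => x _; rewrite re.
by rewrite -e2; apply: eq_Rintegral => x _; rewrite im.
Qed.

End Dim.
End Kernel.

Theorem proposition2p10 (R : realType) (d0 d : measure_display)
    (G0 : measurableType d0) (G : measurableType d) (H : groupoid R G0 G)
    (E : edge_cover H) (D : fundamental_domain H)
    (Hfin : finite_groupoid H) :
  (exists rho : (L2 H -> L2 H) -> (dint E D -> dint E D),
     star_representation rho /\
     forall (T : L2 H -> L2 H) (p : formal_sum H),
       groupoid_ring T -> T = op_of p -> rho T = dint_conv p) /\
  (forall (T : L2 H -> L2 H) (p : formal_sum H),
     groupoid_ring T -> T = op_of p ->
     cintegrable (mu0 H) D (fun x => conv_tr p x / (stab_card H x)%:R) /\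
     trace T =
       cintegral (mu0 H) D (fun x => conv_tr p x / (stab_card H x)%:R)) /\
  (forall (T : L2 H -> L2 H) (p : formal_sum H),
     groupoid_ring T -> T = op_of p ->
     cintegrable (mu0 H) D
       (fun x => (dimension (conv_ker p x))%:R / (stab_card H x)%:R) /\
     dim_vN_ker T =
       cintegral (mu0 H) D
         (fun x => (dimension (conv_ker p x))%:R / (stab_card H x)%:R)).
Proof.
split.
  exists (@compress _ _ _ _ _ H E D); split.
    exact: compress_star_representation.
  by move=> T p _ ->; exact: compress_op_of.
split=> T p ringT Tp; rewrite Tp.
  exact: trace_fundamental_domain.
apply: dim_fundamental_domain => //; rewrite -Tp.
exact: (ring_like_groupoid_ring E).
Qed.
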